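(* Let $K(z)=\frac{\bar z}{z^2}$ for $z\in\mathbb{C}\setminus\{0\}$. There exists a $1$-dimensional purely unrectifiable Borel probability measure $\mu$ on $\mathbb{C}$ such that $\|T_{\mu}(1)\|_{L^{\infty}(\mathbb{C}\setminus \operatorname{supp}(\mu))}<\infty$ and such that $T_\mu(1)$ fails to exist in the sense of principal value $\mu$-almost everywhere, that is, for $\mu$-almost every $z\in\mathbb{C}$ the limit $$\lim_{\delta\to0^+}\int_{\mathbb{C}\setminus B(z,\delta)}K(z-\xi)\,d\mu(\xi)$$ does not exist.
   Context: $B(z,r)$ denotes the closed disc in $\mathbb{C}$ with centre $z$ and radius $r>0$. For a set $E\subset\mathbb{C}$, $\mathcal{H}^1(E)=\sup_{\delta>0}\inf\{\sum_j r_j : E\subset\bigcup_j B(x_j,r_j),\ r_j\le\delta\}$. $\operatorname{supp}(\mu)$ is the closed support of $\mu$. A finite Borel measure $\mu$ on $\mathbb{C}$ is called $1$-dimensional if $\mathcal{H}^1(\operatorname{supp}(\mu))<\infty$ and there is a constant $C>0$ such that $\mu(B(z,r))\le Cr$ for all $z\in\mathbb{C}$ and $r>0$. A measure $\mu$ is purely unrectifiable if $\mathcal{H}^1(\Gamma\cap\operatorname{supp}(\mu))=0$ for every rectifiable curve $\Gamma\subset\mathbb{C}$. For $z\notin\operatorname{supp}(\mu)$, $T_\mu(1)(z)=\int_{\mathbb{C}}K(z-\xi)\,d\mu(\xi)$. The $L^\infty$ norm is with respect to planar Lebesgue measure. *)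

(* Defs.v *)
From HB Require Import structures.
From mathcomp Require Import all_boot all_order all_algebra.
From mathcomp Require Import complex.
From mathcomp Require Import all_classical all_reals all_analysis.

Set Implicit Arguments.
Unset Strict Implicit.
Unset Printing Implicit Defensive.

Import Order.TTheory GRing.Theory Num.Theory numFieldNormedType.Exports.

Local Open Scope classical_set_scope.
Local Open Scope ring_scope.
Local Open Scope complex_scope.

(* Points of the complex plane are pairs [(x, y) : R * R], standing for
   [x + i y]: the product topology and the product sigma-algebra of [R * R]
   are the usual topology and the Borel sigma-algebra of the plane. Complex
   arithmetic is done in [R[i]], through [cplx]. *)
Definition cplx (R : realType) (z : R * R) : R[i] := z.1 +i* z.2.

(* The norm of [R * R] in the library is the sup norm; distances, discs and
   lengths of curves use the modulus of [R[i]] instead. *)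
Definition cdist (R : realType) (z w : R * R) : R :=
  ComplexField.Normc.normc (cplx z - cplx w).

Definition cdisc (R : realType) (z : R * R) (r : R) : set (R * R) :=
  [set w | cdist w z <= r].

(* Covers are indexed by [nat]; finite covers need no separate treatment since
   they can be completed by discs of arbitrarily small total radius. *)
Definition hausdorff1 (R : realType) (E : set (R * R)) : \bar R :=
  ereal_sup [set ereal_inf
    [set s : \bar R | exists (x : nat -> R * R) (r : nat -> R),
      [/\ forall j, 0 < r j <= delta,
          E `<=` \bigcup_j cdisc (x j) (r j) &
          s = (\sum_(0 <= j <oo) (r j)%:E)%E]]
    | delta in [set delta : R | 0 < delta]].

(* Smallest closed set of full measure *)
Definition msupport (R : realType) (mu : {measure set (R * R) -> \bar R}) :
    set (R * R) :=
  \bigcap_(F in [set F | closed F /\ mu (~` F) = 0%E]) F.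

Definition one_dimensional (R : realType)
    (mu : {finite_measure set (R * R)%type -> \bar R}) : Prop :=
  (hausdorff1 (msupport mu) < +oo)%E /\
  exists2 C : R, 0 < C &
    forall (z : R * R) (r : R), 0 < r -> (mu (cdisc z r) <= (C * r)%:E)%E.

(* Length of the polygonal line through g(a), g(s_0), g(s_1), ... *)
Definition polygonal_length (R : realType) (a b : R) (g : R -> R * R)
    (s : seq R) : R :=
  let F := g \o nth b (a :: s) in
  \sum_(0 <= n < size s) cdist (F n.+1) (F n).

Definition rectifiable_curve (R : realType) (Gamma : set (R * R)) : Prop :=
  exists (a b : R) (g : R -> R * R),
    [/\ a < b,
        {within `[a, b], continuous g},
        has_ubound [set polygonal_length a b g s | s in itv_partition a b] &
        Gamma = g @` `[a, b]].

Definition purely_unrectifiable (R : realType)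
    (mu : {measure set (R * R) -> \bar R}) : Prop :=
  forall Gamma : set (R * R), rectifiable_curve Gamma ->
    hausdorff1 (Gamma `&` msupport mu) = 0%E.

(* Only the values at [z != 0] matter; the library convention for inverses
   gives the value 0 at 0. *)
Definition huovinenK (R : realType) (z : R[i]) : R[i] := z^* / z ^+ 2.

(* Complex-valued integral: real and imaginary parts are integrated apart. *)
Definition cintegral (R : realType) (mu : {measure set (R * R) -> \bar R})
    (D : set (R * R)) (f : R * R -> R[i]) : R[i] :=
  (\int[mu]_(x in D) complex.Re (f x)) +i* (\int[mu]_(x in D) complex.Im (f x)).

(* Meaningful for [z] outside the support of [mu] *)
Definition huovinenT (R : realType) (mu : {measure set (R * R) -> \bar R})
    (z : R * R) : R[i] :=
  cintegral mu setT (fun xi => huovinenK (cplx z - cplx xi)).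

Definition truncatedT (R : realType) (mu : {measure set (R * R) -> \bar R})
    (delta : R) (z : R * R) : R[i] :=
  cintegral mu (~` cdisc z delta) (fun xi => huovinenK (cplx z - cplx xi)).

(* [R[i]^o] only gives access to the normed topology of [R[i]]. *)
Definition pv_exists (R : realType) (mu : {measure set (R * R) -> \bar R})
    (z : R * R) : Prop :=
  exists l : R[i]^o, (truncatedT mu delta z : R[i]^o) @[delta --> 0^'+] --> l.

(* The norm of L^oo([D]) for planar Lebesgue measure: [f] is extended by 0
   outside [D]. *)
Definition Linfty_norm (R : realType) (D : set (R * R)) (f : R * R -> R[i]) :
    \bar R :=
  Lnorm (@lebesgue_measure R \x @lebesgue_measure R)%E +oo%E
    ((fun z => (ComplexField.Normc.normc (f z))%:E) \_ D).

(* Main.v *)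
Require Import Defs.
From HB Require Import structures.
From mathcomp Require Import all_boot all_order all_algebra.
From mathcomp Require Import complex.
From mathcomp Require Import all_classical all_reals all_analysis.
From mathcomp Require Import measurable_realfun.
From mathcomp Require separable cyclotomic.
From mathcomp Require Import zify ring lra.

Set Implicit Arguments.
Unset Strict Implicit.
Unset Printing Implicit Defensive.

Import Order.TTheory GRing.Theory Num.Theory numFieldNormedType.Exports.

Local Open Scope classical_set_scope.

Local Open Scope complex_scope.
Local Open Scope ring_scope.

(** The kernel is multiplicative, [K (z w) = K z * K w], so a finite configuration
    in the unit disc can be rescaled and iterated. The configurations are made of
    [m ^ 2 - m] concentric rings of equally many equally spaced points, the ring of
    index [h] having radius [sqrt h / m]: up to rounding this is the uniform measure of
    the disc, whose Huovinen potential vanishes inside the disc. At a point of the ring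
    [g], a ring [h < g] contributes about [Q (1 - 2 h / g)] times the kernel at the point,
    a ring [h > g] almost nothing, and these contributions nearly cancel. With [N] points, the
    sums of [K (p d - p e)] over [e <> d] are thus at most [eps N], while the points are
    [1 / (eps N)]-separated and the sums of [1 / |p d - p e|] are [O(N)].

    Replacing each disc of radius and mass [r n] by [N n] discs of radius and mass
    [r n.+1 = r n / N n], placed according to such a configuration for [eps n], yields a
    Cantor measure. Passing from one generation to the next, the potential seen from a
    point near the cell changes by [O(eps n)], which is summable: this bounds the
    potential off the support. Neighbouring cells are farther apart than
    [r n.+1 / eps n], so a rectifiable curve meets only [O(1 + eps n / r n.+1)] of them.
    Finally, seen from a point near the boundary of its cell, the part of
    the cell at distance more than [7 / 4 * r n] lies in a narrow cone on which [K] is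
    close to one direction; hence the truncations at [7 / 4 * r n] and [4 * r n] differ by a
    fixed amount, and almost every point is in this situation at infinitely many
    generations. *)

(** * The modulus and the kernel *)

(** A ring carries [Q = 4 m ^ 3] points so that its deviation from a uniformly charged circle,
    governed by [(h / g) ^+ (Q / 2)] or its inverse, is of order [4 ^- m] up to polynomial factors,
    even for adjacent rings. What survives is the uncancelled part of the inner rings, of order
    [m Q], times the factor [1 / |p d|] left by rescaling; starting at ring [m] keeps this factor
    below [sqrt m]. As [N] is about [m ^ 2 Q], the potential is of order [N / sqrt m], and [m] is
    taken of order [eps ^- 2]. The sums over roots of unity are exact finite Fourier computations,
    so no angle or trigonometric function occurs. The obstacle is that a bounded potential tends to
    favour principal values: from one generation to the next the potential changes summably. The
    oscillation therefore has to be caught inside one generation, by truncating at two radii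
    comparable to a single cell. The inner radius is [7 / 4 * r n] because [7 / 4 > sqrt 3]: two
    points of the unit disc farther apart than [sqrt 3] see the chord and the radius under an angle
    below [pi / 6], which is what a kernel turning three times as fast as the argument requires. *)

Section ComplexModulus.
Variable R : realType.
Local Notation C := R[i].
Implicit Types (z w : C) (x : R).

(** Real-valued, whereas the library norm of [R[i]] takes its values in [R[i]]: inequalities between
    moduli can thus be left to [lra] and [nra]. *)
Definition cabs (z : R[i]) : R := ComplexField.Normc.normc z.

Lemma cabsE z : (cabs z)%:C = `|z|.
Proof. by case: z => a b; rewrite normc_def. Qed.

Lemma cabs_ge0 z : 0 <= cabs z.
Proof. by case: z => a b; exact: sqrtr_ge0. Qed.

Lemma cabsM z w : cabs (z * w) = cabs z * cabs w.
Proof. exact: ComplexField.Normc.normcM. Qed.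

Lemma cabsV z : cabs z^-1 = (cabs z)^-1.
Proof. exact: ComplexField.Normc.normcV. Qed.

Lemma cabsX z n : cabs (z ^+ n) = cabs z ^+ n.
Proof. by apply: (@complexI R); rewrite rmorphXn /= !cabsE normrX. Qed.

Lemma cabsD z w : cabs (z + w) <= cabs z + cabs w.
Proof. exact: le_normcD. Qed.

Lemma cabsN z : cabs (- z) = cabs z.
Proof. exact: normcN. Qed.

Lemma cabsBC z w : cabs (z - w) = cabs (w - z).
Proof. by rewrite -cabsN opprB. Qed.

Lemma cabsB_trans w z t : cabs (z - t) <= cabs (z - w) + cabs (w - t).
Proof. by rewrite (_ : z - t = (z - w) + (w - t)) ?cabsD// addrA subrK. Qed.

Lemma cabsB_ge z w : cabs z - cabs w <= cabs (z - w).
Proof. by rewrite lerBlDr (le_trans _ (cabsD _ _))// subrK. Qed.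

Lemma cabs_eq0 z : (cabs z == 0) = (z == 0).
Proof.
apply/eqP/eqP => [/ComplexField.Normc.eq0_normc//|->].
exact: ComplexField.Normc.normc0.
Qed.

Lemma cabs0 : cabs 0 = 0. Proof. exact: ComplexField.Normc.normc0. Qed.

Lemma cabs1 : cabs 1 = 1. Proof. exact: ComplexField.Normc.normc1. Qed.

Lemma cabs_gt0 z : (0 < cabs z) = (z != 0).
Proof. by rewrite lt_def cabs_ge0 andbT cabs_eq0. Qed.

Lemma cabsR x : cabs x%:C = `|x|.
Proof. by rewrite /cabs /= expr0n/= addr0 sqrtr_sqr. Qed.

Lemma cabs_nat k : cabs k%:R = k%:R.
Proof. by rewrite -(rmorph_nat (real_complex R)) cabsR ger0_norm. Qed.

Lemma cabsJ z : cabs z^* = cabs z.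
Proof. by case: z => a b; rewrite /cabs /= sqrrN. Qed.

Lemma mulcJE z : z * z^* = (cabs z ^+ 2)%:C.
Proof. by rewrite -sqr_normc -cabsE rmorphXn. Qed.

Lemma sqr_cabs z : cabs z ^+ 2 = complex.Re z ^+ 2 + complex.Im z ^+ 2.
Proof. by case: z => a b; rewrite sqr_sqrtr// addr_ge0// sqr_ge0. Qed.

Lemma cabs_sum (I : Type) (r : seq I) (P : pred I) (F : I -> C) :
  cabs (\sum_(i <- r | P i) F i) <= \sum_(i <- r | P i) cabs (F i).
Proof.
elim/big_ind2 : _ => //; first by rewrite cabs0.
by move=> x1 x2 y1 y2 h1 h2; rewrite (le_trans (cabsD _ _))// lerD.
Qed.

Lemma Re_le_cabs z : `|complex.Re z| <= cabs z.
Proof.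
rewrite -(@ler_pXn2r _ 2)// ?nnegrE// ?cabs_ge0//.
by rewrite sqr_cabs real_normK ?num_real// lerDl sqr_ge0.
Qed.

Lemma Im_le_cabs z : `|complex.Im z| <= cabs z.
Proof.
rewrite -(@ler_pXn2r _ 2)// ?nnegrE// ?cabs_ge0//.
by rewrite sqr_cabs real_normK ?num_real// lerDr sqr_ge0.
Qed.

Lemma cabs_le_ReIm z : cabs z <= `|complex.Re z| + `|complex.Im z|.
Proof.
rewrite -(@ler_pXn2r _ 2)// ?nnegrE// ?cabs_ge0// ?addr_ge0//.
rewrite sqr_cabs sqrrD !real_normK ?num_real//.
by rewrite lerD2r lerDl mulrn_wge0// mulr_ge0.
Qed.

Lemma ReD z w : complex.Re (z + w) = complex.Re z + complex.Re w.
Proof. by case: z w => a b [c d]. Qed.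

Lemma ImD z w : complex.Im (z + w) = complex.Im z + complex.Im w.
Proof. by case: z w => a b [c d]. Qed.

Lemma conjCR x : (x%:C)^* = x%:C :> C.
Proof. exact: conjc_real. Qed.

Lemma huovinenKM z w : huovinenK (z * w) = huovinenK z * huovinenK w.
Proof. by rewrite /huovinenK rmorphM/= exprMn invfM mulrACA. Qed.

Lemma cabs_huovinenK z : cabs (huovinenK z) = (cabs z)^-1.
Proof.
have [->|z0] := eqVneq z 0; first by rewrite /huovinenK rmorph0 mul0r cabs0 invr0.
rewrite /huovinenK cabsM cabsJ cabsV cabsX expr2 invfM mulrA mulfV ?mul1r//.
by rewrite cabs_eq0.
Qed.

Lemma huovinenKR x : huovinenK x%:C = (x^-1)%:C.
Proof.
have [->|x0] := eqVneq x 0.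
  by rewrite /huovinenK rmorph0 mul0r invr0.
rewrite /huovinenK conjCR -rmorphXn/= -fmorphV -rmorphM/=.
by congr (_%:C); rewrite expr2 invfM mulrA mulfV ?mul1r.
Qed.

Lemma huovinenK_lipschitz (h : R) z w : 0 < h -> 10 * h <= cabs w ->
  cabs (z - w) <= 4 * h ->
  cabs (huovinenK z - huovinenK w) <= 40 * h / cabs w ^+ 2.
Proof.
move=> h0 hw zw.
have w0 : 0 < cabs w by lra.
have zw2 : cabs z <= cabs (z - w) + cabs w by rewrite (le_trans _ (cabsD _ _))// subrK.
have wz2 : cabs w - cabs z <= cabs (z - w) by rewrite cabsBC cabsB_ge.
have z0 : 0 < cabs z by lra.
have -> : huovinenK z - huovinenK w =
  ((z - w)^* * w ^+ 2 + w^* * (w - z) * (w + z)) / (z ^+ 2 * w ^+ 2).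
  have zn : z != 0 by rewrite -cabs_gt0.
  have wn : w != 0 by rewrite -cabs_gt0.
  rewrite /huovinenK rmorphB /=.
  by field; rewrite zn wn.
rewrite cabsM cabsV cabsM !cabsX.
(* Since [|z - w| <= 2/5 |w|], one has [|z| >= 3/5 |w|] and [|w + z| <= 12/5 |w|]; this yields the
   constant 340/9, rounded up to 40. *)
apply: (@le_trans _ _ ((4 * h * cabs w ^+ 2 + cabs w * (4 * h) * (12/5 * cabs w)) /
   ((3/5 * cabs w) ^+ 2 * cabs w ^+ 2))).
  apply: ler_pM.
  - exact: cabs_ge0.
  - by rewrite invr_ge0 mulr_ge0 ?exprn_ge0// cabs_ge0.
  - apply: le_trans (cabsD _ _) _; rewrite !(cabsX, cabsM) !cabsJ (cabsBC w z).
    have := cabsD w z => ?.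
    apply: lerD; first by rewrite ler_wpM2r// exprn_ge0// cabs_ge0.
    apply: ler_pM; rewrite ?mulr_ge0 ?cabs_ge0//; last by lra.
    by rewrite ler_wpM2l// cabs_ge0.
  - have c35 : 0 < 3 / 5 * cabs w by lra.
    rewrite lef_pV2 ?posrE; last 2 first.
    + by apply: mulr_gt0; exact: exprn_gt0.
    + by apply: mulr_gt0; exact: exprn_gt0.
    rewrite ler_wpM2r ?exprn_ge0 ?cabs_ge0//.
    by rewrite ler_pXn2r ?nnegrE//; lra.
rewrite ler_pdivlMr ?exprn_gt0//.
have -> : (4 * h * cabs w ^+ 2 + cabs w * (4 * h) * (12/5 * cabs w)) /
  ((3/5 * cabs w) ^+ 2 * cabs w ^+ 2) * cabs w ^+ 2 = (340 / 9) * h.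
  by field; lra.
by rewrite ler_wpM2r ?ltW//; lra.
Qed.

End ComplexModulus.

(** * Rings of equally spaced points *)

Section RootsOfUnity.
Variable R : realType.
Local Notation C := R[i].
Variables (n : nat) (w : C).
Let Q := n.+1.
Hypothesis primw : Q.-primitive_root w.

Lemma sum_expr_unity (u : C) : u ^+ Q = 1 ->
  \sum_(k < Q) u ^+ k = if u == 1 then Q%:R else 0.
Proof.
have [->|u1] := eqVneq u 1.
  move=> _; under eq_bigr do rewrite expr1n.
  by rewrite sumr_const card_ord.
move=> uQ; have /eqP := subrX1 u Q; rewrite uQ subrr eq_sym mulf_eq0 subr_eq0.
by rewrite (negbTE u1) => /eqP.
Qed.

Lemma unity_neq0 : w != 0.
Proof. by apply: contra_eq_neq (prim_expr_order primw) => ->; rewrite expr0n/= eq_sym oner_eq0. Qed.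

Lemma cabs_unity : cabs w = 1.
Proof.
apply/eqP; rewrite -(@pexpr_eq1 _ (cabs w) Q)// ?cabs_ge0//.
by rewrite -cabsX (prim_expr_order primw) cabs1.
Qed.

Lemma conj_unity k : (w ^+ k)^* = w^-1 ^+ k.
Proof.
rewrite rmorphXn /=; congr (_ ^+ k); apply: (mulfI unity_neq0).
by rewrite mulcJE cabs_unity expr1n mulfV// unity_neq0.
Qed.

(** Orthogonality of the characters of Z/Q. Kept bilinear because it is applied with [h] a conjugate
    sequence (Parseval), a delta at 0 (constant coefficient) and a reflected sequence (sum of
    squares). *)
Lemma unity_bilinear (g h : nat -> C) :
  \sum_(k < Q) (\sum_(i < Q) g i * w ^+ (k * i)) *
               (\sum_(i < Q) h i * w^-1 ^+ (k * i)) =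
  Q%:R * \sum_(i < Q) g i * h i.
Proof.
under eq_bigr do rewrite mulr_suml.
rewrite exchange_big /= mulr_sumr; apply: eq_bigr => i _.
under eq_bigr do rewrite mulr_sumr.
rewrite exchange_big /= (bigD1 i)//= [X in _ + X]big1 ?addr0 => [|j ji].
  under eq_bigr do rewrite mulrACA -exprMn mulfV ?unity_neq0// expr1n mulr1.
  by rewrite sumr_const card_ord mulr_natl.
under eq_bigr => k _ do rewrite mulrACA (mulnC k) (mulnC k) !exprM -exprMn.
rewrite -mulr_sumr sum_expr_unity; last first.
  rewrite exprMn -!exprM !(mulnC _ Q) !exprM exprVn (prim_expr_order primw).
  by rewrite invr1 !expr1n mulr1.
case: eqP => [|_]; rewrite ?mulr0// => /eqP.
rewrite exprVn -(inj_eq (mulIf (expf_neq0 j unity_neq0))) mul1r.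
rewrite -mulrA mulVf ?expf_neq0 ?unity_neq0// mulr1.
rewrite (eq_prim_root_expr primw) !modn_small// => /eqP ij.
by move: ji; rewrite (val_inj ij) eqxx.
Qed.

Lemma unity_parseval (g : nat -> C) :
  \sum_(k < Q) cabs (\sum_(i < Q) g i * w ^+ (k * i)) ^+ 2 =
  Q%:R * \sum_(i < Q) cabs (g i) ^+ 2.
Proof.
apply: (@complexI R); rewrite rmorphM rmorph_nat !rmorph_sum /=.
have /= := unity_bilinear g (fun i => (g i)^*).
under [X in _ = _ * X -> _]eq_bigr do rewrite mulcJE.
move=> <-; apply: eq_bigr => k _.
rewrite -mulcJE rmorph_sum /=; congr (_ * _); apply: eq_bigr => i _.
by rewrite rmorphM /= conj_unity.
Qed.

Lemma geometric_unity (v : C) k :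
  (1 - v * w ^+ k) * (\sum_(i < Q) v ^+ i * w ^+ (k * i)) = 1 - v ^+ Q.
Proof.
under eq_bigr do rewrite exprM -exprMn.
rewrite -(opprB _ 1) mulNr -subrX1 opprB exprMn -exprM mulnC exprM.
by rewrite (prim_expr_order primw) expr1n mulr1.
Qed.

Section OffCircle.
Variable v : C.
Hypothesis vQ : v ^+ Q != 1.

Lemma off_circle_neq0 k : 1 - v * w ^+ k != 0.
Proof.
apply: contraNneq vQ => /eqP; rewrite subr_eq0 => /eqP v1.
by rewrite -subr_eq0 -opprB -(geometric_unity v k) -v1 subrr mul0r oppr0.
Qed.

(** As [(v w^k)^Q = v^Q] does not depend on [k], the geometric series closes after [Q] terms: the
    inverse is a trigonometric polynomial in [k], without any convergence and for [|v|] on either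
    side of 1. *)
Lemma inv_off_circle k : (1 - v * w ^+ k)^-1 =
  (1 - v ^+ Q)^-1 * \sum_(i < Q) v ^+ i * w ^+ (k * i).
Proof.
have v1 : 1 - v ^+ Q != 0 by rewrite subr_eq0 eq_sym.
apply: (mulfI (off_circle_neq0 k)); rewrite mulfV ?off_circle_neq0//.
by rewrite mulrCA geometric_unity mulVf.
Qed.

Lemma sum_inv_off_circle :
  \sum_(k < Q) (1 - v * w ^+ k)^-1 = Q%:R / (1 - v ^+ Q).
Proof.
under eq_bigr do rewrite inv_off_circle.
rewrite -mulr_sumr mulrC; congr (_ * _).
have D (g : nat -> C) : \sum_(i < Q) g i * (i == 0%N :> nat)%:R = g 0%N.
  by rewrite big_ord_recl /= mulr1 big1 ?addr0// => i _; rewrite mulr0.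
have := unity_bilinear (fun i => v ^+ i) (fun i => (i == 0%N)%:R).
rewrite (D (fun i => v ^+ i)) mulr1 => <-; apply: eq_bigr => k _.
under [X in _ = _ * X]eq_bigr do rewrite mulrC.
by rewrite (D (fun i => w^-1 ^+ (k * i))) muln0 expr0 mulr1.
Qed.

Lemma sum_inv2_off_circle :
  \sum_(k < Q) (1 - v * w ^+ k)^-1 ^+ 2 =
  Q%:R * (1 + n%:R * v ^+ Q) / (1 - v ^+ Q) ^+ 2.
Proof.
under eq_bigr do rewrite inv_off_circle exprMn.
rewrite -mulr_sumr mulrC exprVn; congr (_ * _).
(* Coefficients of the same polynomial in powers of [w^-1]: the exponent [i > 0] is read as
   [-(Q - i)]. Each of the [n] nonconstant pairs contributes [v^i v^(Q - i) = v^Q]. *)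
pose h (i : nat) : C := if i == 0%N then 1 else v ^+ (Q - i).
have S : \sum_(i < Q) v ^+ i * h i = 1 + n%:R * v ^+ Q.
  rewrite big_ord_recl /= mulr1 expr0; congr (_ + _).
  rewrite (eq_bigr (fun=> v ^+ Q)) ?sumr_const ?card_ord ?mulr_natl// => i _.
  by rewrite /bump /h /= add1n -exprD subnKC// ltnS ltnW.
have := unity_bilinear (fun i => v ^+ i) h.
rewrite S => <-; apply: eq_bigr => k _.
rewrite expr2; congr (_ * _).
rewrite [LHS]big_ord_recl [RHS]big_ord_recl /= /h /= !muln0; congr (_ + _).
rewrite (reindex_inj rev_ord_inj) /=; apply: eq_bigr => i _.
have -> : bump 0 (n - i.+1) = (Q - i.+1)%N.
  by rewrite /bump add1n subSS -subSn// subSS.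
rewrite /bump /= add1n; congr (_ * _).
apply: (mulIf (expf_neq0 (k * i.+1) unity_neq0)).
rewrite -exprD -mulnDr subnK 1?ltnS 1?ltnW// mulnC exprM (prim_expr_order primw).
by rewrite expr1n -exprMn mulVf ?unity_neq0// expr1n.
Qed.

Lemma sum_norm2_off_circle :
  \sum_(k < Q) (cabs (1 - v * w ^+ k) ^+ 2)^-1 =
  Q%:R * (\sum_(i < Q) (cabs v ^+ 2) ^+ i) / cabs (1 - v ^+ Q) ^+ 2.
Proof.
under eq_bigr do rewrite -exprVn -cabsV inv_off_circle cabsM exprMn cabsV exprVn.
rewrite -mulr_sumr unity_parseval mulrC; congr (_ * _ * _).
by apply: eq_bigr => i _; rewrite cabsX -!exprM mulnC.
Qed.

(* On the ring [conj u = |v|^2 / u], which turns [K (1 - u)] into a rational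
   function of [u]. *)
Lemma sum_huovinenK_off_circle : (0 < n)%N -> v != 0 ->
  \sum_(k < Q) huovinenK (1 - v * w ^+ k) =
  Q%:R * ((1 - (cabs v ^+ 2)%:C) * (1 + n%:R * v ^+ Q) / (1 - v ^+ Q) ^+ 2
          - (cabs v ^+ 2)%:C / (1 - v ^+ Q)).
Proof.
move=> n0 v0; set b := (cabs v ^+ 2)%:C.
have K k : huovinenK (1 - v * w ^+ k) =
  (1 - b) * (1 - v * w ^+ k)^-1 ^+ 2 - b * (1 - v * w ^+ k)^-1 - b * (v * w ^+ k)^-1.
  have := off_circle_neq0 k; set u := v * w ^+ k => u1.
  have u0 : u != 0 by rewrite mulf_neq0// expf_neq0// unity_neq0.
  have -> : b = u * u^*.
    rewrite mulcJE /b cabsM cabsX cabs_unity expr1n mulr1//.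
  rewrite /huovinenK rmorphB rmorph1 /=.
  by field; rewrite u0 u1.
under eq_bigr do rewrite K.
rewrite !big_split /= !sumrN -!mulr_sumr sum_inv2_off_circle sum_inv_off_circle.
have -> : \sum_(k < Q) (v * w ^+ k)^-1 = 0.
  under eq_bigr => k _ do rewrite invfM -exprVn.
  rewrite -mulr_sumr sum_expr_unity ?exprVn ?(prim_expr_order primw) ?invr1//.
  rewrite invr_eq1; case: eqP => [w1|]; rewrite ?mulr0//.
  have := eq_prim_root_expr primw 1 0; rewrite w1 expr1n expr0 eqxx.
  by rewrite modn_small ?ltnS// mod0n.
rewrite mulr0 subr0 mulrBr; congr (_ - _); rewrite ?mulrA; congr (_ / _).
  by rewrite mulrAC mulrC !mulrA.
by rewrite mulrC.
Qed.

End OffCircle.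

(** For a root of unity [u != 1], summation by parts gives [(u - 1) * sum i u^i = Q], so
    [1 / |1 - u|] is [1 / Q] times the modulus of a Fourier sum with coefficients [i < Q]; Parseval
    concludes. *)
Lemma sum_norm2_on_circle :
  \sum_(k < Q | k != ord0) (cabs (1 - w ^+ k) ^+ 2)^-1 <= Q%:R ^+ 2.
Proof.
have T (u : C) j : (u - 1) * (\sum_(i < j) i%:R * u ^+ i) =
    j%:R * u ^+ j - \sum_(i < j) u ^+ i.+1.
  elim: j => [|j IH]; first by rewrite !big_ord0 mulr0 mul0r subr0.
  rewrite !big_ord_recr /= mulrDr IH exprS -[j.+1%:R]natr1; ring.
have E (k : 'I_Q) : k != ord0 -> (cabs (1 - w ^+ k) ^+ 2)^-1 =
    (Q%:R ^+ 2)^-1 * cabs (\sum_(i < Q) i%:R * w ^+ (k * i)) ^+ 2.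
  move=> k0.
  have u1 : w ^+ k - 1 != 0.
    rewrite subr_eq0 -(prim_order_dvd primw); apply: contra k0 => /dvdn_leq.
    by rewrite -val_eqE /= lt0n; case: eqP => // _ /(_ isT); rewrite leqNgt (ltn_ord k).
  have := T (w ^+ k) Q.
  under [X in _ = _ - X -> _]eq_bigr do rewrite exprS.
  rewrite -mulr_sumr sum_expr_unity; last first.
    by rewrite -exprM mulnC exprM (prim_expr_order primw) expr1n.
  rewrite -[_ == 1]subr_eq0 (negbTE u1) mulr0 subr0.
  rewrite -exprM [(k * Q)%N]mulnC exprM (prim_expr_order primw) expr1n mulr1.
  under eq_bigr do rewrite -exprM.
  move=> /(congr1 (@cabs R)); rewrite cabsM cabsBC => TT.
  rewrite cabs_nat in TT.
  have u2 : 0 < cabs (1 - w ^+ k) by rewrite cabsBC cabs_gt0.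
  have -> : cabs (\sum_(i < Q) i%:R * w ^+ (k * i)) = Q%:R / cabs (1 - w ^+ k).
    by rewrite -TT mulrC mulKf// gt_eqF.
  by rewrite exprMn exprVn mulrA mulVf ?mul1r// expf_neq0// pnatr_eq0.
rewrite (eq_bigr _ E) -mulr_sumr ler_pdivrMl ?exprn_gt0//.
apply: (@le_trans _ _ (\sum_(k < Q) cabs (\sum_(i < Q) i%:R * w ^+ (k * i)) ^+ 2)).
  rewrite big_mkcond ler_sum// => k _; case: ifP => // _; exact: exprn_ge0 (cabs_ge0 _).
rewrite (unity_parseval (fun i => i%:R)).
have -> : Q%:R ^+ 2 * Q%:R ^+ 2 = Q%:R * \sum_(i < Q) (Q%:R ^+ 2 : R).
  by rewrite sumr_const card_ord -(mulr_natl (Q%:R ^+ 2)); ring.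
rewrite ler_wpM2l// ler_sum// => i _.
rewrite cabs_nat ler_pXn2r ?nnegrE//.
by rewrite ler_nat ltnW// ltn_ord.
Qed.

(** The numbers [1 - u^i] sum to [Q], while [|1 - u^i| <= i |1 - u|] and the [i < Q] sum to
    [Q n / 2]: hence [2 <= n |1 - u|]. *)
Lemma unity_separated k : (0 < k < Q)%N -> 2 <= Q%:R * cabs (1 - w ^+ k).
Proof.
move=> /andP[k0 kQ].
have u1 : w ^+ k != 1.
  rewrite -(prim_order_dvd primw); apply/negP => /(dvdn_leq k0).
  by rewrite leqNgt kQ.
have n0 : (0 < n)%N by rewrite -ltnS (leq_ltn_trans k0 kQ).
set u := w ^+ k in u1 *.
have cu : cabs u = 1 by rewrite cabsX cabs_unity expr1n.
have B i : cabs (1 - u ^+ i) <= i%:R * cabs (1 - u).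
  elim: i => [|i IH]; first by rewrite expr0 subrr cabs0 mul0r.
  have -> : 1 - u ^+ i.+1 = (1 - u ^+ i) + u ^+ i * (1 - u).
    by rewrite exprSr; ring.
  by rewrite (le_trans (cabsD _ _))// cabsM cabsX cu expr1n mul1r -natr1 mulrDl mul1r lerD2r.
have S : \sum_(i < Q) (1 - u ^+ i) = Q%:R.
  rewrite sumrB sumr_const card_ord sum_expr_unity ?(negbTE u1) ?subr0//.
  by rewrite /u -exprM mulnC exprM (prim_expr_order primw) expr1n.
have := cabs_sum (index_enum 'I_Q) xpredT (fun i : 'I_Q => 1 - u ^+ i).
rewrite S cabs_nat => H.
have {}H : Q%:R <= (\sum_(i < Q) i%:R) * cabs (1 - u).
  by rewrite (le_trans H)// mulr_suml ler_sum.
have S2 m : (\sum_(i < m.+1) i%:R : R) * 2 = m.+1%:R * m%:R.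
  elim: m => [|m IH]; first by rewrite big_ord_recr big_ord0 /= add0r mul0r mulr0.
  by rewrite big_ord_recr /= mulrDl IH -!natr1; ring.
have {}H : Q%:R * 2 <= Q%:R * (n%:R * cabs (1 - u)).
  by rewrite [leRHS]mulrA -S2 mulrAC ler_pM2r.
rewrite ler_pM2l ?ltr0n// in H; apply: le_trans H _.
by rewrite ler_wpM2r ?cabs_ge0// ler_nat.
Qed.

Lemma sum_unity_rotate (V : nmodType) (F : C -> V) l :
  \sum_(k < Q) F (w ^+ k * w^-1 ^+ l) = \sum_(k < Q) F (w ^+ k).
Proof.
have hI : injective (fun k : 'I_Q => inord ((k + l) %% Q) : 'I_Q).
  move=> a b /(congr1 val); rewrite /= !inordK ?ltn_pmod// => /eqP.
  by rewrite eqn_modDr !modn_small// => /eqP/val_inj.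
rewrite (reindex_inj hI) /=; apply: eq_bigr => k _.
rewrite inordK ?ltn_pmod// (prim_expr_mod primw) exprD -mulrA -exprMn.
by rewrite mulfV ?unity_neq0// expr1n mulr1.
Qed.

Lemma unity_div_eq1 (k l : 'I_Q) : (w ^+ k * w^-1 ^+ l == 1) = (k == l).
Proof.
rewrite -(inj_eq (mulIf (expf_neq0 l unity_neq0))) mul1r -mulrA -exprMn.
by rewrite mulVf ?unity_neq0// expr1n mulr1 (eq_prim_root_expr primw) !modn_small.
Qed.

Lemma sum_unity_rotate_neq (V : nmodType) (F : C -> V) (l : 'I_Q) :
  \sum_(k < Q | k != l) F (w ^+ k * w^-1 ^+ l) = \sum_(k < n) F (w ^+ k.+1).
Proof.
(* Setting the value at [u = 1] to 0 turns the punctured sum into a full one, on which the rotation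
   acts. *)
pose G (u : C) : V := if u == 1 then 0 else F u.
have G1 : G 1 = 0 by rewrite /G eqxx.
have := sum_unity_rotate G l; rewrite [RHS]big_ord_recl expr0 G1 add0r.
move=> E; rewrite big_mkcond /=.
transitivity (\sum_(k < Q) G (w ^+ k * w^-1 ^+ l)).
  by apply: eq_bigr => k _; rewrite /G unity_div_eq1; case: eqP.
rewrite E; apply: eq_bigr => k _; rewrite lift0 /G.
by rewrite -(prim_order_dvd primw) gtnNdvd// ltnS ltn_ord.
Qed.

Lemma sum_unity_inv (V : nmodType) (F : C -> V) :
  \sum_(k < n) F (w ^+ k.+1) = \sum_(k < n) F (w ^+ k.+1)^-1.
Proof.
rewrite (reindex_inj rev_ord_inj) /=; apply: eq_bigr => k _; congr F.
apply: (mulIf (expf_neq0 k.+1 unity_neq0)).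
rewrite mulVf ?expf_neq0 ?unity_neq0// -exprD subnSK// addnS subnK 1?ltnW//.
exact: prim_expr_order.
Qed.

(* [huovinenK (1 - u) = - 1 / u - 1 / (1 - u)] on the unit circle, and
   [1 / (1 - u) + 1 / (1 - 1 / u) = 1]. *)
Lemma ring_self_potential :
  cabs (\sum_(k < n) huovinenK (1 - w ^+ k.+1)) <= Q%:R.
Proof.
have u0 k : w ^+ k != 0 by rewrite expf_neq0// unity_neq0.
have u1 (k : 'I_n) : 1 - w ^+ k.+1 != 0.
  by rewrite subr_eq0 eq_sym -(prim_order_dvd primw) gtnNdvd// ltnS ltn_ord.
have E (k : 'I_n) : huovinenK (1 - w ^+ k.+1) = - (w ^+ k.+1)^-1 - (1 - w ^+ k.+1)^-1.
  rewrite /huovinenK rmorphB rmorph1 /= conj_unity exprVn.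
  by field; rewrite u0 u1.
rewrite (eq_bigr _ (fun k _ => E k)) big_split /= !sumrN.
have -> : \sum_(k < n) (1 - w ^+ k.+1)^-1 = n%:R / 2.
  apply: (mulIf (_ : 2 != 0)); first by rewrite pnatr_eq0.
  rewrite divfK ?pnatr_eq0// mulr_natr mulr2n.
  rewrite {2}(sum_unity_inv (fun u => (1 - u)^-1)) -big_split /=.
  rewrite (eq_bigr (fun=> 1)) ?sumr_const ?card_ord// => k _.
  rewrite -[X in _ - X^-1]mul1r.
  by field; rewrite u0 u1 -opprB oppr_eq0 u1.
have S : \sum_(k < n) (w ^+ k.+1)^-1 = \sum_(k < n) w ^+ k.+1.
  by rewrite (sum_unity_inv id).
have cQ : cabs (\sum_(k < n) w ^+ k.+1) <= n%:R.
  apply: le_trans (cabs_sum _ _ _) _.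
  by under eq_bigr do rewrite cabsX cabs_unity expr1n; rewrite sumr_const card_ord.
rewrite S -opprD cabsN.
have [n0|n0] := posnP n.
  rewrite /Q n0 big_ord0 mul0r addr0 cabs0//.
have -> : \sum_(k < n) w ^+ k.+1 = - 1.
  have := sum_expr_unity (prim_expr_order primw); rewrite big_ord_recl /= expr0.
  have w1 : w != 1 by rewrite -(expr1 w) -(prim_order_dvd primw) gtnNdvd.
  rewrite (negbTE w1) => /eqP; rewrite addrC addr_eq0 => /eqP.
  by under eq_bigr do rewrite /bump add1n.
apply: le_trans (cabsD _ _) _.
rewrite cabsN cabs1 cabsM cabsV !cabs_nat -[Q%:R]natr1.
rewrite addrC lerD2r ler_pdivrMr// ler_peMr// ler1n//.
Qed.

End RootsOfUnity.

Lemma ring_factor_inside (R : realType) (N q : R) : 1 <= N -> 2 <= q ->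
  0 <= (1 + N * q) / (q - 1) ^+ 2 <= 4 * (N + 1) / q.
Proof.
move=> N1 q2; have nq : 0 <= N * q by nra.
have q1 : 0 < q - 1 by lra.
have q0 : 0 < q by lra.
apply/andP; split; first by apply: divr_ge0; [lra|exact: sqr_ge0].
rewrite ler_pdivrMr ?exprn_gt0// mulrAC ler_pdivlMr//.
have : q ^+ 2 <= 4 * (q - 1) ^+ 2 by nra.
have N0 : 0 <= N + 1 by lra.
move=> /(ler_wpM2l N0) qq; have : q <= q ^+ 2 by nra.
by lra.
Qed.

(** * One ring seen from a node, scaled to the point 1 *)

Section OneRing.
Variable R : realType.
Local Notation C := R[i].
Variables (n : nat) (w : C).
Let Q := n.+1.
Hypothesis primw : Q.-primitive_root w.
Variables (v : C) (q : R).
Hypotheses (n0 : (0 < n)%N) (v0 : v != 0) (vQ : v ^+ Q = q%:C).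

Let n1 : (1 : R) <= n%:R. Proof. by rewrite ler1n. Qed.

Let sumK : q != 1 -> \sum_(k < Q) huovinenK (1 - v * w ^+ k) =
  (Q%:R * ((1 - cabs v ^+ 2) * ((1 + n%:R * q) / (1 - q) ^+ 2)
          - cabs v ^+ 2 / (1 - q)))%:C.
Proof.
move=> q1; have vQ1 : v ^+ Q != 1.
  by rewrite vQ; apply: contra q1 => /eqP[/eqP].
rewrite sum_huovinenK_off_circle// vQ.
rewrite !(rmorphM, rmorphB, rmorphD, fmorphV, rmorphXn, rmorph1, rmorph_nat)/=.
by rewrite mulrA.
Qed.

(** Here [v] is a ring node divided by the node of evaluation; all rings share their arguments, so
    [v ^+ Q] is a real number [q]. As [q] tends to 0 the closed form tends to [Q (1 - 2 |v|^2)], the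
    potential of the uniform circle at a point outside it. *)
Lemma ring_potential_outside : 0 <= q <= 2^-1 -> cabs v ^+ 2 <= 1 ->
  cabs (\sum_(k < Q) huovinenK (1 - v * w ^+ k)
        - (Q%:R * (1 - 2 * cabs v ^+ 2))%:C) <= 10 * Q%:R ^+ 2 * q.
Proof.
move=> /andP[q0 q2] b1; have b0 : 0 <= cabs v ^+ 2 by rewrite exprn_ge0// cabs_ge0.
rewrite sumK; last by apply/eqP; lra.
rewrite -rmorphB cabsR; set b := cabs v ^+ 2 in b0 b1 *.
rewrite -mulrBr normrM (ger0_norm (ler0n _ _)).
have -> : 10 * Q%:R ^+ 2 * q = Q%:R * (10 * Q%:R * q) by ring.
rewrite ler_wpM2l//.
have q3 : 0 < 1 - q by lra.
have E1 : 0 <= (1 + n%:R * q) / (1 - q) ^+ 2 - 1 <= 4 * (n%:R + 2) * q.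
  have -> : (1 + n%:R * q) / (1 - q) ^+ 2 - 1 = (n%:R * q + 2 * q - q ^+ 2) / (1 - q) ^+ 2.
    by field; lra.
  have nq : 0 <= n%:R * q by rewrite mulr_ge0.
  have qq : 0 <= q * (1 - q) by rewrite mulr_ge0// ltW.
  apply/andP; split; first by apply: divr_ge0; [nra|exact: sqr_ge0].
  rewrite ler_pdivrMr ?exprn_gt0//.
  have : 4^-1 <= (1 - q) ^+ 2 by nra.
  have : 0 <= n%:R * q by [].
  by nra.
have E2 : 0 <= 1 / (1 - q) - 1 <= 2 * q.
  have -> : 1 / (1 - q) - 1 = q / (1 - q) by field; lra.
  apply/andP; split; first by apply: divr_ge0; lra.
  by rewrite ler_pdivrMr//; nra.
have -> : (1 - b) * ((1 + n%:R * q) / (1 - q) ^+ 2) - b / (1 - q) - (1 - 2 * b) =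
  (1 - b) * ((1 + n%:R * q) / (1 - q) ^+ 2 - 1) - b * (1 / (1 - q) - 1) by field; lra.
move: E1 E2; set x := _ - 1; set y := _ - 1 => /andP[x0 x1] /andP[y0 y1].
have X0 : 0 <= (1 - b) * x by apply: mulr_ge0 => //; rewrite subr_ge0.
have Y0 : 0 <= b * y by rewrite mulr_ge0.
apply: (le_trans (ler_normB _ _)); rewrite (ger0_norm X0) (ger0_norm Y0).
have X : (1 - b) * x <= x by nra.
have Y : b * y <= y by nra.
have nq : 0 <= n%:R * q by rewrite mulr_ge0.
by rewrite -[Q%:R]natr1; lra.
Qed.

(** A uniform circle has no potential inside, and the closed form indeed vanishes as [q] tends to
    infinity, at the rate [n / q]. *)
Lemma ring_potential_inside : 2 <= q -> 1 <= cabs v ^+ 2 ->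
  cabs (\sum_(k < Q) huovinenK (1 - v * w ^+ k)) <= 6 * cabs v ^+ 2 * Q%:R ^+ 2 / q.
Proof.
move=> q2 b1; rewrite sumK; last by apply/eqP; lra.
rewrite cabsR; set b := cabs v ^+ 2 in b1 *.
rewrite normrM (ger0_norm (ler0n _ _)).
have -> : 6 * b * Q%:R ^+ 2 / q = Q%:R * (6 * b * Q%:R / q) by ring.
rewrite ler_wpM2l//.
have q1 : 0 < q - 1 by lra.
have q0 : 0 < q by lra.
have E1 : 0 <= (1 + n%:R * q) / (1 - q) ^+ 2 <= 4 * Q%:R / q.
  rewrite -(opprB q 1) sqrrN -[Q%:R]natr1.
  exact: ring_factor_inside.
have E2 : 0 <= (q - 1)^-1 <= 2 / q.
  by rewrite invr_ge0 ltW//= -[leLHS]mul1r ler_pdivrMr// mulrAC ler_pdivlMr//; nra.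
have -> : b / (1 - q) = - (b * (q - 1)^-1) by rewrite -(opprB q 1) invrN mulrN.
move: E1 E2; set x := (1 + n%:R * q) / (1 - q) ^+ 2; set y := (q - 1)^-1 => /andP[x0 x1] /andP[y0 y1].
have -> : (1 - b) * x - - (b * y) = b * y - (b - 1) * x by ring.
have X0 : 0 <= (b - 1) * x by apply: mulr_ge0 => //; rewrite subr_ge0.
have Y0 : 0 <= b * y by rewrite mulr_ge0//; lra.
apply: (le_trans (ler_normB _ _)); rewrite (ger0_norm X0) (ger0_norm Y0).
have X : (b - 1) * x <= b * (4 * Q%:R / q) by nra.
have Y : b * y <= b * (2 / q) by nra.
apply: (le_trans (lerD Y X)).
have -> : b * (2 / q) + b * (4 * Q%:R / q) = b * (2 + 4 * Q%:R) / q by ring.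
apply: ler_wpM2r; first by rewrite invr_ge0 ltW.
have H (N : R) : 1 <= N -> b * (2 + 4 * N) <= 6 * b * N by move=> ?; nra.
by apply: H; rewrite ler1n.
Qed.

(** With [b = |v|^2] one has [b ^+ Q = q ^ 2], so the geometric sum of [sum_norm2_off_circle] equals
    [(1 - q^2) / (1 - b)]. Away from [q = 1] the quotient of [|1 - q^2|] by [(1 - q)^2] is at most
    4. *)
Lemma ring_norm2 : (0 <= q <= 2^-1) || (2 <= q) -> cabs v != 1 ->
  \sum_(k < Q) (cabs (1 - v * w ^+ k) ^+ 2)^-1 <=
  4 * Q%:R / `|1 - cabs v ^+ 2|.
Proof.
move=> qq v1.
have vQ1 : v ^+ Q != 1.
  by rewrite vQ; apply/eqP => -[]; case/orP: qq => [/andP[]|]; lra.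
rewrite sum_norm2_off_circle// vQ.
have -> : 1 - q%:C = (1 - q)%:C by rewrite rmorphB rmorph1.
rewrite cabsR real_normK ?num_real//.
have qv : cabs v ^+ Q = q.
  rewrite -cabsX vQ cabsR ger0_norm//.
  by case/orP: qq => [/andP[]//|]; lra.
set b := cabs v ^+ 2.
have b0 : 0 <= b by rewrite exprn_ge0// cabs_ge0.
have b1 : b != 1.
  rewrite /b; apply: contra v1; rewrite sqrf_eq1 => /orP[//|/eqP vN].
  by have := cabs_ge0 v; rewrite vN; lra.
have bQ : b ^+ Q = q ^+ 2 by rewrite -exprM mulnC exprM qv.
have S := subrX1 b Q; rewrite bQ in S.
move: S; set T := (X in _ = _ * X) => S.
rewrite -[4 * _]mulrC -!mulrA ler_wpM2l//.
have T0 : 0 <= T by rewrite sumr_ge0// => i _; rewrite exprn_ge0.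
case/orP: qq => [/andP[q0 q2]|q2].
  have blt : b < 1.
    rewrite ltNge; apply/negP => bge; have := exprn_ege1 Q bge; rewrite bQ; nra.
  have b2 : 0 < 1 - b by rewrite subr_gt0.
  have q3 : 0 < (1 - q) ^+ 2 by rewrite exprn_gt0//; lra.
  rewrite gtr0_norm// ler_pdivrMr// mulrAC ler_pdivlMr//.
  have -> : T * (1 - b) = 1 - q ^+ 2 by rewrite -[RHS]opprB S; ring.
  by nra.
have bgt : 1 < b.
  rewrite ltNge; apply/negP => ble; have := exprn_ile1 Q b0 ble; rewrite bQ; nra.
have b2 : 0 < b - 1 by rewrite subr_gt0.
have q3 : 0 < (1 - q) ^+ 2 by rewrite exprn_even_gt0//=; lra.
rewrite distrC gtr0_norm// ler_pdivrMr// mulrAC ler_pdivlMr//.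
have -> : T * (b - 1) = q ^+ 2 - 1 by rewrite mulrC.
by nra.
Qed.

End OneRing.

(** * Elementary sums and powers for the ring configuration *)

Section NumericBounds.
Variable R : realType.

(** Bernoulli: [(b / a) ^+ (m ^ 2) >= 1 + m ^ 2 / a >= 2], then the power [2 m]. The exponent is
    half of the number [4 m ^ 3] of points of a ring, because the radii are square roots of the ring
    indices. *)
Lemma ratio_power (a b m : nat) : (0 < a)%N -> (a < b)%N -> (a <= m ^ 2)%N ->
  4 ^+ m <= (b%:R / a%:R : R) ^+ (2 * m ^ 3).
Proof.
move=> a0 ab am.
have ar : (0 : R) < a%:R by rewrite ltr0n.
have x1 : 1 + a%:R^-1 <= b%:R / a%:R :> R.
  by rewrite ler_pdivlMr// mulrDl mul1r mulVf ?lt0r_neq0// natr1 ler_nat.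
have x2 : 2 <= (b%:R / a%:R : R) ^+ (m ^ 2).
  have H k : 1 + k%:R / a%:R <= (b%:R / a%:R : R) ^+ k.
    elim: k => [|k IH]; first by rewrite mul0r addr0 expr0.
    rewrite exprS; apply: (@le_trans _ _ ((1 + a%:R^-1) * (1 + k%:R / a%:R))).
      rewrite -natr1 mulrDl mul1r -subr_ge0.
      have -> : (1 + a%:R^-1) * (1 + k%:R / a%:R) - (1 + (k%:R / a%:R + a%:R^-1)) =
        a%:R^-1 * (k%:R / a%:R) :> R by ring.
      by rewrite mulr_ge0 ?divr_ge0 ?invr_ge0.
    by rewrite ler_pM// ?addr_ge0 ?divr_ge0 ?invr_ge0.
  apply: le_trans (H _); rewrite -[2]/(1 + 1 : R) lerD2l ler_pdivlMr// mul1r.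
  by rewrite ler_nat.
have -> : (2 * m ^ 3 = m ^ 2 * (m * 2))%N by rewrite !expnS expn0; ring.
rewrite exprM.
apply: (@le_trans _ _ (2 ^+ (m * 2))).
  by rewrite mulnC exprM -[4]/((2 * 2)%:R : R) natrM expr2.
by apply: lerXn2r; rewrite ?nnegrE// exprn_ge0// divr_ge0.
Qed.

Lemma sum_invsqrt n : \sum_(0 <= i < n) (Num.sqrt i.+1%:R)^-1 <= 2 * Num.sqrt n%:R :> R.
Proof.
elim: n => [|n IH]; first by rewrite big_geq// sqrtr0 mulr0.
rewrite big_nat_recr//=.
apply: le_trans (lerD IH (lexx _)) _.
set x := Num.sqrt n%:R; set y := Num.sqrt n.+1%:R.
have x0 : 0 <= x := sqrtr_ge0 _.
have y0 : 0 < y by rewrite sqrtr_gt0 ltr0n.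
have xx : x ^+ 2 = n%:R by rewrite sqr_sqrtr.
have yy : y ^+ 2 = x ^+ 2 + 1 by rewrite xx sqr_sqrtr// natr1.
rewrite -(ler_pM2r y0) mulrDl mulVf ?gt_eqF//; nra.
Qed.

Lemma sum_invsqrt_dist M g : (g < M)%N ->
  \sum_(0 <= i < M | i != g) (Num.sqrt `|i%:R - g%:R|)^-1 <= 4 * Num.sqrt M%:R :> R.
Proof.
move=> gM; rewrite (@big_cat_nat _ _ _ g) ?leq0n 1?ltnW//=.
have -> : 4 * Num.sqrt M%:R = 2 * Num.sqrt M%:R + 2 * Num.sqrt M%:R :> R by ring.
apply: lerD.
  rewrite big_nat_rev /= add0n.
  apply: (@le_trans _ _ (\sum_(0 <= i < g) (Num.sqrt i.+1%:R)^-1)).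
    rewrite big_mkcond /=; apply: ler_sum_nat => i /andP[_ ig].
    case: ifP => // _.
    by rewrite distrC -natrB ?leq_subr// subKn// ger0_norm.
  apply: le_trans (sum_invsqrt _) _.
  by rewrite ler_wpM2l// ler_sqrt ?ler_nat// ltnW.
rewrite big_ltn_cond// eqxx /=.
apply: (@le_trans _ _ (\sum_(0 <= i < M - g.+1) (Num.sqrt i.+1%:R)^-1)).
  rewrite -{1}[g.+1]add0n big_addn big_mkcond /=; apply: ler_sum_nat => i _.
  case: ifP => // _.
  by rewrite -natrB ?leq_addl// 1?addnS ?leqW ?leq_addl// subSn ?leq_addl// addnK ger0_norm.
apply: le_trans (sum_invsqrt _) _.
by rewrite ler_wpM2l// ler_sqrt ?ler_nat// leq_subr.
Qed.

(** This is the cancellation between the inner rings: over all [0 <= i < g] the sum would be only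
    [g], and leaving out the first [m] rings costs at most the order [m g], where the terms alone
    would allow [g ^ 2]. *)
Lemma sum_ring_weights m g : (m <= g)%N ->
  \sum_(m <= i < g) (g%:R - 2 * i%:R : R) = - ((m%:R - 1) * (g%:R - m%:R)).
Proof.
move=> mg; rewrite sumrB big_const_nat iter_addr_0 -mulr_sumr -(mulr_natl (g%:R)) natrB//.
have -> : 2 * \sum_(m <= i < g) i%:R = g%:R * (g%:R - 1) - m%:R * (m%:R - 1) :> R.
  rewrite -(subnK mg); elim: (g - m)%N => [|k IH]; first by rewrite big_geq// mulr0 subrr.
  rewrite addSn big_nat_recr ?leq_addl//= mulrDr IH -[in RHS]natr1 natrD; ring.
by ring.
Qed.

(** With [m = 4 ^ p], it brings the total rounding error [160 m ^ 9 / 4 ^ m] of the rings down to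
    [2 m ^ 3]. *)
Lemma exp4_dominates p : (3 <= p)%N -> 80 * ((4 ^ p)%:R) ^+ 6 <= (4 : R) ^+ (4 ^ p).
Proof.
move=> p3.
have H : (6 * p + 4 <= 4 ^ p)%N.
  elim: p p3 => // p IH; rewrite leq_eqVlt => /orP[/eqP<-//|p3].
  rewrite expnS; have := IH p3; lia.
apply: (@le_trans _ _ (4 ^+ (6 * p + 4))).
  rewrite natrX -exprM mulnC exprD mulrC ler_wpM2l ?exprn_ge0//.
  by rewrite -natrX ler_nat.
by rewrite ler_weXn2l// ler1n.
Qed.

End NumericBounds.

(** * Interaction of two rings, and of a ring with itself *)

Section RingConfiguration.
Variable R : realType.
Local Notation C := R[i].
Variables (m n : nat) (w : C).
Let Q := n.+1.
Hypotheses (m1 : (1 < m)%N) (QE : Q = (4 * m ^ 3)%N) (primw : Q.-primitive_root w).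

Definition ring_node (g k : nat) : C := (Num.sqrt g%:R / m%:R)%:C * w ^+ k.
Local Notation node := ring_node.

Let m0 : (0 : R) < m%:R. Proof. by rewrite ltr0n ltnW. Qed.
Let n0 : (0 < n)%N.
Proof.
have : (1 < Q)%N by rewrite QE; apply: (@leq_trans (4 * 1)) => //; rewrite leq_mul2l expn_gt0 (ltnW m1).
by [].
Qed.
Let Q0 : (0 : R) < Q%:R. Proof. by rewrite ltr0n. Qed.

Lemma cabs_ring_node g k : cabs (node g k) = Num.sqrt g%:R / m%:R.
Proof.
rewrite cabsM cabsX (cabs_unity primw) expr1n mulr1 cabsR ger0_norm//.
Qed.

Lemma cabs_ring_node_gt0 g k : (0 < g)%N -> 0 < cabs (node g k).
Proof. by move=> g0; rewrite cabs_ring_node divr_gt0// sqrtr_gt0 ltr0n. Qed.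

(** This is what leaving out the rings below [m] buys: rescaling to the point 1 costs a factor
    [sqrt m], less than the factor [m] gained by cancellation. *)
Lemma inv_cabs_ring_node g k : (m <= g)%N -> (cabs (node g k))^-1 <= Num.sqrt m%:R.
Proof.
move=> mg; have g0 : (0 < g)%N by rewrite (leq_trans _ mg)// ltnW.
rewrite cabs_ring_node invf_div ler_pdivrMr ?sqrtr_gt0 ?ltr0n//.
rewrite -{1}[m%:R](@sqr_sqrtr _ m%:R)// expr2 ler_wpM2l ?sqrtr_ge0//.
by rewrite ler_sqrt ?ler0n// ler_nat.
Qed.

Section TwoRings.
Variables (g h l : nat).
Hypotheses (mg : (m <= g)%N) (gM : (g < m ^ 2)%N) (mh : (m <= h)%N) (hM : (h < m ^ 2)%N).

Let g0 : (0 : R) < g%:R. Proof. by rewrite ltr0n (leq_trans _ mg)// ltnW. Qed.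
Let h0 : (0 : R) < h%:R. Proof. by rewrite ltr0n (leq_trans _ mh)// ltnW. Qed.
Let g1 : (0 < g)%N. Proof. by rewrite (leq_trans _ mg)// ltnW. Qed.
Let v : C := (Num.sqrt (h%:R / g%:R))%:C * w^-1 ^+ l.
Let q : R := (h%:R / g%:R) ^+ (2 * m ^ 3).

Let cv : cabs v ^+ 2 = h%:R / g%:R.
Proof.
rewrite cabsM cabsX cabsV (cabs_unity primw) invr1 expr1n mulr1 cabsR.
by rewrite real_normK ?num_real// sqr_sqrtr// divr_ge0.
Qed.

Let v0 : v != 0.
Proof.
apply/eqP => ve; have := cv; rewrite ve cabs0 expr0n/= => /esym/eqP.
by rewrite gt_eqF// divr_gt0.
Qed.

Let vQ : v ^+ Q = q%:C.
Proof.
rewrite exprMn -exprM [(l * Q)%N]mulnC exprM exprVn (prim_expr_order primw).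
rewrite invr1 expr1n mulr1 -rmorphXn/=; congr (_%:C).
rewrite QE (_ : (4 * m ^ 3 = 2 * (2 * m ^ 3))%N); last by rewrite mulnA.
by rewrite exprM sqr_sqrtr// divr_ge0.
Qed.

Let node_sub k : node g l - node h k = node g l * (1 - v * w ^+ k).
Proof.
rewrite mulrBr mulr1; congr (_ - _); rewrite /node /v !mulrA; congr (_ * _).
rewrite -!mulrA [w ^+ l * _]mulrCA -exprMn mulfV ?(unity_neq0 primw)// expr1n mulr1.
rewrite -rmorphM /=; congr (_%:C).
rewrite sqrtrM ?ler0n// sqrtrV ?ler0n// mulrAC mulrCA mulrC !mulrA mulfK.
  by rewrite mulrC.
by rewrite gt_eqF// sqrtr_gt0.
Qed.

Let q_small : (h < g)%N -> 0 <= q <= (4 ^+ m)^-1.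
Proof.
move=> hg; have q0 : 0 < q by rewrite exprn_gt0 ?divr_gt0.
rewrite ltW//=.
rewrite -[q]invrK lef_pV2 ?posrE ?exprn_gt0 ?invr_gt0 ?divr_gt0//.
rewrite -exprVn invf_div; apply: ratio_power => //; last by rewrite ltnW.
by rewrite -(ltr0n R).
Qed.

Let q_large : (g < h)%N -> 4 ^+ m <= q.
Proof. by move=> gh; apply: ratio_power => //; rewrite ltnW. Qed.

Let four_m : (2 : R) <= 4 ^+ m.
Proof.
apply: (@le_trans _ _ (4 ^+ 1)); first by rewrite expr1 ler_nat.
by rewrite ler_weXn2l ?ler1n// ltnW.
Qed.

Lemma two_rings_norm2 : g != h ->
  \sum_(k < Q) (cabs (node g l - node h k) ^+ 2)^-1 <=
  4 * Q%:R * m%:R ^+ 2 / `|h%:R - g%:R|.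
Proof.
move=> gh; under eq_bigr do rewrite node_sub cabsM exprMn invfM.
rewrite -mulr_sumr cabs_ring_node exprMn sqr_sqrtr// exprVn invfM invrK.
have H : \sum_(k < Q) (cabs (1 - v * w ^+ k) ^+ 2)^-1 <= 4 * Q%:R / `|1 - h%:R / g%:R|.
  rewrite -cv; apply: (ring_norm2 primw vQ).
    move: gh; rewrite neq_ltn orbC => /orP[/q_small/andP[-> q1]/=|/q_large q1].
      apply/orP; left; apply: le_trans q1 _.
      by rewrite lef_pV2 ?posrE ?exprn_gt0.
    by apply/orP; right; apply: le_trans q1.
  apply: contra gh => /eqP v1; move: cv; rewrite v1 expr1n => /esym/eqP.
  move=> /eqP hg1; have := divfK (lt0r_neq0 g0) h%:R.
  by rewrite hg1 mul1r => /eqP; rewrite eqr_nat.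
have gn : `|1 - h%:R / g%:R| = `|h%:R - g%:R| / g%:R :> R.
  have -> : 1 - h%:R / g%:R = (g%:R - h%:R) / g%:R :> R.
    by rewrite mulrBl mulfV// gt_eqF.
  by rewrite normf_div (gtr0_norm g0) distrC.
rewrite gn invf_div in H.
apply: (@le_trans _ _ (g%:R^-1 * m%:R ^+ 2 * (4 * Q%:R * (g%:R / `|h%:R - g%:R|)))).
  by rewrite ler_wpM2l// mulr_ge0 ?invr_ge0 ?exprn_ge0.
rewrite le_eqVlt; apply/orP; left; apply/eqP.
have hgn : `|h%:R - g%:R| != 0 :> R by rewrite normr_eq0 subr_eq0 eqr_nat eq_sym.
by field; rewrite hgn gt_eqF.
Qed.

Lemma two_rings_norm1 : g != h ->
  \sum_(k < Q) (cabs (node g l - node h k))^-1 <=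
  2 * Q%:R * m%:R * (Num.sqrt `|h%:R - g%:R|)^-1.
Proof.
move=> gh; set D := `|h%:R - g%:R|.
have D0 : 0 < D by rewrite normr_gt0 subr_eq0 eqr_nat eq_sym.
set s := Num.sqrt D.
have DS : D = s ^+ 2 by rewrite sqr_sqrtr// ltW.
have S0 : 0 < s by rewrite sqrtr_gt0.
(* [L ^ 2] is the mean of the squares given by [two_rings_norm2]; with this weight the inequality
   [A] below plays the role of Cauchy-Schwarz. *)
set L := 2 * m%:R / s.
have L0 : 0 < L by rewrite divr_gt0// mulr_gt0.
have A (a : R) : a <= 2^-1 * L + (2 * L)^-1 * a ^+ 2.
  rewrite -subr_ge0.
  have -> : 2^-1 * L + (2 * L)^-1 * a ^+ 2 - a = (L - a) ^+ 2 / (2 * L).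
    by field; rewrite gt_eqF.
  by rewrite divr_ge0 ?sqr_ge0// mulr_ge0// ltW.
apply: (@le_trans _ _ (\sum_(k < Q) (2^-1 * L + (2 * L)^-1 * (cabs (node g l - node h k) ^+ 2)^-1))).
  by apply: ler_sum => k _; rewrite -exprVn.
rewrite big_split /= sumr_const card_ord -mulr_sumr.
apply: (@le_trans _ _ (2^-1 * L *+ Q + (2 * L)^-1 * (4 * Q%:R * m%:R ^+ 2 / D))).
  rewrite lerD2l; apply: ler_wpM2l; last exact: two_rings_norm2.
  by rewrite invr_ge0 mulr_ge0// ltW.
rewrite -(mulr_natl (2^-1 * L)) le_eqVlt; apply/orP; left; apply/eqP.
rewrite DS /L; clearbody s.
by field; rewrite !gt_eqF.
Qed.

Lemma inner_ring_potential : (h < g)%N ->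
  cabs (\sum_(k < Q) huovinenK (node g l - node h k)
        - huovinenK (node g l) * (Q%:R * (1 - 2 * (h%:R / g%:R)))%:C) <=
  (cabs (node g l))^-1 * (10 * Q%:R ^+ 2 / 4 ^+ m).
Proof.
move=> hg; under eq_bigr do rewrite node_sub huovinenKM.
rewrite -mulr_sumr -mulrBr cabsM cabs_huovinenK ler_wpM2l ?invr_ge0 ?cabs_ge0//.
have /andP[q0 q1] := q_small hg.
have q2 : q <= 2^-1 by apply: le_trans q1 _; rewrite lef_pV2 ?posrE ?exprn_gt0.
rewrite -cv; apply: le_trans (ring_potential_outside primw n0 v0 vQ _ _) _.
- by rewrite q0.
- by rewrite cv ler_pdivrMr// mul1r ler_nat ltnW.
- by rewrite ler_wpM2l// mulr_ge0// exprn_ge0.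
Qed.

Lemma outer_ring_potential : (g < h)%N ->
  cabs (\sum_(k < Q) huovinenK (node g l - node h k)) <=
  (cabs (node g l))^-1 * (6 * m%:R * Q%:R ^+ 2 / 4 ^+ m).
Proof.
move=> gh; under eq_bigr do rewrite node_sub huovinenKM.
rewrite -mulr_sumr cabsM cabs_huovinenK ler_wpM2l ?invr_ge0 ?cabs_ge0//.
have q1 := q_large gh.
apply: le_trans (ring_potential_inside primw n0 v0 vQ _ _) _.
- exact: le_trans q1.
- by rewrite cv ler_pdivlMr// mul1r ler_nat ltnW.
apply: ler_pM.
- by rewrite !mulr_ge0 ?exprn_ge0 ?cabs_ge0.
- by rewrite invr_ge0 (le_trans _ q1)// exprn_ge0.
- rewrite ler_wpM2r ?exprn_ge0// ler_wpM2l// cv ler_pdivrMr//.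
  rewrite -natrM ler_nat; apply: leq_trans (ltnW hM) _.
  by rewrite expnS expn1 leq_mul2l mg orbT.
- have q0 : 0 < q by apply: lt_le_trans q1; rewrite exprn_gt0.
  by rewrite lef_pV2 ?posrE// exprn_gt0.
Qed.

End TwoRings.

Section SameRing.
Variables (g : nat) (l : 'I_Q).
Hypotheses (mg : (m <= g)%N).

Let g1 : (0 < g)%N. Proof. by rewrite (leq_trans _ mg)// ltnW. Qed.

Lemma same_ring_sum (V : nmodType) (F : C -> V) :
  \sum_(k < Q | k != l) F (node g l - node g k) =
  \sum_(k < n) F (node g l * (1 - w ^+ k.+1)).
Proof.
rewrite -(sum_unity_rotate_neq primw (fun u => F (node g l * (1 - u))) l).
apply: eq_bigr => k _; congr F; rewrite mulrBr mulr1; congr (_ - _).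
by rewrite /node mulrACA -exprMn mulfV ?(unity_neq0 primw)// expr1n mulr1.
Qed.

Lemma same_ring_potential :
  cabs (\sum_(k < Q | k != l) huovinenK (node g l - node g k)) <=
  (cabs (node g l))^-1 * Q%:R.
Proof.
rewrite same_ring_sum; under eq_bigr do rewrite huovinenKM.
rewrite -mulr_sumr cabsM cabs_huovinenK ler_wpM2l ?invr_ge0 ?cabs_ge0//.
exact: ring_self_potential.
Qed.

Lemma same_ring_norm1 :
  \sum_(k < Q | k != l) (cabs (node g l - node g k))^-1 <= 2 * Q%:R * m%:R ^+ 2.
Proof.
rewrite (same_ring_sum (fun z => (cabs z)^-1)).
under eq_bigr do rewrite cabsM invfM.
rewrite -mulr_sumr.
have S := sum_norm2_on_circle primw.
(* Cauchy-Schwarz gives [Q sqrt Q] for a sum of true order [Q log Q]. This suffices: with the factor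
   [sqrt m] for the radius it becomes [Q sqrt (m Q) = 2 Q m ^ 2], the order of [N]. *)
set L : R := Num.sqrt Q%:R.
have L0 : 0 < L by rewrite sqrtr_gt0.
have A (a : R) : a <= 2^-1 * L + (2 * L)^-1 * a ^+ 2.
  rewrite -subr_ge0.
  have -> : 2^-1 * L + (2 * L)^-1 * a ^+ 2 - a = (L - a) ^+ 2 / (2 * L).
    by field; rewrite gt_eqF.
  by rewrite divr_ge0 ?sqr_ge0// mulr_ge0// ltW.
have H : \sum_(k < n) (cabs (1 - w ^+ k.+1))^-1 <= Q%:R * L.
  apply: (@le_trans _ _ (\sum_(k < n) (2^-1 * L + (2 * L)^-1 * (cabs (1 - w ^+ k.+1) ^+ 2)^-1))).
    by apply: ler_sum => k _; rewrite -exprVn.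
  rewrite big_split /= sumr_const card_ord -mulr_sumr -(mulr_natl (2^-1 * L)).
  have S' : \sum_(k < n) (cabs (1 - w ^+ k.+1) ^+ 2)^-1 <= Q%:R ^+ 2.
    apply: le_trans S; rewrite [leRHS]big_mkcond big_ord_recl /= add0r.
    exact: ler_sum.
  apply: (@le_trans _ _ (Q%:R * (2^-1 * L) + (2 * L)^-1 * Q%:R ^+ 2)).
    apply: lerD; last by rewrite ler_wpM2l// invr_ge0 mulr_ge0// ltW.
    by rewrite ler_wpM2r ?mulr_ge0 ?invr_ge0 ?ltW// ltr_nat.
  have LL : L ^+ 2 = Q%:R by rewrite sqr_sqrtr.
  rewrite -LL le_eqVlt; apply/orP; left; apply/eqP.
  by field; rewrite gt_eqF.
apply: (@le_trans _ _ (Num.sqrt m%:R * (Q%:R * L))).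
  apply: ler_pM => //; first by rewrite invr_ge0 cabs_ge0.
    by apply: sumr_ge0 => k _; rewrite invr_ge0 cabs_ge0.
  exact: inv_cabs_ring_node.
have -> : Num.sqrt m%:R * (Q%:R * L) = Q%:R * (Num.sqrt m%:R * L) by ring.
rewrite [2 * _]mulrC -mulrA ler_wpM2l// -sqrtrM ?ler0n// QE -natrM.
have -> : (m * (4 * m ^ 3))%N = ((2 * m ^ 2) ^ 2)%N by rewrite !expnS expn0; ring.
by rewrite natrX sqrtr_sqr ger0_norm// natrM natrX.
Qed.

End SameRing.
End RingConfiguration.

(** * Finite configurations with small potential *)

(** The size makes consecutive radii differ by a factor 1000. Separation makes cells sparse, for
    unrectifiability and for linearizing the kernel. The energy controls the growth of the measure
    and the sum of the linearization errors. The potential is the change caused by one generation.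
    The spread gives a fixed proportion of points with a fixed proportion of far partners, on which
    the principal values fail. *)
Record point_config (R : realType) (eps : R) (N : nat) (p : nat -> R[i]) : Prop :=
  PointConfig {
  config_size : (1000 <= N)%N;
  config_disc : forall d, (d < N)%N -> cabs (p d) <= 1;
  config_separated : forall d e, (d < N)%N -> (e < N)%N -> d != e ->
    1 <= eps * (N%:R * cabs (p d - p e));
  config_energy : forall d, (d < N)%N ->
    \sum_(0 <= e < N | e != d) (cabs (p d - p e))^-1 <= 20 * N%:R;
  config_potential : forall d, (d < N)%N ->
    cabs (\sum_(0 <= e < N | e != d) huovinenK (p d - p e)) <= eps * N%:R;
  config_spread : exists G : pred nat,
    (N <= 200 * \sum_(0 <= d < N | G d) 1)%N /\
    forall d, (d < N)%N -> G d ->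
      (N <= 200 * \sum_(0 <= e < N | (9 / 5 <= cabs (p d - p e))%R) 1)%N
}.

Lemma sum_nat_mul (V : nmodType) (a b : nat) (F : nat -> V) :
  \sum_(0 <= e < a * b) F e = \sum_(0 <= i < a) \sum_(0 <= k < b) F (i * b + k)%N.
Proof.
elim: a => [|a IH]; first by rewrite mul0n !big_geq.
rewrite big_nat_recr//= -IH mulSn addnC (@big_cat_nat _ _ _ (a * b))//= ?leq_addr//.
congr (_ + _); rewrite -{1}[(a * b)%N]add0n big_addn addKn.
by apply: eq_big_nat => k _; rewrite addnC.
Qed.

Lemma sum_nat_shift (V : nmodType) (a b : nat) (F : nat -> V) :
  \sum_(a <= h < b) F h = \sum_(0 <= h < b - a) F (h + a)%N.
Proof. by rewrite -{1}[a]add0n big_addn. Qed.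

(** * The configuration of all rings *)

Section RingPoints.
Variable R : realType.
Local Notation C := R[i].
Variables (m n : nat) (w : C).
Let Q := n.+1.
Hypotheses (m1 : (1 < m)%N) (QE : Q = (4 * m ^ 3)%N) (primw : Q.-primitive_root w).
Local Notation node := (ring_node m w).

Let N := ((m ^ 2 - m) * Q)%N.
Definition ring_point (d : nat) : C := node (m + d %/ Q) (d %% Q).

Let m0 : (0 : R) < m%:R. Proof. by rewrite ltr0n ltnW. Qed.
Let mM : (m <= m ^ 2)%N. Proof. by rewrite -[leqLHS]expn1 leq_exp2l. Qed.
Let Q0 : (0 : R) < Q%:R. Proof. by rewrite ltr0n. Qed.

Lemma ring_point_bounds d : (d < N)%N -> (m <= m + d %/ Q < m ^ 2)%N.
Proof.
move=> dN; rewrite leq_addr /= -ltn_subRL ltn_divLR//.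
Qed.

Lemma sum_ring_point (V : nmodType) (P : pred C) (F : C -> V) :
  \sum_(0 <= e < N | P (ring_point e)) F (ring_point e) =
  \sum_(m <= h < m ^ 2) \sum_(k < Q | P (node h k)) F (node h k).
Proof.
rewrite big_mkcond /N sum_nat_mul [RHS]sum_nat_shift.
apply: eq_big_nat => h _; rewrite big_mkord [RHS]big_mkcond /=.
apply: eq_bigr => k _.
by rewrite /ring_point divnMDl// divn_small// addn0 modnMDl modn_small// addnC.
Qed.

Lemma sum_ring_point_neq (V : nmodType) (F : C -> V) d : (d < N)%N ->
  \sum_(0 <= e < N | e != d) F (ring_point e) =
  \sum_(m <= h < m ^ 2 | h != (m + d %/ Q)%N) \sum_(k < Q) F (node h k) +
  \sum_(k < Q | k != inord (d %% Q)) F (node (m + d %/ Q) k).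
Proof.
move=> dN; rewrite big_mkcond /N sum_nat_mul.
have dQ : (0 <= d %/ Q < m ^ 2 - m)%N by rewrite leq0n ltn_divLR.
have E i k : (k < Q)%N -> (i * Q + k == d)%N = ((i == d %/ Q) && (k == d %% Q))%N.
  move=> kQ; apply/eqP/andP => [<-|[/eqP-> /eqP->]]; last by rewrite -divn_eq.
  by rewrite divnMDl// divn_small// addn0 modnMDl modn_small// !eqxx.
have P i k : (k < Q)%N -> ring_point (i * Q + k)%N = node (i + m)%N k.
  move=> kQ.
  by rewrite /ring_point divnMDl// divn_small// addn0 modnMDl modn_small// addnC.
rewrite (bigD1_seq (d %/ Q)%N) ?iota_uniq ?mem_index_iota//= addrC; congr (_ + _).
  rewrite big_mkcond [RHS]big_mkcond [RHS]sum_nat_shift /=.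
  apply: eq_big_nat => i _; rewrite [(m + _)%N]addnC eqn_add2r; case: ifP => // id.
  rewrite big_mkord; apply: eq_bigr => k _; rewrite E// (negbTE id)/= P//.
rewrite big_mkord [RHS]big_mkcond /=; apply: eq_bigr => k _.
rewrite E// eqxx /= P// addnC -val_eqE /= inordK ?ltn_pmod//.
Qed.

Let sqrt_nat_le g : (g <= m ^ 2)%N -> Num.sqrt g%:R <= m%:R :> R.
Proof.
move=> gm; have -> : m%:R = Num.sqrt (m ^ 2)%:R :> R.
  by rewrite natrX sqrtr_sqr ger0_norm.
by rewrite ler_sqrt// ler_nat.
Qed.

(** The radii differ by [(g - h) / (sqrt g + sqrt h) / m], and both square roots are at most [m]. *)
Lemma cabs_ring_point_sub g h k l : (g <= m ^ 2)%N -> (h <= m ^ 2)%N ->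
  `|g%:R - h%:R| / (2 * m%:R ^+ 2) <= cabs (node g k - node h l).
Proof.
move=> gM hM.
apply: (@le_trans _ _ `|cabs (node g k) - cabs (node h l)|); last first.
  rewrite ler_norml cabsB_ge andbT lerNl opprB cabsBC; exact: cabsB_ge.
rewrite !(cabs_ring_node _ primw) -mulrBl normrM (ger0_norm (x := m%:R^-1)) ?invr_ge0//.
set a := Num.sqrt g%:R; set b := Num.sqrt h%:R.
have ag : a ^+ 2 = g%:R by rewrite sqr_sqrtr.
have bh : b ^+ 2 = h%:R by rewrite sqr_sqrtr.
have am : a <= m%:R := sqrt_nat_le gM.
have bm : b <= m%:R := sqrt_nat_le hM.
have a0 : 0 <= a := sqrtr_ge0 _.
have b0 : 0 <= b := sqrtr_ge0 _.
rewrite -ag -bh subr_sqr normrM (ger0_norm (x := a + b)) ?addr_ge0//.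
rewrite -mulrA ler_wpM2l// ler_pdivrMr ?mulr_gt0 ?exprn_gt0//.
have -> : m%:R^-1 * (2 * m%:R ^+ 2) = m%:R + m%:R :> R by field; rewrite gt_eqF.
exact: lerD.
Qed.

(** Two points of one ring have radius at least [1 / sqrt m] and a chord of at least [2 / Q] times
    it, which gives the bound exactly; distinct rings are at least [1 / (2 m ^ 2)] apart, which is
    larger. *)
Lemma ring_point_separated d e : (d < N)%N -> (e < N)%N -> d != e ->
  (2 * m%:R ^+ 3 * Num.sqrt m%:R)^-1 <= cabs (ring_point d - ring_point e).
Proof.
move=> dN eN de.
have s1 : 1 <= Num.sqrt m%:R :> R.
  by rewrite -[leLHS]sqrtr1 ler_sqrt// ler1n ltnW.
have s0 : 0 < Num.sqrt m%:R :> R by apply: lt_le_trans s1.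
have /andP[mg gM] := ring_point_bounds dN.
have /andP[mh hM] := ring_point_bounds eN.
have [gh|gh] := eqVneq (d %/ Q)%N (e %/ Q)%N.
  rewrite /ring_point -gh.
  have kl : (d %% Q != e %% Q)%N.
    by apply: contra de => /eqP kl; rewrite (divn_eq d Q) gh kl -divn_eq.
  pose k : 'I_Q := inord (d %% Q)%N; pose l : 'I_Q := inord (e %% Q)%N.
  have kE : (d %% Q)%N = k by rewrite inordK// ltn_pmod.
  have lE : (e %% Q)%N = l by rewrite inordK// ltn_pmod.
  rewrite kE lE in kl *; set g := (m + _)%N in mg gM *.
  have -> : node g k - node g l = node g k * (1 - w ^+ l * w^-1 ^+ k).
    rewrite mulrBr mulr1; congr (_ - _); rewrite /ring_node mulrACA -exprMn.
    by rewrite mulfV ?(unity_neq0 primw)// expr1n mulr1.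
  have [j jQ ->] : exists2 j, (0 < j < Q)%N & w ^+ l * w^-1 ^+ k = w ^+ j.
    exists ((l + (Q - k)) %% Q)%N; last first.
      rewrite (prim_expr_mod primw) exprD; congr (_ * _).
      apply: (mulIf (expf_neq0 k (unity_neq0 primw))).
      rewrite -exprMn mulVf ?(unity_neq0 primw)// expr1n -exprD subnK 1?ltnW//.
      by rewrite (prim_expr_order primw).
    rewrite ltn_pmod// andbT lt0n; apply: contra kl => /eqP H.
    have : (l + (Q - k) + k = k %[mod Q])%N by rewrite -modnDml H add0n.
    rewrite -addnA subnK 1?ltnW// modnDr !modn_small// => ->//.
  have := unity_separated primw jQ.
  rewrite cabsM => sep.
  have zs := inv_cabs_ring_node m1 primw k mg.
  have g0 : (0 < g)%N by rewrite (leq_trans _ mg)// ltnW.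
  have z0 := cabs_ring_node_gt0 m1 primw k g0.
  have {}zs : (Num.sqrt m%:R)^-1 <= cabs (node g k).
    by rewrite -[leRHS]invrK lef_pV2 ?posrE ?invr_gt0.
  have us : 2 / Q%:R <= cabs (1 - w ^+ j) by rewrite ler_pdivrMr// mulrC.
  apply: (@le_trans _ _ ((Num.sqrt m%:R)^-1 * (2 / Q%:R))).
    rewrite QE natrM natrX le_eqVlt; apply/orP; left; apply/eqP.
    by field; rewrite !gt_eqF.
  by apply: ler_pM => //; rewrite ?invr_ge0 ?divr_ge0// ltW.
have H := cabs_ring_point_sub (d %% Q) (e %% Q) (ltnW gM) (ltnW hM).
apply: le_trans H.
have D1 : 1 <= `|(m + d %/ Q)%N%:R - (m + e %/ Q)%N%:R| :> R.
  rewrite !natrD opprD addrACA subrr add0r.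
  have [lt|lt|eq] := ltngtP (d %/ Q)%N (e %/ Q)%N.
  - by rewrite distrC -natrB 1?ltnW// ger0_norm// ler1n subn_gt0.
  - by rewrite -natrB 1?ltnW// ger0_norm// ler1n subn_gt0.
  - by rewrite eq eqxx in gh.
apply: (@le_trans _ _ (1 / (2 * m%:R ^+ 2))); last first.
  by rewrite ler_wpM2r// invr_ge0 mulr_ge0// exprn_ge0.
rewrite div1r lef_pV2 ?posrE ?mulr_gt0 ?exprn_gt0//.
apply: (@le_trans _ _ (2 * m%:R ^+ 3)).
  by rewrite ler_wpM2l// ler_weXn2l// ler1n ltnW.
by rewrite ler_peMr// mulr_ge0// exprn_ge0.
Qed.

Lemma ring_point_disc d : (d < N)%N -> cabs (ring_point d) <= 1.
Proof.
move=> /ring_point_bounds/andP[mg gM].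
rewrite /ring_point (cabs_ring_node _ primw) ler_pdivrMr// mul1r.
exact/sqrt_nat_le/ltnW.
Qed.

Lemma ring_point_energy d : (d < N)%N ->
  \sum_(0 <= e < N | e != d) (cabs (ring_point d - ring_point e))^-1 <=
  10 * Q%:R * m%:R ^+ 2.
Proof.
move=> dN; have /andP[mg gM] := ring_point_bounds dN.
rewrite (sum_ring_point_neq (fun z => (cabs (ring_point d - z))^-1) dN).
rewrite /ring_point; set g := (m + _)%N in mg gM *; set l := (d %% Q)%N.
have lQ : (l < Q)%N by rewrite ltn_pmod.
have -> : 10 * Q%:R * m%:R ^+ 2 = 2 * Q%:R * m%:R * (4 * m%:R) + 2 * Q%:R * m%:R ^+ 2 :> R by ring.
apply: lerD; last first.
  have := same_ring_norm1 m1 QE primw (inord l : 'I_Q) mg.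
  by rewrite inordK.
apply: (@le_trans _ _ (\sum_(m <= h < m ^ 2 | h != g)
   2 * Q%:R * m%:R * (Num.sqrt `|h%:R - g%:R|)^-1)).
  rewrite big_mkcond [leRHS]big_mkcond /=; apply: ler_sum_nat => h /andP[mh hM].
  case: ifP => // hg; apply: (two_rings_norm1 m1 QE primw) => //.
  by rewrite eq_sym.
rewrite -mulr_sumr ler_wpM2l ?mulr_ge0//.
apply: (@le_trans _ _ (\sum_(0 <= h < m ^ 2 | h != g) (Num.sqrt `|h%:R - g%:R|)^-1)).
  rewrite [leRHS](@big_cat_nat _ _ _ m)//= lerDr sumr_ge0// => i _.
apply: le_trans (sum_invsqrt_dist _ gM) _.
by rewrite natrX sqrtr_sqr ger0_norm.
Qed.

(** The three terms are the uncancelled inner rings, the deviation of at most [m ^ 2] rings from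
    uniform circles, and the ring of the point itself; [sqrt m] bounds [1 / |p d|]. *)
Lemma ring_point_potential d : (d < N)%N ->
  cabs (\sum_(0 <= e < N | e != d) huovinenK (ring_point d - ring_point e)) <=
  Num.sqrt m%:R * (Q%:R * m%:R + m%:R ^+ 2 * (10 * m%:R * Q%:R ^+ 2 / 4 ^+ m) + Q%:R).
Proof.
move=> dN; have /andP[mg gM] := ring_point_bounds dN.
rewrite (sum_ring_point_neq (fun z => huovinenK (ring_point d - z)) dN).
rewrite /ring_point; set g := (m + _)%N in mg gM *; set l := (d %% Q)%N.
have lQ : (l < Q)%N by rewrite ltn_pmod.
have g0 : (0 < g)%N by rewrite (leq_trans _ mg)// ltnW.
have g0' : (0 : R) < g%:R by rewrite ltr0n.
have zs := inv_cabs_ring_node m1 primw l mg.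
set z := node g l in zs *.
set E := 10 * m%:R * Q%:R ^+ 2 / 4 ^+ m.
have E0 : 0 <= E by rewrite divr_ge0 ?mulr_ge0 ?exprn_ge0.
apply: (@le_trans _ _ ((cabs z)^-1 * (Q%:R * m%:R + m%:R ^+ 2 * E + Q%:R))); last first.
  by rewrite ler_wpM2r// !addr_ge0// mulr_ge0// exprn_ge0.
rewrite mulrDr; apply: le_trans (cabsD _ _) _; apply: lerD; last first.
  by have := same_ring_potential m primw g (inord l : 'I_Q); rewrite inordK.
(* The contribution of the ring [h] if it were a uniform circle: zero for the rings outside the
   point. *)
pose ideal h := if (h < g)%N then huovinenK z * (Q%:R * (1 - 2 * (h%:R / g%:R)))%:C else 0.
rewrite (eq_bigr (fun h => ideal h + (\sum_(k < Q) huovinenK (z - node h k) - ideal h))); last first.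
  by move=> h _; rewrite addrC subrK.
rewrite big_split /= mulrDr; apply: le_trans (cabsD _ _) _; apply: lerD.
  have -> : \sum_(m <= h < m ^ 2 | h != g) ideal h =
     huovinenK z * (\sum_(m <= h < g) Q%:R * (1 - 2 * (h%:R / g%:R)))%:C.
    rewrite rmorph_sum mulr_sumr /= [RHS](@big_nat_widen _ _ _ _ _ (m ^ 2)%N) 1?ltnW//=.
    rewrite [LHS]big_mkcond [RHS]big_mkcond /=; apply: eq_big_nat => h _.
    by rewrite /ideal; case: ltngtP.
  rewrite cabsM cabs_huovinenK ler_wpM2l ?invr_ge0 ?cabs_ge0// cabsR -mulr_sumr.
  have -> : \sum_(m <= h < g) (1 - 2 * (h%:R / g%:R)) =
      g%:R^-1 * \sum_(m <= h < g) (g%:R - 2 * h%:R) :> R.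
    rewrite mulr_sumr; apply: eq_bigr => h _.
    by field; rewrite gt_eqF.
  rewrite (sum_ring_weights _ mg) normrM (ger0_norm (ler0n _ Q)) ler_wpM2l//.
  have mgR : (m%:R : R) <= g%:R by rewrite ler_nat.
  have m1R : (1 : R) <= m%:R by rewrite ler1n ltnW.
  rewrite mulrN normrN ger0_norm; last by rewrite mulr_ge0 ?invr_ge0// mulr_ge0// subr_ge0.
  rewrite mulrC ler_pdivrMr//.
  by apply: ler_pM; rewrite ?subr_ge0 ?lerBlDr ?lerDl.
apply: le_trans (cabs_sum _ _ _) _.
apply: (@le_trans _ _ (\sum_(m <= h < m ^ 2 | h != g) (cabs z)^-1 * E)).
  rewrite big_mkcond [leRHS]big_mkcond /=; apply: ler_sum_nat => h /andP[mh hM].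
  case: ifP => // hg; rewrite /ideal.
  have [hlt|hgt|heq] := ltngtP h g; last by rewrite heq eqxx in hg.
    apply: le_trans (inner_ring_potential m1 QE primw l mg mh hM hlt) _.
    rewrite ler_wpM2l ?invr_ge0 ?cabs_ge0// ler_wpM2r ?invr_ge0 ?exprn_ge0//.
    by rewrite ler_wpM2r ?exprn_ge0// -[leLHS]mulr1 ler_wpM2l// ler1n ltnW.
  rewrite subr0; apply: le_trans (outer_ring_potential m1 QE primw l mg gM mh hM hgt) _.
  rewrite ler_wpM2l ?invr_ge0 ?cabs_ge0// ler_wpM2r ?invr_ge0 ?exprn_ge0//.
  by rewrite ler_wpM2r ?exprn_ge0// ler_wpM2r// ler_nat.
rewrite [leRHS]mulrCA; apply: (@le_trans _ _ (\sum_(0 <= h < m ^ 2) (cabs z)^-1 * E)).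
  rewrite [leRHS](@big_cat_nat _ _ _ m)//= big_mkcond /=.
  rewrite -[leLHS]add0r; apply: lerD.
    by apply: sumr_ge0 => i _; rewrite mulr_ge0 ?invr_ge0 ?cabs_ge0.
  by apply: ler_sum_nat => h _; case: ifP => // _; rewrite mulr_ge0 ?invr_ge0 ?cabs_ge0.
by rewrite big_const_nat subn0 iter_addr_0 -(mulr_natl (_ * E)) natrX.
Qed.

End RingPoints.

(** * Points nearly opposite to a given one *)

Section Quadrants.
Variable R : realType.
Local Notation C := R[i].
Variables (n : nat) (w : C).
Let Q := n.+1.
Hypotheses (Q4 : (4 %| Q)%N) (primw : Q.-primitive_root w).

(* The four quarter turns of the ring cover the circle by four copies of the
   arc [Re u <= - 7 / 10]. *)
Lemma quadrant_count (l : nat) :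
  (Q <= 4 * \sum_(k < Q | (complex.Re (w ^+ k * w^-1 ^+ l) <= - (7 / 10))%R) 1)%N.
Proof.
pose c (u : C) : nat := (complex.Re u <= - (7 / 10))%R.
have -> : (\sum_(k < Q | (complex.Re (w ^+ k * w^-1 ^+ l) <= - (7 / 10))%R) 1 =
    \sum_(k < Q) c (w ^+ k))%N.
  rewrite -(sum_unity_rotate primw c l) big_mkcond /=.
  by apply: eq_bigr => k _; rewrite /c; case: (_ <= _)%R.
pose ii : C := 0 +i* 1.
have ii2 : ii ^+ 2 = -1 by exact: sqr_i.
have iiQ : ii ^+ Q = 1.
  by rewrite -(divnK Q4) mulnC exprM (_ : 4 = 2 * 2)%N// exprM ii2 sqrrN !expr1n.
have [t tE] := prim_rootP primw iiQ.
have tV : w^-1 ^+ t = - ii.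
  rewrite exprVn -tE; apply: (mulIf (_ : ii != 0)).
    by rewrite eq_complex /= oner_eq0 andbF.
  by rewrite mulVf ?mulNr -?expr2 ?ii2 ?opprK// eq_complex /= oner_eq0 andbF.
have rot j : (\sum_(k < Q) c (w ^+ k) = \sum_(k < Q) c (w ^+ k * (- ii) ^+ j)%R)%N.
  by rewrite -(sum_unity_rotate primw c (t * j)%N) exprM tV.
have -> : (4 * \sum_(k < Q) c (w ^+ k) = \sum_(k < Q) (c (w ^+ k) +
   c (w ^+ k * (- ii) ^+ 1)%R + c (w ^+ k * (- ii) ^+ 2)%R + c (w ^+ k * (- ii) ^+ 3)%R))%N.
  by rewrite !big_split /= -(rot 1%N) -(rot 2%N) -(rot 3%N) !mulSn mul0n addn0 !addnA.
rewrite -[leqLHS]card_ord -sum1_card; apply: leq_sum => k _.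
have : cabs (w ^+ k) ^+ 2 = 1 by rewrite cabsX (cabs_unity primw) !expr1n.
rewrite sqr_cabs; case: (w ^+ k) => a b /= ab.
have p2 : (- ii) ^+ 2 = -1 by rewrite sqrrN ii2.
have p3 : (- ii) ^+ 3 = ii by rewrite exprS p2 mulrN1 opprK.
rewrite p2 p3 expr1 mulrN mulrN1 /c.
have -> : complex.Re (- ((a +i* b) * ii)) = b.
  by change (- (a * 0 - b * 1) = b); ring.
have -> : complex.Re ((a +i* b) * ii) = - b.
  by change (a * 0 - b * 1 = - b); ring.
have -> : complex.Re (- (a +i* b)) = - a by [].
rewrite [complex.Re _]/=.
case: (lerP a (- (7 / 10))) => [|h1]//.
case: (lerP b (- (7 / 10))) => [|h2]; first by rewrite addn1.
case: (lerP (- a) (- (7 / 10))) => [|h3]//.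
case: (lerP (- b) (- (7 / 10))) => [|h4]//.
(* Otherwise both coordinates are below 7/10 in modulus, and a unit vector would have square at most
   98/100. *)
exfalso; clear -ab h1 h2 h3 h4.
have : a ^+ 2 < 49 / 100 by nra.
have : b ^+ 2 < 49 / 100 by nra.
lra.
Qed.

End Quadrants.

(** The squared distance is [a^2 + b^2 - 2 a b x >= (2 + 7/5) * 24/25 = 3.264], just above
    [(9/5)^2 = 3.24]. The 9/5 must exceed the truncation radius 7/4, which fixes how thin the outer
    rings and how short the opposite arc have to be. *)
Lemma opposite_arc_far (R : realType) (a b x y : R) : 0 <= a -> 0 <= b ->
  24 / 25 <= a ^+ 2 -> 24 / 25 <= b ^+ 2 -> x <= - (7 / 10) ->
  x ^+ 2 + y ^+ 2 = 1 ->
  (9 / 5 : R) ^+ 2 <= (a - (b * x - 0 * y)) ^+ 2 + (0 - (b * y + 0 * x)) ^+ 2.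
Proof.
move=> a0 b0 a2 b2 re uu.
have ab : 24 / 25 <= a * b.
  rewrite -(@ler_pXn2r _ 2)// ?nnegrE ?mulr_ge0// [leRHS]exprMn [leLHS]expr2.
  by apply: ler_pM.
have abx : 0 <= a * b * (- (7 / 10) - x) by rewrite !mulr_ge0// subr_ge0.
have -> : (a - (b * x - 0 * y)) ^+ 2 + (0 - (b * y + 0 * x)) ^+ 2 =
  a ^+ 2 + b ^+ 2 * (x ^+ 2 + y ^+ 2) + 7 / 5 * (a * b) + 2 * (a * b * (- (7 / 10) - x)) by field.
rewrite uu mulr1; move: a2 b2 ab abx.
move: (a ^+ 2) (b ^+ 2) (a * b) (a * b * _) => A B D E.
lra.
Qed.

Section RingSpread.
Variable R : realType.
Local Notation C := R[i].
Variables (m n : nat) (w : C).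
Let Q := n.+1.
Hypotheses (m64 : (64 <= m)%N) (QE : Q = (4 * m ^ 3)%N) (primw : Q.-primitive_root w).
Let m1 : (1 < m)%N. Proof. exact: leq_trans m64. Qed.
Let m0 : (0 : R) < m%:R. Proof. by rewrite ltr0n ltnW. Qed.
Let N := ((m ^ 2 - m) * Q)%N.
Local Notation point := (ring_point m n w).
Local Notation node := (ring_node m w).

Let outer_ring (h : nat) := (24 * m ^ 2 <= 25 * h)%N.

(** The outer rings are a twenty-fifth of the [m ^ 2] indices; 40 absorbs the rounding. With the
    quarter of each ring from [quadrant_count] this leaves a proportion 1/160 of far points. *)
Let outer_count : (m ^ 2 <= 40 * \sum_(m <= h < m ^ 2 | outer_ring h) 1)%N.
Proof.
have mM : (64 * m <= m ^ 2)%N by rewrite expnS expn1 leq_mul2r m64 orbT.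
set k := ((24 * m ^ 2) %/ 25).+1.
have kM : (k <= m ^ 2)%N.
  by rewrite /k ltn_divLR//; lia.
have mk : (m <= k)%N.
  by apply: leq_trans (leqnSn _); rewrite leq_divRL//; lia.
apply: (@leq_trans (40 * \sum_(k <= h < m ^ 2) 1)); last first.
  rewrite leq_mul2l /= [X in (_ <= X)%N](@big_cat_nat _ _ _ k)//=.
  apply: leq_trans (leq_addl _ _); rewrite [leqRHS]big_mkcond /=.
  rewrite big_nat [leqRHS]big_nat; apply: leq_sum => h /andP[kh _].
  rewrite /outer_ring; case: ifP => // /negP[].
  by move: kh; rewrite /k ltn_divLR// [(h * 25)%N]mulnC => /ltnW.
rewrite sum_nat_const_nat muln1 /k.
have := leq_divM (24 * m ^ 2) 25; move: ((_ %/ _)%N) => q hq.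
have m2 : (64 * 64 <= m ^ 2)%N by apply: leq_trans mM; rewrite leq_mul2l m64.
lia.
Qed.

Let far_sqr (g h l k : nat) : (g < m ^ 2)%N -> outer_ring g -> (h < m ^ 2)%N -> outer_ring h ->
  complex.Re (w ^+ k * w^-1 ^+ l) <= - (7 / 10) ->
  9 / 5 <= cabs (node g l - node h k).
Proof.
move=> gM og hM oh re.
set u := w ^+ k * w^-1 ^+ l in re.
pose a : R := Num.sqrt g%:R / m%:R; pose b : R := Num.sqrt h%:R / m%:R.
have a0 : 0 <= a by rewrite divr_ge0 ?sqrtr_ge0.
have b0 : 0 <= b by rewrite divr_ge0 ?sqrtr_ge0.
have bound k' : outer_ring k' -> 24 / 25 <= (Num.sqrt k'%:R / m%:R : R) ^+ 2.
  move=> ok; rewrite exprMn sqr_sqrtr// exprVn ler_pdivlMr ?exprn_gt0//.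
  rewrite mulrAC ler_pdivrMr//.
  by rewrite -natrX -!natrM ler_nat [(k' * _)%N]mulnC.
have a2 := bound _ og; have b2 := bound _ oh; rewrite -/a -/b in a2 b2.
have nE : node g l - node h k = w ^+ l * (a%:C - b%:C * u).
  rewrite /ring_node -/a -/b /u mulrBr mulrC; congr (_ - _).
  rewrite mulrCA; congr (_ * _).
  by rewrite mulrCA -exprMn mulfV ?(unity_neq0 primw)// expr1n mulr1.
have uu : complex.Re u ^+ 2 + complex.Im u ^+ 2 = 1.
  by rewrite -sqr_cabs cabsM !cabsX cabsV (cabs_unity primw) invr1 !expr1n mulr1 expr1n.
have -> : cabs (node g l - node h k) = cabs (a%:C - b%:C * u).
  by rewrite nE cabsM cabsX (cabs_unity primw) expr1n mul1r.
rewrite -(@ler_pXn2r _ 2)// ?nnegrE ?cabs_ge0//.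
rewrite sqr_cabs; case: (u) re uu => x y /= re uu.
exact: opposite_arc_far.
Qed.

Lemma ring_point_spread : exists G : pred nat,
  (N <= 200 * \sum_(0 <= d < N | G d) 1)%N /\
  forall d, (d < N)%N -> G d ->
    (N <= 200 * \sum_(0 <= e < N | (9 / 5 <= cabs (point d - point e))%R) 1)%N.
Proof.
have NM : (N <= m ^ 2 * Q)%N by rewrite leq_mul2r leq_subr orbT.
have Q4 : (4 %| Q)%N by rewrite QE dvdn_mulr.
exists (fun d => outer_ring (m + d %/ Q)); split.
  apply: leq_trans NM _.
  have -> : (\sum_(0 <= d < N | outer_ring (m + d %/ Q)) 1 =
      (\sum_(m <= h < m ^ 2 | outer_ring h) 1) * Q)%N.
    rewrite big_mkcond /N sum_nat_mul big_distrl /= [RHS]big_mkcond [RHS]sum_nat_shift.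
    apply: eq_big_nat => i _ /=.
    rewrite (eq_big_nat _ _ (F2 := fun=> if outer_ring (i + m) then 1%N else 0%N)); last first.
      by move=> k /andP[_ kQ]; rewrite divnMDl// divn_small// addn0 addnC.
    by rewrite sum_nat_const_nat subn0 mulnC; case: ifP; rewrite ?mul0n ?mul1n.
  rewrite mulnA leq_mul2r /=; apply: leq_trans outer_count _.
  by rewrite leq_mul2r orbT.
move=> d dN od.
have /andP[mg gM] := ring_point_bounds dN.
apply: leq_trans NM _.
rewrite (sum_ring_point _ _ _ (fun z => (9 / 5 <= cabs (point d - z))%R) (fun=> 1%N)).
apply: (@leq_trans (200 * \sum_(m <= h < m ^ 2 | outer_ring h) \sum_(k < Q | (complex.Re (w ^+ k * w^-1 ^+ (d %% Q)) <= - (7 / 10))%R) 1)).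
  set b := (\sum_(k < Q | _) 1)%N.
  have -> : (\sum_(m <= h < m ^ 2 | outer_ring h) b =
             (\sum_(m <= h < m ^ 2 | outer_ring h) 1) * b)%N.
    by rewrite big_distrl /=; apply: eq_bigr => h _; rewrite mul1n.
  have := quadrant_count Q4 primw (d %% Q); have := outer_count.
  rewrite -/Q -/b; set a := (\sum_(_ <= _ < _ | _) 1)%N => ha hb.
  apply: (@leq_trans (40 * a * (4 * b))); [exact: leq_mul|lia].
rewrite leq_mul2l /= big_mkcond big_nat [leqRHS]big_nat.
apply: leq_sum => h /andP[mh hM]; case: ifP => // oh.
rewrite big_mkcond [leqRHS]big_mkcond; apply: leq_sum => k _.
case: ifP => // re; case: ifP => // /negP[].
exact: far_sqr.
Qed.

End RingSpread.

Lemma exists_primitive_root (R : realType) n : (0 < n)%N ->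
  exists w : R[i], n.-primitive_root w.
Proof.
move=> n0; pose p : {poly R[i]} := 'X^n - 1; have [r Dp] := closed_field_poly_normal p.
move: Dp; rewrite (monicP _) ?monicXnsubC // scale1r => Dp.
have rn1 : all n.-unity_root r by apply/allP=> z; rewrite -root_prod_XsubC -Dp.
have sz_r : (n < (size r).+1)%N by rewrite -(size_prod_XsubC r id) -Dp size_XnsubC.
have [|z] := hasP (cyclic.has_prim_root n0 rn1 _ sz_r); last by exists z.
by rewrite -separable.separable_prod_XsubC -Dp cyclotomic.separable_Xn_sub_1 // pnatr_eq0 -lt0n.
Qed.

Lemma exists_point_config (R : realType) (eps : R) : 0 < eps ->
  exists (N : nat) (p : nat -> R[i]), point_config eps N p.
Proof.
move=> eps0.
(* Ensures [eps * sqrt m >= 5], which is what the potential bound consumes: [4 m + 6 <= 10 m] after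
   simplification. *)
pose t := (Num.truncn (5 / eps)).+1.
have te : 5 / eps <= t%:R by rewrite ltW// truncnS_gt.
pose s := (t + 3)%N.
(* A power of four, so that [sqrt m] is the integer power [r = 2 ^ s] and all bounds become
   polynomial in [r]: [Q = 4 r ^ 6] and [N >= 2 r ^ 10]. *)
have [m mE] : exists m, m = (4 ^ s)%N by exists (4 ^ s)%N.
pose Q := (4 * m ^ 3)%N.
have s3 : (3 <= s)%N by rewrite leq_addl.
have m64 : (64 <= m)%N by rewrite mE -[64%N]/(4 ^ 3)%N leq_exp2l.
have m1 : (1 < m)%N by apply: leq_trans m64.
have N1000 : (64 * 64 <= (m ^ 2 - m) * Q)%N.
  have mm : (64 * m <= m ^ 2)%N by rewrite expnS expn1 leq_mul2r m64 orbT.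
  have m3 : (m <= m ^ 3)%N by rewrite -{1}[m]expn1 leq_exp2l.
  apply: leq_mul; first by clear -mm m64; lia.
  by apply: (leq_trans m64); apply: (leq_trans m3); rewrite leq_pmull.
have mR : (64 : R) <= m%:R by rewrite ler_nat.
have mR0 : (0 : R) < m%:R by rewrite ltr0n ltnW.
have Q0 : (0 < Q)%N by rewrite muln_gt0 expn_gt0 (ltnW m1).
have QE : Q.-1.+1 = (4 * m ^ 3)%N by rewrite prednK.
have [w] := @exists_primitive_root R Q Q0; rewrite -(prednK Q0) => primw.
pose r : R := (2 ^ s)%:R.
have rm : Num.sqrt m%:R = r.
  by rewrite mE -[4%N]/(2 ^ 2)%N -expnM mulnC expnM natrX sqrtr_sqr ger0_norm.
have rr : r ^+ 2 = m%:R by rewrite -rm sqr_sqrtr// ltW.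
have r0 : 0 < r by rewrite ltr0n expn_gt0.
have r8 : 8 <= r by rewrite ler_nat -[8%N]/(2 ^ 3)%N leq_exp2l.
have er : 5 <= eps * r.
  rewrite mulrC -ler_pdivrMr//; apply: le_trans te _.
  by rewrite ler_nat; apply: leq_trans (ltnW (ltn_expl _ _)); rewrite // leq_addr.
pose N := ((m ^ 2 - m) * Q)%N.
have QR : Q%:R = 4 * r ^+ 6 :> R by rewrite natrM natrX -rr -exprM.
have NE : N%:R = (r ^+ 4 - r ^+ 2) * (4 * r ^+ 6) :> R.
  rewrite natrM natrB; last by rewrite -[leqLHS]expn1 leq_exp2l.
  by rewrite QR (natrX _ m) -rr -exprM.
have rN : 2^-1 * r ^+ 4 <= r ^+ 4 - r ^+ 2.
  have -> : r ^+ 4 = r ^+ 2 * r ^+ 2 by rewrite -exprD.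
  by rewrite rr; nra.
have r6 : 0 < r ^+ 6 by rewrite exprn_gt0.
have N1 : 2^-1 * r ^+ 4 * (4 * r ^+ 6) <= N%:R.
  by rewrite NE ler_wpM2r// mulr_ge0// ltW.
have eps0' : 0 <= eps := ltW eps0.
have r0' : 0 <= r := ltW r0.
have r6' : 0 <= r ^+ 6 := ltW r6.
have mR0' : (0 : R) <= m%:R := ltW mR0.
exists N, (ring_point m Q.-1 w); split.
- exact: leq_trans N1000.
- by move=> d dN; apply: (ring_point_disc m1 primw); rewrite prednK.
- move=> d e dN eN de.
  have := ring_point_separated m1 QE primw; rewrite prednK// => /(_ d e dN eN de) sep.
  rewrite rm -rr -exprM in sep.
  apply: (@le_trans _ _ (eps * (N%:R * (2 * r ^+ (2 * 3) * r)^-1))); last first.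
    by rewrite ler_wpM2l // ler_wpM2l.
  apply: (@le_trans _ _ (eps * (2^-1 * r ^+ 4 * (4 * r ^+ 6) * (2 * r ^+ 6 * r)^-1))); last first.
    by rewrite ler_wpM2l // ler_wpM2r// invr_ge0 !mulr_ge0//.
  have -> : 2^-1 * r ^+ 4 * (4 * r ^+ 6) * (2 * r ^+ 6 * r)^-1 = r * r ^+ 2.
    by field; rewrite gt_eqF.
  rewrite mulrA; have : 1 <= r ^+ 2 by rewrite rr; lra.
  have : 1 <= eps * r by lra.
  by move=> h1 h2; rewrite -[1]mulr1; apply: ler_pM.
- move=> d dN.
  have := ring_point_energy m1 QE primw; rewrite prednK// => /(_ d dN) H.
  apply: le_trans H _; rewrite -rr -exprM QR.
  apply: (@le_trans _ _ (20 * (2^-1 * r ^+ 4 * (4 * r ^+ 6)))); last by rewrite ler_wpM2l.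
  rewrite le_eqVlt; apply/orP; left; apply/eqP.
  by field.
- move=> d dN.
  have := ring_point_potential m1 QE primw; rewrite prednK// => /(_ d dN) H.
  apply: le_trans H _; rewrite rm QR.
  have := @exp4_dominates R s s3; rewrite -mE => e4.
  have e40 : (0 : R) < 4 ^+ m by rewrite exprn_gt0.
  have B : m%:R ^+ 2 * (10 * m%:R * (4 * r ^+ 6) ^+ 2 / 4 ^+ m) <= 2 * m%:R ^+ 3 :> R.
    have -> : m%:R ^+ 2 * (10 * m%:R * (4 * r ^+ 6) ^+ 2 / 4 ^+ m) =
       2 * m%:R ^+ 3 * (80 * m%:R ^+ 6 / 4 ^+ m) :> R.
      by rewrite -rr; field; rewrite gt_eqF.
    rewrite -[leRHS]mulr1 ler_wpM2l ?mulr_ge0 ?exprn_ge0////.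
    by rewrite ler_pdivrMr// mul1r.
  apply: (@le_trans _ _ (r * (4 * r ^+ 6 * m%:R + 2 * m%:R ^+ 3 + 4 * r ^+ 6))).
    by rewrite ler_wpM2l // lerD2r lerD2l.
  apply: (@le_trans _ _ (eps * (2^-1 * r ^+ 4 * (4 * r ^+ 6)))); last first.
    by rewrite ler_wpM2l//.
  have -> : eps * (2^-1 * r ^+ 4 * (4 * r ^+ 6)) = (eps * r) * (r * (2 * r ^+ 6 * m%:R)).
    by rewrite -rr; field.
  apply: (@le_trans _ _ (5 * (r * (2 * r ^+ 6 * m%:R)))); last first.
    by rewrite ler_wpM2r// !mulr_ge0//.
  have -> : r * (4 * r ^+ 6 * m%:R + 2 * m%:R ^+ 3 + 4 * r ^+ 6) =
     r * r ^+ 6 * (4 * m%:R + 6) by rewrite -rr; ring.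
  have -> : 5 * (r * (2 * r ^+ 6 * m%:R)) = r * r ^+ 6 * (10 * m%:R) by ring.
  rewrite ler_wpM2l ?mulr_ge0//; lra.
- have := ring_point_spread m64 QE primw.
  by rewrite prednK.
Qed.

(** * The Cantor measure *)

Section CantorCenters.
Variable R : realType.
Local Notation C := R[i].

(** The powers of 1/2 make the changes of the potential summable; the factor 1/100 makes distinct
    cells of a generation 100 radii apart. *)
Definition cantor_eps (n : nat) : R := 100^-1 * 2^-1 ^+ n.

Lemma cantor_eps_gt0 n : 0 < cantor_eps n.
Proof. by rewrite mulr_gt0// exprn_gt0. Qed.

Lemma cantor_eps_le n : cantor_eps n <= 100^-1.
Proof. by rewrite ler_piMr// exprn_ile1// invf_le1//; lra. Qed.

Variables (N : nat -> nat) (p : nat -> nat -> C).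
Hypothesis configNp : forall n, point_config (cantor_eps n) (N n) (p n).

Definition cantor_count n := (\prod_(i < n) N i)%N.
Local Notation P := cantor_count.
Definition cantor_radius n : R := (P n)%:R^-1.
Local Notation r := cantor_radius.

(** Indices are read in mixed radix, so that the parent is a quotient; the subintervals of [[0, 1[]
    carrying the same numbers parametrize the cells. *)
Fixpoint cantor_center n (k : nat) : C :=
  if n is m.+1 then cantor_center m (k %/ N m)%N + (r m)%:C * p m (k %% N m)%N
  else 0.
Local Notation cen := cantor_center.

Lemma cantor_N_gt0 n : (0 < N n)%N.
Proof. by have := config_size (configNp n); case: (N n). Qed.

Lemma cantor_N_ge n : 1000 <= (N n)%:R :> R.
Proof. by rewrite ler_nat (config_size (configNp n)). Qed.

Lemma cantor_countS n : P n.+1 = (P n * N n)%N.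
Proof. by rewrite /P big_ord_recr. Qed.

Lemma cantor_count0 : P 0 = 1%N.
Proof. by rewrite /P big_ord0. Qed.

Lemma cantor_count_gt0 n : (0 < P n)%N.
Proof. by elim: n => [|n IH]; rewrite ?cantor_count0// cantor_countS muln_gt0 IH cantor_N_gt0. Qed.

Lemma cantor_radius_gt0 n : 0 < r n.
Proof. by rewrite invr_gt0 ltr0n cantor_count_gt0. Qed.

Lemma cantor_radius_ge0 n : 0 <= r n.
Proof. exact/ltW/cantor_radius_gt0. Qed.

Lemma cantor_radius0 : r 0 = 1.
Proof. by rewrite /r cantor_count0 invr1. Qed.

Lemma cantor_radiusS n : r n = (N n)%:R * r n.+1.
Proof.
rewrite /r cantor_countS natrM invfM mulrCA mulfV ?mulr1//.
by rewrite pnatr_eq0 -lt0n cantor_N_gt0.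
Qed.

Lemma cantor_radius_small n : 1000 * r n.+1 <= r n.
Proof. by rewrite (cantor_radiusS n) ler_wpM2r ?cantor_radius_ge0 ?cantor_N_ge. Qed.

Lemma cantor_radius_count n : (P n)%:R * r n = 1.
Proof. by rewrite mulfV// pnatr_eq0 -lt0n cantor_count_gt0. Qed.

Lemma cantor_radius_le_exp n : r n <= 2^-1 ^+ n.
Proof.
elim: n => [|n IH]; first by rewrite cantor_radius0 expr0.
have := cantor_radius_small n; have := cantor_radius_ge0 n.+1.
rewrite exprS; move: (r n.+1) (r n) (2^-1 ^+ n) IH => x y z; lra.
Qed.

Lemma cantor_parent n k : (k < P n.+1)%N -> (k %/ N n < P n)%N.
Proof. by rewrite cantor_countS => kP; rewrite ltn_divLR ?cantor_N_gt0. Qed.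

Lemma cantor_child n k d : (k < P n)%N -> (d < N n)%N -> (k * N n + d < P n.+1)%N.
Proof.
move=> kP dN; rewrite cantor_countS; apply: (@leq_trans (k.+1 * N n)).
  by rewrite mulSn addnC ltn_add2r.
by rewrite leq_mul2r kP orbT.
Qed.

Lemma cantor_digit n k : (k %% N n < N n)%N.
Proof. by rewrite ltn_pmod// cantor_N_gt0. Qed.

Lemma cantor_center_parent n k :
  cabs (cen n.+1 k - cen n (k %/ N n)) <= r n.
Proof.
rewrite /= addrC addKr cabsM cabsR ger0_norm ?cantor_radius_ge0//.
rewrite ler_piMr ?cantor_radius_ge0//.
exact: (config_disc (configNp n) (cantor_digit n k)).
Qed.

(** Siblings inherit the separation of the configuration. For cells with different parents, the
    parents are already 100 of their radii apart, so the children are at least two parent radii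
    apart, and [e2] turns this into the claim. *)
Lemma cantor_separated_eps n k l : (k < P n.+1)%N -> (l < P n.+1)%N -> k != l ->
  r n.+1 <= cantor_eps n * cabs (cen n.+1 k - cen n.+1 l).
Proof.
have aux (a b c e : R) : 1 <= e * (a * c) -> 0 <= b -> b <= e * (a * b * c).
  move=> h b0; have -> : e * (a * b * c) = e * (a * c) * b by ring.
  by rewrite ler_peMl.
elim: n k l => [|n IH] k l kP lP kl.
  have dig : (k %% N 0 != l %% N 0)%N.
    move: kP lP; rewrite cantor_countS cantor_count0 mul1n => kP lP.
    by rewrite !modn_small.
  have kl0 : (k %/ N 0 = l %/ N 0)%N by rewrite !divn_small//;
    [move: lP|move: kP]; rewrite cantor_countS cantor_count0 mul1n.
  have := config_separated (configNp 0) (cantor_digit 0 k) (cantor_digit 0 l) dig.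
  rewrite /= opprD addrACA subrr add0r -mulrBr cabsM cabsR ger0_norm ?cantor_radius_ge0//.
  rewrite (cantor_radiusS 0) => H; apply: aux H _; exact: cantor_radius_ge0.
have [par|par] := eqVneq (k %/ N n.+1)%N (l %/ N n.+1)%N.
  have dig : (k %% N n.+1 != l %% N n.+1)%N.
    by apply: contra kl => /eqP dig; rewrite (divn_eq k (N n.+1)) par dig -divn_eq.
  have := config_separated (configNp n.+1) (cantor_digit n.+1 k) (cantor_digit n.+1 l) dig.
  rewrite [cen n.+2 k]/= [cen n.+2 l]/= par opprD addrACA subrr add0r.
  rewrite -mulrBr cabsM cabsR ger0_norm ?cantor_radius_ge0//.
  rewrite (cantor_radiusS n.+1) => H; apply: aux H _; exact: cantor_radius_ge0.
have sep := IH _ _ (cantor_parent kP) (cantor_parent lP) par.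
(* Obtained from the separation of the points 0 and 1 of the configuration, which lie in the unit
   disc. *)
have e2 : 1 <= cantor_eps n.+1 * ((N n.+1)%:R * 2).
  have N1 : (1 < N n.+1)%N by have := config_size (configNp n.+1); case: (N _) => [|[]].
  apply: le_trans (config_separated (configNp n.+1) N1 (cantor_N_gt0 _) isT) _.
  rewrite ler_wpM2l ?(ltW (cantor_eps_gt0 _))// ler_wpM2l//.
  apply: le_trans (cabsD _ _) _; rewrite cabsN.
  rewrite -[2]/(1 + 1); apply: lerD; apply: (config_disc (configNp _)) => //.
  exact: cantor_N_gt0.
set X := cabs (cen n.+1 _ - _) in sep.
have X1 : 100 * r n.+1 <= X.
  have : r n.+1 <= 100^-1 * X.
    by apply: le_trans sep _; rewrite ler_wpM2r ?cabs_ge0// cantor_eps_le.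
  by lra.
have X2 : X - 2 * r n.+1 <= cabs (cen n.+2 k - cen n.+2 l).
  have k1 := cantor_center_parent n.+1 k; have l1 := cantor_center_parent n.+1 l.
  have t1 := cabsB_trans (cen n.+2 k) (cen n.+1 (k %/ N n.+1)) (cen n.+1 (l %/ N n.+1)).
  have t2 := cabsB_trans (cen n.+2 l) (cen n.+2 k) (cen n.+1 (l %/ N n.+1)).
  rewrite cabsBC in k1; rewrite -/X in t1.
  by move: k1 l1 t1 t2; lra.
have X3 : 2 * r n.+1 <= cabs (cen n.+2 k - cen n.+2 l).
  by move: X1 X2 (cantor_radius_ge0 n.+1); lra.
rewrite -[leLHS]mul1r.
apply: (@le_trans _ _ (cantor_eps n.+1 * ((N n.+1)%:R * 2) * r n.+2)).
  by rewrite ler_wpM2r// cantor_radius_ge0.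
rewrite -mulrA ler_wpM2l ?(ltW (cantor_eps_gt0 _))//.
by apply: le_trans X3; rewrite mulrAC -cantor_radiusS mulrC.
Qed.

Lemma cantor_separated n k l : (k < P n)%N -> (l < P n)%N -> k != l ->
  100 * r n <= cabs (cen n k - cen n l).
Proof.
case: n => [|n].
  by rewrite cantor_count0 !ltnS !leqn0 => /eqP-> /eqP->; rewrite eqxx.
move=> kP lP kl; have := cantor_separated_eps kP lP kl.
have : cantor_eps n * cabs (cen n.+1 k - cen n.+1 l) <=
  100^-1 * cabs (cen n.+1 k - cen n.+1 l).
  by rewrite ler_wpM2r ?cabs_ge0// cantor_eps_le.
by move=> h1 h2; have := le_trans h2 h1; lra.
Qed.

End CantorCenters.

(** * Discs in the plane as a measurable space *)

Section Plane.
Variable R : realType.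
Local Notation C := R[i].

Definition plane_of (c : C) : R * R := (complex.Re c, complex.Im c).

Lemma plane_ofK c : cplx (plane_of c) = c.
Proof. by case: c. Qed.

Lemma cplxK z : plane_of (cplx z) = z.
Proof. by case: z. Qed.

Lemma cdistE (z w : R * R) : cdist z w = cabs (cplx z - cplx w).
Proof. by []. Qed.

Lemma cdisc_plane (c : C) (s : R) :
  cdisc (plane_of c) s = [set w | cabs (cplx w - c) <= s].
Proof. by rewrite /cdisc; under eq_set do rewrite cdistE plane_ofK. Qed.

Lemma cdisc_sqr (c : C) (s : R) : 0 <= s -> cdisc (plane_of c) s =
  [set w | (w.1 - complex.Re c) ^+ 2 + (w.2 - complex.Im c) ^+ 2 <= s ^+ 2].
Proof.
move=> s0; rewrite cdisc_plane; apply/seteqP; split => w /=.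
  rewrite -(@ler_pXn2r _ 2) ?nnegrE ?cabs_ge0// sqr_cabs.
  by case: c.
move=> h; rewrite -(@ler_pXn2r _ 2) ?nnegrE ?cabs_ge0// sqr_cabs.
by case: c h.
Qed.

Lemma measurable_cdisc (z : R * R) (s : R) : measurable (cdisc z s).
Proof.
have [s0|s0] := ltP s 0.
  rewrite (_ : cdisc z s = set0) ?measurable0//; apply/seteqP; split => w //=.
  by rewrite /cdisc /= cdistE => /(le_trans (cabs_ge0 _)); rewrite leNgt s0.
rewrite -(cplxK z) cdisc_sqr//.
rewrite (_ : [set _ | _] = (fun w : R * R =>
  (w.1 - complex.Re (cplx z)) ^+ 2 + (w.2 - complex.Im (cplx z)) ^+ 2) @^-1` `]-oo, s ^+ 2]); last first.
  by apply/seteqP; split => w /=; rewrite in_itv.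
rewrite -[X in measurable X]setTI.
suff mf : measurable_fun [set: (R * R)%type] (fun w : R * R =>
  (w.1 - complex.Re (cplx z)) ^+ 2 + (w.2 - complex.Im (cplx z)) ^+ 2).
  by apply: mf => //; exact: measurable_itv.
by apply: measurable_funD; apply: measurable_funX; apply: measurable_funB.
Qed.

End Plane.

Definition unit_measure (R : realType) : set (measurableTypeR R) -> \bar R :=
  mrestr (@lebesgue_measure R) (measurable_itv `[0, 1[).

Section UnitMeasure.
Variable R : realType.

HB.instance Definition _ := Measure.on (@unit_measure R).

Let unit_measureT : @unit_measure R setT = 1%:E.
Proof.
rewrite /unit_measure /mrestr setTI lebesgue_measure_itv /= lte_fin ltr01.
by rewrite -EFinD oppr0 addr0.
Qed.

HB.instance Definition _ := Measure_isProbability.Build _ _ R (@unit_measure R) unit_measureT.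

End UnitMeasure.

Lemma geometric_is_cvgn (R : realType) (u : R^nat) :
  (forall n, `|u n.+1 - u n| <= 2^-1 ^+ n) -> cvgn u.
Proof.
move=> du.
have ub n : u n <= u 0%N + 2 - 2 * 2^-1 ^+ n.
  elim: n => [|n IH]; first by rewrite expr0; lra.
  have := du n; rewrite ler_norml exprS => /andP[_].
  by move: IH; move: (2^-1 ^+ n) (u n) (u n.+1) => a b c; lra.
(* Adding back the geometric tail makes the sequence nondecreasing, so monotone convergence
   applies. *)
pose v n := u n - 2 * 2^-1 ^+ n.
have vcvg : cvgn v.
  apply: nondecreasing_is_cvgn.
    apply/nondecreasing_seqP => n; rewrite /v.
    have := du n; rewrite ler_norml exprS => /andP[+ _].
    by move: (2^-1 ^+ n) (u n) (u n.+1) => a b c; lra.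
  exists (u 0%N + 2) => _ [n _ <-]; rewrite /v; have := ub n.
  have : 0 <= 2^-1 ^+ n :> R by rewrite exprn_ge0.
  by move: (2^-1 ^+ n) (u n) => a b; lra.
have gcvg : cvgn (fun n => 2 * 2^-1 ^+ n : R).
  apply: is_cvgM; first exact: is_cvg_cst.
  by apply: (cvgP 0); apply: cvg_expr; rewrite ger0_norm//; lra.
have -> : u = v \+ (fun n => 2 * 2^-1 ^+ n).
  by apply/funext => n; rewrite /v /= subrK.
exact: is_cvgD.
Qed.

(** * Parametrization of the Cantor set by the unit interval *)

Section CantorParametrization.
Variable R : realType.
Local Notation C := R[i].
Variables (N : nat -> nat) (p : nat -> nat -> C).
Hypothesis configNp : forall n, point_config (cantor_eps R n) (N n) (p n).
Local Notation P := (cantor_count N).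
Local Notation r := (cantor_radius R N).
Local Notation cen := (cantor_center N p).

Definition cantor_interval n k : set R :=
  [set t | k%:R * r n <= t < k.+1%:R * r n].
Local Notation A := cantor_interval.

Lemma cantor_interval_itv n k : A n k = `[k%:R * r n, k.+1%:R * r n[%classic.
Proof. by apply/seteqP; split => t /=; rewrite in_itv. Qed.

Lemma cantor_interval_exists n t : 0 <= t < 1 -> exists2 k, (k < P n)%N & A n k t.
Proof.
move=> /andP[t0 t1]; have P0 : (0 : R) < (P n)%:R.
  by rewrite ltr0n (cantor_count_gt0 configNp).
exists (Num.truncn (t * (P n)%:R)).
  rewrite -(ltr_nat R); apply: (@le_lt_trans _ _ (t * (P n)%:R)).
    by have /andP[] := truncn_itv (mulr_ge0 t0 (ltW P0)).
  by rewrite gtr_pMl.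
have := truncn_itv (mulr_ge0 t0 (ltW P0)) => /andP[h1 h2].
by rewrite /A /= /r ler_pdivrMr// ltr_pdivlMr// h1 h2.
Qed.

Lemma cantor_interval_uniq n k l t : A n k t -> A n l t -> k = l.
Proof.
move=> /andP[h1 h2] /andP[h3 h4].
have r0 := cantor_radius_gt0 configNp n.
have : k%:R * r n < l.+1%:R * r n by apply: le_lt_trans h4.
have : l%:R * r n < k.+1%:R * r n by apply: le_lt_trans h2.
rewrite !ltr_pM2r// !ltr_nat !ltnS => lk kl.
by apply/eqP; rewrite eqn_leq lk kl.
Qed.

Lemma cantor_interval_parent n k : A n.+1 k `<=` A n (k %/ N n).
Proof.
move=> t /andP[h1 h2]; have N0 := cantor_N_gt0 configNp n.
have r0 := cantor_radius_ge0 configNp n.+1.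
rewrite /A /= (cantor_radiusS configNp n) !mulrA -!natrM; apply/andP; split.
  by apply: le_trans h1; rewrite ler_wpM2r// ler_nat leq_divM.
by apply: (lt_le_trans h2); rewrite ler_wpM2r// ler_nat -ltn_divLR.
Qed.

(** The [n]-th approximation of the parametrization, one real coordinate at a time: [h] is
    instantiated with the real and the imaginary part. *)
Definition cantor_step (h : C -> R) n (t : measurableTypeR R) : R :=
  \sum_(k < P n) h (cen n k) * \1_(A n k) t.

Lemma measurable_cantor_step h n : measurable_fun setT (cantor_step h n).
Proof.
apply: measurable_sum => k; apply: measurable_funM => //.
by apply: measurable_indic; rewrite cantor_interval_itv; exact: measurable_itv.
Qed.

Lemma cantor_stepE h n k t : (k < P n)%N -> A n k t -> cantor_step h n t = h (cen n k).
Proof.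
move=> kP Akt; rewrite /cantor_step (bigD1 (Ordinal kP))//= indicE mem_set// mulr1.
rewrite big1 ?addr0// => l lk; rewrite indicE memNset ?mulr0// => Alt.
by move: lk; rewrite -val_eqE /= (cantor_interval_uniq Alt Akt) eqxx.
Qed.

Lemma cantor_step_out h n t : ~ (0 <= t < 1) -> cantor_step h n t = 0.
Proof.
move=> t01; rewrite /cantor_step big1// => k _; rewrite indicE memNset ?mulr0//.
move=> /andP[h1 h2]; apply: t01; have r0 := cantor_radius_ge0 configNp n.
rewrite (le_trans _ h1) ?mulr_ge0//= (lt_le_trans h2)//.
by rewrite -[leRHS](cantor_radius_count configNp n) ler_wpM2r// ler_nat.
Qed.

Lemma cantor_step_parent n k t : (k < P n.+1)%N -> A n.+1 k t ->
  forall h, cantor_step h n t = h (cen n (k %/ N n)).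
Proof.
move=> kP Akt h; apply: cantor_stepE; first exact: (cantor_parent configNp).
exact: cantor_interval_parent.
Qed.

Lemma cantor_step_is_cvg h t : (forall z w, `|h z - h w| <= cabs (z - w)) ->
  cvgn (fun n => cantor_step h n t).
Proof.
move=> hh; apply: geometric_is_cvgn => n.
have [t01|t01] := pselect (0 <= t < 1); last first.
  by rewrite !cantor_step_out// subrr normr0 exprn_ge0.
have [k kP Akt] := cantor_interval_exists n.+1 t01.
rewrite (cantor_stepE _ kP Akt) (cantor_step_parent kP Akt).
apply: le_trans (hh _ _) _; apply: le_trans (cantor_center_parent configNp n k) _.
exact: (cantor_radius_le_exp configNp).
Qed.

Let Re_lip (z w : C) : `|complex.Re z - complex.Re w| <= cabs (z - w).
Proof. by apply: le_trans (Re_le_cabs _); rewrite ReD; case: w. Qed.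

Let Im_lip (z w : C) : `|complex.Im z - complex.Im w| <= cabs (z - w).
Proof. by apply: le_trans (Im_le_cabs _); rewrite ImD; case: w. Qed.

Definition cantor_map (t : measurableTypeR R) : R * R :=
  (limn (fun n => cantor_step (@complex.Re R) n t),
   limn (fun n => cantor_step (@complex.Im R) n t)).

Lemma measurable_cantor_map : measurable_fun setT cantor_map.
Proof.
apply: measurable_fun_pair.
  apply: (measurable_fun_cvg (h := cantor_step (@complex.Re R))) => [n|t _].
    exact: measurable_cantor_step.
  exact: cantor_step_is_cvg.
apply: (measurable_fun_cvg (h := cantor_step (@complex.Im R))) => [n|t _].
  exact: measurable_cantor_step.
exact: cantor_step_is_cvg.
Qed.

(** One step moves the centre by at most [r m], and [r m <= 101 / 100 * (r m - r m.+1)] as radii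
    shrink by a factor 1000; the differences telescope. This is the origin of the cell radius
    [101 / 100 * r n]. *)
Lemma cantor_center_descend n j k t : (k < P n)%N -> A n k t ->
  exists l, [/\ (l < P (n + j))%N, A (n + j) l t &
    cabs (cen (n + j) l - cen n k) <= 101 / 100 * (r n - r (n + j))].
Proof.
move=> kP Akt; elim: j => [|j [l [lP Alt H]]].
  by exists k; rewrite addn0; split => //; rewrite !subrr cabs0 mulr0.
have t01 : 0 <= t < 1.
  (* The step function of the constant 1 vanishes off [[0, 1[] but equals 1 at [t]. *)
  apply: contrapT => t01; have := cantor_step_out (fun=> 1) n t01.
  by rewrite (cantor_stepE _ kP Akt) => /eqP; rewrite oner_eq0.
have [l' lP' Alt'] := cantor_interval_exists (n + j.+1) t01.
exists l'; split => //; rewrite addnS in lP' Alt' *.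
have ll : (l' %/ N (n + j) = l)%N.
  by apply: (cantor_interval_uniq _ Alt); exact: cantor_interval_parent.
have := cabsB_trans (cen (n + j) l) (cen (n + j).+1 l') (cen n k).
have := cantor_center_parent configNp (n + j) l'; rewrite ll.
have := cantor_radius_small configNp (n + j).
have := cantor_radius_ge0 configNp (n + j).
by move: (r (n + j).+1) (r (n + j)) (r n) H => *; lra.
Qed.

Lemma cantor_map_near n k t : (k < P n)%N -> A n k t ->
  cabs (cplx (cantor_map t) - cen n k) <= 101 / 100 * r n.
Proof.
move=> kP Akt; have r0 := cantor_radius_ge0 configNp n.
have B0 : 0 <= 101 / 100 * r n by rewrite mulr_ge0 ?divr_ge0 ?ler0n.
rewrite -(@ler_pXn2r _ 2) ?nnegrE ?cabs_ge0// sqr_cabs.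
set B := 101 / 100 * r n in B0 *.
pose u m := (cantor_step (@complex.Re R) m t - complex.Re (cen n k)) ^+ 2 +
  (cantor_step (@complex.Im R) m t - complex.Im (cen n k)) ^+ 2.
have cu : u @ \oo --> ((cantor_map t).1 - complex.Re (cen n k)) ^+ 2 +
     ((cantor_map t).2 - complex.Im (cen n k)) ^+ 2.
  have c1 : cantor_step (@complex.Re R) m t @[m --> \oo] --> (cantor_map t).1.
    exact: cantor_step_is_cvg.
  have c2 : cantor_step (@complex.Im R) m t @[m --> \oo] --> (cantor_map t).2.
    exact: cantor_step_is_cvg.
  by apply: cvgD; rewrite expr2; under eq_fun do rewrite expr2;
    apply: cvgM; apply: cvgB => //; exact: cvg_cst.
have -> : complex.Re (cplx (cantor_map t) - cen n k) ^+ 2 +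
    complex.Im (cplx (cantor_map t) - cen n k) ^+ 2 = limn u.
  by rewrite (cvg_lim _ cu)//; case: (cen n k).
apply: limr_le; first exact: cvgP cu.
exists n => // m /= nm; rewrite -(subnKC nm).
have [l [lP Alt H]] := cantor_center_descend (m - n) kP Akt.
rewrite /u !(cantor_stepE _ lP Alt).
have rm := cantor_radius_ge0 configNp (n + (m - n)).
have {}H : cabs (cen (n + (m - n)) l - cen n k) <= B.
  by apply: (le_trans H); rewrite ler_wpM2l ?divr_ge0 ?ler0n// lerBlDr lerDl.
rewrite -(@ler_pXn2r _ 2) ?nnegrE ?cabs_ge0// sqr_cabs in H.
by move: H; rewrite ReD ImD; case: (cen n k).
Qed.

End CantorParametrization.

Section CantorMeasure.
Variable R : realType.
Local Notation C := R[i].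
Variables (N : nat -> nat) (p : nat -> nat -> C).
Hypothesis configNp : forall n, point_config (cantor_eps R n) (N n) (p n).
Local Notation P := (cantor_count N).
Local Notation r := (cantor_radius R N).
Local Notation cen := (cantor_center N p).

(** Slightly enlarged, so that cells are nested and contain the images of their intervals, yet
    remain disjoint within a generation. *)
Definition cantor_cell n k : set (R * R) :=
  cdisc (plane_of (cen n k)) (101 / 100 * r n).
Local Notation D := cantor_cell.

Lemma cantor_cellE n k z : D n k z = (cabs (cplx z - cen n k) <= 101 / 100 * r n).
Proof. by rewrite /D cdisc_plane. Qed.

Lemma measurable_cantor_cell n k : measurable (D n k).
Proof. exact: measurable_cdisc. Qed.

Lemma cantor_cell_uniq n k l z : (k < P n)%N -> (l < P n)%N ->
  D n k z -> D n l z -> k = l.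
Proof.
move=> kP lP; rewrite !cantor_cellE => zk zl; apply/eqP.
have [//|kl] := eqVneq k l; have := cantor_separated configNp kP lP kl.
have := cabsB_trans (cplx z) (cen n k) (cen n l); rewrite (cabsBC (cen n k) (cplx z)).
have := cantor_radius_gt0 configNp n.
by move: (r n) zk zl => a *; lra.
Qed.

(** Pushforward of Lebesgue measure on [[0, 1[]. The cells of a generation being disjoint, the
    preimage of a cell is exactly its interval. The rest of the proof knows the measure only through
    these masses. *)
Lemma exists_cantor_measure : exists mu : probability (R * R)%type R,
  forall n k, (k < P n)%N -> mu (D n k) = (r n)%:E.
Proof.
pose mix := isMeasurableFun.Build _ _ _ _ _ (measurable_cantor_map configNp).
pose X := MeasurableFun.Pack (MeasurableFun.Class mix).
exists (distribution (@unit_measure R) X) => n k kP.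
rewrite /distribution /pushforward /= /unit_measure /mrestr.
have -> : cantor_map N p @^-1` D n k `&` `[0, 1[ = cantor_interval N n k.
  apply/seteqP; split => t /=.
    move=> [Dt]; rewrite in_itv /= => t01.
    have [l lP Alt] := cantor_interval_exists configNp n t01.
    have : D n l (cantor_map N p t) by rewrite cantor_cellE; exact: (cantor_map_near configNp).
    by move=> Dl; rewrite (cantor_cell_uniq kP lP Dt Dl).
  move=> Akt; split; first by rewrite cantor_cellE; exact: (cantor_map_near configNp).
  rewrite in_itv /=; move: Akt => /andP[h1 h2]; have r0 := cantor_radius_ge0 configNp n.
  rewrite (le_trans _ h1) ?mulr_ge0//= (lt_le_trans h2)//.
  by rewrite -[leRHS](cantor_radius_count configNp n) ler_wpM2r// ler_nat.
rewrite cantor_interval_itv lebesgue_measure_itv /= lte_fin.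
rewrite ltr_pM2r ?(cantor_radius_gt0 configNp)// ltr_nat ltnSn -EFinD.
by rewrite -mulrBl -natr1 addrAC subrr add0r mul1r.
Qed.

Lemma cantor_cell_nested n k : D n.+1 k `<=` D n (k %/ N n).
Proof.
move=> z; rewrite !cantor_cellE => zk.
have := cabsB_trans (cen n.+1 k) (cplx z) (cen n (k %/ N n)).
have := cantor_center_parent configNp n k.
have := cantor_radius_small configNp n.
have := cantor_radius_ge0 configNp n.
by move: (r n) (r n.+1) zk => a b *; lra.
Qed.

End CantorMeasure.

(** * Integrals over cells *)

Section BoundedIntegrals.
Context d (T : measurableType d) (R : realType) (mu : probability T R).
Implicit Types (S : set T) (g : T -> R).

Lemma prob_bounded_integrable S g (B : R) : measurable S ->
  measurable_fun [set: T] g -> (forall x, S x -> `|g x| <= B) ->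
  mu.-integrable S (EFin \o g).
Proof.
move=> mS mg gB; apply: measurable_bounded_integrable => //.
- by rewrite (le_lt_trans (probability_le1 mu mS))// ltry.
- exact: measurable_funTS.
- exists B; split; first exact: num_real.
  by move=> M BM x Sx /=; rewrite (le_trans (gB x Sx))// ltW.
Qed.

Lemma mass_ge0 S : 0 <= fine (mu S).
Proof. by rewrite fine_ge0. Qed.

Lemma fineK_prob S : measurable S -> (fine (mu S))%:E = mu S.
Proof. by move=> mS; rewrite fineK// fin_num_measure. Qed.

Lemma Rintegral_approx S g (v b : R) : measurable S -> measurable_fun [set: T] g ->
  (forall x, S x -> `|g x - v| <= b) ->
  `|\int[mu]_(x in S) g x - v * fine (mu S)| <= b * fine (mu S).
Proof.
move=> mS mg gb.
have ig : mu.-integrable S (EFin \o g).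
  apply: (@prob_bounded_integrable _ _ (`|v| + b)) => // x Sx.
  rewrite -[g x](subrK v) addrC (le_trans (ler_normD _ _))// lerD2l.
  exact: gb.
have iv c : mu.-integrable S (EFin \o cst c) by exact: finite_measure_integrable_cst.
rewrite -(Rintegral_cst mu mS v) -(RintegralB mS ig (iv v)).
have igv : mu.-integrable S (EFin \o (fun x => g x - v)).
  by apply: (@prob_bounded_integrable _ _ b) => //; exact: measurable_funB.
apply: le_trans (le_normr_Rintegral mS igv) _.
rewrite -(Rintegral_cst mu mS b); apply: le_Rintegral => //; last exact: iv.
apply: (@prob_bounded_integrable _ _ b) => // [|x Sx]; last by rewrite normr_id gb.
by apply: measurableT_comp => //; exact: measurable_funB.
Qed.

Lemma Rintegral_partition S (F : nat -> set T) n g (B : R) : measurable S ->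
  (forall i, measurable (F i)) ->
  (forall i j x, (i < n)%N -> (j < n)%N -> F i x -> F j x -> i = j) ->
  mu (S `\` \big[setU/set0]_(i < n) F i) = 0%E ->
  measurable_fun [set: T] g -> (forall x, S x -> `|g x| <= B) ->
  \int[mu]_(x in S) g x = \sum_(i < n) \int[mu]_(x in S `&` F i) g x.
Proof.
move=> mS mF tF null mg gB.
have mU k : measurable (\big[setU/set0]_(i < k) F i) by exact: bigsetU_measurable.
have H k : (k <= n)%N -> \int[mu]_(x in S `&` \big[setU/set0]_(i < k) F i) g x =
    \sum_(i < k) \int[mu]_(x in S `&` F i) g x.
  elim: k => [|k IH] kn; first by rewrite !big_ord0 setI0 Rintegral_set0.
  rewrite !big_ord_recr /= -IH 1?ltnW// setIUr Rintegral_setU//.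
  - by apply: measurableI => //; exact: mU.
  - by apply: measurableI => //; exact: mF.
  - apply: (@prob_bounded_integrable _ _ B) => // [|x].
      by apply: measurableU; [apply: measurableI => //; exact: mU|apply: measurableI => //; exact: mF].
    by move=> [|] [Sx _]; exact: gB.
  - apply/disj_setPS => x [[_]]; rewrite -bigcup_mkord => -[i /= ik Fi] [_ Fk].
    by have := tF i k x (leq_trans ik (ltnW kn)) kn Fi Fk => ikE; rewrite ikE ltnn in ik.
rewrite -H//; set U := \big[setU/set0]_(i < n) F i in null *.
have -> : \int[mu]_(x in S) g x =
  \int[mu]_(x in S `&` U) g x + \int[mu]_(x in S `\` U) g x.
  rewrite -Rintegral_setU ?setUIDK//.
  - by apply: measurableI => //; exact: mU.
  - by apply: measurableD => //; exact: mU.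
  - exact: (prob_bounded_integrable (B := B)).
  - by apply/disj_setPS => x [[_ Ux] [_ nUx]].
suff -> : \int[mu]_(x in S `\` U) g x = 0 by rewrite addr0.
apply/eqP; rewrite -normr_le0.
have := @Rintegral_approx (S `\` U) g 0 B (measurableD mS (mU n)) mg.
by rewrite null /= !mulr0 subr0; apply => x [Sx _]; rewrite subr0; exact: gB.
Qed.

End BoundedIntegrals.

Section ComplexIntegral.
Variable R : realType.
Variable mu : probability (R * R)%type R.
Local Notation C := R[i].
Local Notation plane := (R * R)%type.
Implicit Types (S : set plane) (h : plane -> C).

Definition cmeasurable h :=
  measurable_fun [set: plane] (fun x => complex.Re (h x)) /\
  measurable_fun [set: plane] (fun x => complex.Im (h x)).

(** The factor 2 comes from integrating real and imaginary parts apart. *)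
Lemma cintegral_approx S h (v : C) (b : R) : measurable S -> cmeasurable h ->
  (forall x, S x -> cabs (h x - v) <= b) ->
  cabs (cintegral mu S h - v * (fine (mu S))%:C) <= 2 * b * fine (mu S).
Proof.
move=> mS [mRe mIm] hb.
apply: le_trans (cabs_le_ReIm _) _.
have -> : 2 * b * fine (mu S) = b * fine (mu S) + b * fine (mu S) by ring.
have -> : v * (fine (mu S))%:C = (complex.Re v * fine (mu S)) +i* (complex.Im v * fine (mu S)).
  case: v {hb} => x y; apply/eqP; rewrite eq_complex /=.
  by apply/andP; split; apply/eqP; ring.
apply: lerD.
  apply: (@Rintegral_approx _ _ _ mu _ _ (complex.Re v)) => // x Sx.
  by apply: le_trans (hb x Sx); apply: le_trans (Re_le_cabs _); rewrite ReD; case: v {hb}.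
apply: (@Rintegral_approx _ _ _ mu _ _ (complex.Im v)) => // x Sx.
by apply: le_trans (hb x Sx); apply: le_trans (Im_le_cabs _); rewrite ImD; case: v {hb}.
Qed.

Lemma cintegral_bound S h (b : R) : measurable S -> cmeasurable h ->
  (forall x, S x -> cabs (h x) <= b) ->
  cabs (cintegral mu S h) <= 2 * b * fine (mu S).
Proof.
move=> mS mh hb; have := @cintegral_approx S h 0 b mS mh.
by rewrite mul0r subr0; apply => x Sx; rewrite subr0; exact: hb.
Qed.

Lemma cintegral_partition S (F : nat -> set plane) n h (B : R) : measurable S ->
  (forall i, measurable (F i)) ->
  (forall i j x, (i < n)%N -> (j < n)%N -> F i x -> F j x -> i = j) ->
  mu (S `\` \big[setU/set0]_(i < n) F i) = 0%E ->
  cmeasurable h -> (forall x, S x -> cabs (h x) <= B) ->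
  cintegral mu S h = \sum_(i < n) cintegral mu (S `&` F i) h.
Proof.
move=> mS mF tF null [mRe mIm] hB.
have -> : \sum_(i < n) cintegral mu (S `&` F i) h =
  (\sum_(i < n) \int[mu]_(x in S `&` F i) complex.Re (h x)) +i*
  (\sum_(i < n) \int[mu]_(x in S `&` F i) complex.Im (h x)).
  elim/big_ind3 : _ => //.
  by move=> x1 x2 x3 y1 y2 y3 -> ->; apply/eqP; rewrite eq_complex /= !eqxx.
rewrite /cintegral (@Rintegral_partition _ _ _ mu _ _ _ _ B mS mF tF null mRe); last first.
  by move=> x Sx; apply: le_trans (hB x Sx); exact: Re_le_cabs.
rewrite (@Rintegral_partition _ _ _ mu _ _ _ _ B mS mF tF null mIm)//.
by move=> x Sx; apply: le_trans (hB x Sx); exact: Im_le_cabs.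
Qed.

Lemma cintegral_full S h : measurable S -> mu (~` S) = 0%E -> cmeasurable h ->
  cintegral mu setT h = cintegral mu S h.
Proof.
move=> mS null [mRe mIm]; rewrite /cintegral.
have H g : measurable_fun [set: plane] g -> \int[mu]_x g x = \int[mu]_(x in S) g x.
  move=> mg; rewrite [RHS]Rintegral_mkcond; congr fine.
  apply: ae_eq_integral => //.
  - exact/measurable_EFinP.
  - by apply/measurable_EFinP; apply/(measurable_restrictT _ mS); exact: measurable_funTS.
  exists (~` S); split => //; first exact: measurableC.
  by move=> x /= H Sx; apply: H => _; rewrite patchE mem_set.
by rewrite (H _ mRe) (H _ mIm).
Qed.

(** From [K z = conj z ^ 3 / |z| ^ 4], which makes both coordinates rational with a real
    denominator; the convention for inverses covers 0. *)
Lemma huovinenKE (a b : R) : huovinenK (a +i* b) =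
  ((a ^+ 3 - 3 * a * b ^+ 2) / (a ^+ 2 + b ^+ 2) ^+ 2) +i*
  ((b ^+ 3 - 3 * a ^+ 2 * b) / (a ^+ 2 + b ^+ 2) ^+ 2).
Proof.
have [ab0|ab0] := eqVneq (a +i* b) 0.
  move/eqP: (ab0); rewrite eq_complex /= => /andP[/eqP a0 /eqP b0].
  rewrite ab0 a0 b0 /huovinenK rmorph0 mul0r.
  by apply/eqP; rewrite eq_complex /=; apply/andP; split; apply/eqP; ring.
have -> : huovinenK (a +i* b) =
    ((a +i* b)^*) ^+ 3 * ((cabs (a +i* b) ^+ 2) ^-2)%:C.
  have z0 : (a +i* b)^* != 0 by rewrite conjC_eq0.
  have -> : ((cabs (a +i* b) ^+ 2) ^-2)%:C = (((a +i* b) * (a +i* b)^*) ^+ 2)^-1.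
    by rewrite mulcJE -rmorphXn -fmorphV.
  rewrite /huovinenK.
  by field; rewrite z0 ab0.
rewrite sqr_cabs /=.
have -> : ((a +i* b)^*) ^+ 3 = (a ^+ 3 - 3 * a * b ^+ 2) +i* (b ^+ 3 - 3 * a ^+ 2 * b) :> C.
  rewrite !exprS expr0 mulr1 /Num.conj /=.
  by apply/eqP; rewrite eq_complex /=; apply/andP; split; apply/eqP; ring.
by apply/eqP; rewrite eq_complex /=; apply/andP; split; apply/eqP; ring.
Qed.

Lemma cmeasurable_huovinenK (z : plane) :
  cmeasurable (fun xi => huovinenK (cplx z - cplx xi)).
Proof.
have mp : measurable_fun [set: plane] (fun xi : plane => z.1 - xi.1).
  by apply: measurable_funB => //; exact: measurable_fst.
have mq : measurable_fun [set: plane] (fun xi : plane => z.2 - xi.2).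
  by apply: measurable_funB => //; exact: measurable_snd.
have mi : measurable_fun [set: plane] (fun xi : plane =>
   (((z.1 - xi.1) ^+ 2 + (z.2 - xi.2) ^+ 2) ^+ 2)^-1).
  have -> : (fun xi : plane => (((z.1 - xi.1) ^+ 2 + (z.2 - xi.2) ^+ 2) ^+ 2)^-1) =
    (fun x : R => powR x (- 1)) \o (fun xi : plane => ((z.1 - xi.1) ^+ 2 + (z.2 - xi.2) ^+ 2) ^+ 2).
    by apply/funext => xi /=; rewrite powR_inv1// exprn_ge0// addr_ge0// sqr_ge0.
  apply: measurableT_comp; first exact: measurable_powR.
  by apply: measurable_funX; apply: measurable_funD; exact: measurable_funX.
split; under eq_fun do rewrite -[cplx z - cplx _]/((z.1 - _.1) +i* (z.2 - _.2)) huovinenKE /=.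
  apply: measurable_funM => //; apply: measurable_funB; first exact: measurable_funX.
  by apply: measurable_funM; [exact: measurable_funM|exact: measurable_funX].
apply: measurable_funM => //; apply: measurable_funB; first exact: measurable_funX.
by apply: measurable_funM => //; apply: measurable_funM => //; exact: measurable_funX.
Qed.

End ComplexIntegral.

Section ClosedDisc.
Variable R : realType.

Lemma closed_cdisc (z : R * R) (s : R) : closed (cdisc z s).
Proof.
have [s0|s0] := ltP s 0.
  rewrite (_ : cdisc z s = set0); first exact: closed0.
  apply/seteqP; split => w //=.
  by rewrite /cdisc /= cdistE => /(le_trans (cabs_ge0 _)); rewrite leNgt s0.
rewrite -(cplxK z) cdisc_sqr//.
pose f (w : R * R) := (w.1 - complex.Re (cplx z)) ^+ 2 + (w.2 - complex.Im (cplx z)) ^+ 2.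
rewrite (_ : [set _ | _] = f @^-1` [set x | x <= s ^+ 2])//.
apply: closed_comp; last exact: closed_le.
move=> w _; apply: cvgD; rewrite expr2; under eq_fun do rewrite expr2.
  by apply: cvgM; apply: cvgB; [exact: cvg_fst|exact: cvg_cst|exact: cvg_fst|exact: cvg_cst].
by apply: cvgM; apply: cvgB; [exact: cvg_snd|exact: cvg_cst|exact: cvg_snd|exact: cvg_cst].
Qed.

Lemma open_contains_cdisc (A : set (R * R)) z : open A -> A z ->
  exists2 e : R, 0 < e & forall w, cabs (cplx w - cplx z) < e -> A w.
Proof.
move=> oA Az; have : nbhs z A by exact: open_nbhs_nbhs.
move=> /nbhs_ballP[e /= e0 eA]; exists e => // w wz; apply: eA.
split; rewrite /ball /= /ball_ /= distrC.
  by apply: le_lt_trans wz; exact: (Re_le_cabs (cplx w - cplx z)).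
by apply: le_lt_trans wz; exact: (Im_le_cabs (cplx w - cplx z)).
Qed.

Lemma open_plane_measurable (A : set (R * R)) : open A -> measurable A.
Proof.
move=> oA.
pose F (a b e : rat) : set (R * R) :=
  if `[< cdisc (ratr a, ratr b) (ratr e) `<=` A >] then cdisc (ratr a, ratr b) (ratr e)
  else set0.
have -> : A = \bigcup_a \bigcup_b \bigcup_e F a b e.
  apply/seteqP; split => z; last first.
    by move=> [a _ [b _ [e _]]]; rewrite /F; case: asboolP => [sub zin|_ []//]; exact: (sub _ zin).
  move=> Az; have [e e0 eA] := open_contains_cdisc oA Az.
  have e4 : 0 < e / 4 by lra.
  have [q] := rat_in_itvoo e4; rewrite in_itv /= => /andP[q0 qe].
  have q2 : z.1 < z.1 + ratr q / 2 by lra.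
  have [a] := rat_in_itvoo q2; rewrite in_itv /= => /andP[a1 a2].
  have q2' : z.2 < z.2 + ratr q / 2 by lra.
  have [b] := rat_in_itvoo q2'; rewrite in_itv /= => /andP[b1 b2].
  have zab : cabs (cplx z - cplx (ratr a, ratr b)) <= ratr q.
    apply: le_trans (cabs_le_ReIm _) _ => /=.
    by rewrite !ltr0_norm ?subr_lt0//; lra.
  exists a => //; exists b => //; exists q => //; rewrite /F asboolT//.
  move=> w; rewrite /cdisc /= cdistE => wab; apply: eA.
  have := cabsB_trans (cplx (ratr a, ratr b)) (cplx w) (cplx z).
  by rewrite (cabsBC (cplx (ratr a, ratr b)) (cplx z)); lra.
do 3 apply: bigcupT_measurable_rat => ?.
by rewrite /F; case: ifP => // _; exact: measurable_cdisc.
Qed.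

End ClosedDisc.

(** * Generations of cells and the support *)

Section CantorSupport.
Variable R : realType.
Local Notation C := R[i].
Variables (N : nat -> nat) (p : nat -> nat -> C).
Hypothesis configNp : forall n, point_config (cantor_eps R n) (N n) (p n).
Local Notation P := (cantor_count N).
Local Notation r := (cantor_radius R N).
Local Notation cen := (cantor_center N p).
Local Notation D := (cantor_cell N p).
Variable mu : probability (R * R)%type R.
Hypothesis muD : forall n k, (k < P n)%N -> mu (D n k) = (r n)%:E.

Definition cantor_level n : set (R * R) := \big[setU/set0]_(k < P n) D n k.
Local Notation E := cantor_level.

Lemma cantor_levelP n z : E n z <-> exists2 k, (k < P n)%N & D n k z.
Proof. by rewrite /E -bigcup_mkord; split => -[k kP Dk]; exists k. Qed.

Lemma measurable_cantor_level n : measurable (E n).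
Proof. by apply: bigsetU_measurable => k _; exact: measurable_cantor_cell. Qed.

Lemma closed_cantor_level n : closed (E n).
Proof. by apply: closed_bigsetU => k _; exact: closed_cdisc. Qed.

Lemma cantor_level_full n : mu (~` E n) = 0%E.
Proof.
rewrite probability_setC; last exact: measurable_cantor_level.
suff -> : mu (E n) = 1%E by rewrite subee.
pose F k := if (k < P n)%N then D n k else set0.
have -> : E n = \big[setU/set0]_(k < P n) F k.
  by apply: eq_bigr => k _; rewrite /F ltn_ord.
rewrite measure_bigsetU.
- rewrite (eq_bigr (fun=> (r n)%:E)) => [|k _]; last by rewrite /F ltn_ord; exact: muD.
  by rewrite sumEFin sumr_const card_ord -(mulr_natl (r n)) (cantor_radius_count configNp).
- by move=> k; rewrite /F; case: ifP => // _; exact: measurable_cantor_cell.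
apply/trivIsetP => k l _ _ /eqP kl; apply/seteqP; split => // z [].
rewrite /F; case: ifP => // kP Dk; case: ifP => // lP Dl.
exact: kl (cantor_cell_uniq configNp kP lP Dk Dl).
Qed.

Lemma cantor_full_mass S A : measurable S -> measurable A -> mu (~` S) = 0%E ->
  mu (S `&` A) = mu A.
Proof.
move=> mS mA null; apply/eqP; rewrite eq_le; apply/andP; split.
  by apply: le_measure; rewrite ?inE//; exact: measurableI.
rewrite -[X in (mu X <= _)%E](setUIDK A S).
apply: le_trans (measureU2 _ _ _) _ => //; [exact: measurableI|exact: measurableD|].
rewrite setIC [X in (_ + X <= _)%E](_ : _ = 0%E) ?adde0//.
apply/eqP; rewrite eq_le measure_ge0 andbT -null.
by apply: le_measure; rewrite ?inE; [exact: measurableD|exact: measurableC|move=> z []].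
Qed.

Section CellIntegrals.
Variables (S : set (R * R)) (h : R * R -> C) (B : R).
Hypotheses (mS : measurable S) (mh : cmeasurable h) (hB : forall x, S x -> cabs (h x) <= B).

Lemma cantor_integral_level n :
  cintegral mu S h = \sum_(k < P n) cintegral mu (S `&` D n k) h.
Proof.
apply: (@cintegral_partition _ _ _ _ _ _ B) => //.
- by move=> k; exact: measurable_cantor_cell.
- by move=> k l x kP lP; exact: (cantor_cell_uniq configNp).
apply/eqP; rewrite eq_le measure_ge0 andbT -(cantor_level_full n).
apply: le_measure; rewrite ?inE; [|by apply: measurableC; exact: measurable_cantor_level|by move=> z []].
by apply: measurableD => //; exact: measurable_cantor_level.
Qed.

Lemma cantor_integral_split n k : (k < P n)%N ->
  cintegral mu (S `&` D n k) h =
  \sum_(d < N n) cintegral mu (S `&` D n.+1 (k * N n + d)) h.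
Proof.
move=> kP.
have mD m l : measurable (D m l) by exact: measurable_cantor_cell.
have par d : (d < N n)%N -> ((k * N n + d) %/ N n = k)%N.
  by move=> dN; rewrite divnMDl ?(cantor_N_gt0 configNp)// divn_small// addn0.
rewrite (@cintegral_partition _ mu (S `&` D n k) (fun d => D n.+1 (k * N n + d)) (N n) h B)//.
- apply: eq_bigr => d _; congr cintegral; rewrite -setIA; congr (_ `&` _).
  apply/setIidPr; have := @cantor_cell_nested _ _ _ configNp n (k * N n + d).
  by rewrite par.
- exact: measurableI.
- move=> d e x dN eN Dd De.
  have := cantor_cell_uniq configNp (cantor_child kP dN) (cantor_child kP eN) Dd De.
  by move/addnI.
- apply/eqP; rewrite eq_le measure_ge0 andbT -(cantor_level_full n.+1).
  apply: le_measure; rewrite ?inE.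
  + apply: measurableD; first exact: measurableI.
    by apply: bigsetU_measurable => d _; exact: mD.
  + by apply: measurableC; exact: measurable_cantor_level.
  move=> x [[_ Dk] nD] /cantor_levelP[l lP Dl]; apply: nD.
  rewrite -(bigcup_mkord (N n) (fun d => D n.+1 (k * N n + d))).
  exists (l %% N n)%N => /=; first exact: (cantor_digit configNp).
  have lk : (l %/ N n = k)%N.
    apply: (cantor_cell_uniq configNp (cantor_parent configNp lP) kP _ Dk).
    exact: (cantor_cell_nested configNp).
  by rewrite -lk -divn_eq.
- by move=> x [Sx _]; exact: hB.
Qed.

End CellIntegrals.

Lemma cantor_support_sub n : msupport mu `<=` E n.
Proof.
move=> z; apply; split; [exact: closed_cantor_level|exact: cantor_level_full].
Qed.

Lemma cantor_radius_lt (e : R) : 0 < e -> exists n, r n < e.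
Proof.
move=> e0; have : (2^-1 : R) ^+ n @[n --> \oo] --> 0.
  by apply: cvg_expr; rewrite ger0_norm//; lra.
move=> /cvgrPdist_lt /(_ e e0)[n _ /(_ n (leqnn n))] /=.
rewrite sub0r normrN ger0_norm ?exprn_ge0// => ne; exists n.
exact: le_lt_trans (cantor_radius_le_exp configNp n) ne.
Qed.

Lemma cantor_radius_homo m n : (m <= n)%N -> r n <= r m.
Proof.
move=> /subnK <-; elim: (n - m)%N => [//|k IH]; apply: le_trans IH.
have := cantor_radius_small configNp (k + m); have := cantor_radius_ge0 configNp (k + m).+1.
by rewrite addSn; lra.
Qed.

(** Otherwise cells of arbitrarily small radius would come within a few radii of [z], and one of
    them would lie in an open null neighbourhood of [z] although its mass is positive. *)
Lemma cantor_not_support z : ~ msupport mu z ->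
  exists n, forall k, (k < P n)%N -> 2 * r n < cabs (cplx z - cen n k).
Proof.
move=> zS; apply: contrapT => H; apply: zS => F [cF nullF].
apply: contrapT => nFz.
have [e e0 eF] := open_contains_cdisc (closed_openC cF) nFz.
have e4 : 0 < e / 4 by lra.
have [n rn] := cantor_radius_lt e4.
apply: H; exists n => k kP; rewrite ltNge; apply/negP => zk.
have : (mu (D n k) <= mu (~` F))%E.
  apply: le_measure; rewrite ?inE; [exact: measurable_cantor_cell| |].
    by apply: open_plane_measurable; exact: closed_openC.
  move=> w; rewrite cantor_cellE => wk; apply: eF.
  have := cabsB_trans (cen n k) (cplx w) (cplx z); rewrite (cabsBC (cen n k) (cplx z)).
  by have := cantor_radius_gt0 configNp n; lra.
by rewrite muD// nullF lee_fin leNgt (cantor_radius_gt0 configNp).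
Qed.

End CantorSupport.

(** * Growth and Hausdorff measure *)

Section HausdorffContent.
Variable R : realType.

(* The countable cover demanded by [hausdorff1] is completed by discs of radius
   [rho / 2 ^ j.+1], of total radius at most [rho]. *)
Lemma hausdorff1_le (E : set (R * R)) (B : R) :
  (forall delta : R, 0 < delta -> exists (L : nat) (x : nat -> R * R) (rho : R),
    [/\ 0 < rho <= delta, (L%:R + 1) * rho <= B &
        forall z, E z -> exists2 j, (j < L)%N & cdisc (x j) rho z]) ->
  (hausdorff1 E <= B%:E)%E.
Proof.
move=> cover; apply: ge_ereal_sup => _ [delta /= delta0 <-].
have [L [x [rho [/andP[rho0 rhod] LB sub]]]] := cover _ delta0.
pose t j : R := if (j < L)%N then rho else rho * 2^-1 ^+ j.+1.
have t0 j : 0 < t j by rewrite /t; case: ifP => // _; rewrite mulr_gt0// exprn_gt0.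
have half j : (2^-1 : R) ^+ j <= 1 by rewrite exprn_ile1// invf_le1//; lra.
apply: (@le_trans _ _ (\sum_(0 <= j <oo) (t j)%:E)%E).
  apply: ereal_inf_lbound; exists x, t; split => // [j|z Ez].
    rewrite t0/= /t; case: ifP => // _; apply: le_trans rhod.
    by rewrite ler_piMr// ltW.
  have [j jL zj] := sub z Ez; exists j => //.
  by rewrite /t jL.
have S n : \sum_(0 <= j < n) t j + rho * 2^-1 ^+ n <= (minn n L)%:R * rho + rho.
  elim: n => [|n IH]; first by rewrite big_geq// min0n expr0; lra.
  rewrite big_nat_recr//= {2}/t exprS.
  have p2 := half n; have p0 : 0 <= rho * 2^-1 ^+ n by rewrite mulr_ge0// ?ltW// exprn_gt0.
  have E1 : rho * (2^-1 * 2^-1 ^+ n) = 2^-1 * (rho * 2^-1 ^+ n) by ring.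
  case: (ltnP n L) => nL.
    have -> : minn n.+1 L = n.+1 by exact/minn_idPl.
    rewrite -[n.+1%:R]natr1 mulrDl mul1r.
    by move: IH; rewrite (minn_idPl (ltnW nL)) E1; lra.
  rewrite (minn_idPr (leqW nL)); move: IH; rewrite (minn_idPr nL); lra.
apply: lime_le; first by apply: is_cvg_nneseries => j _ _; rewrite lee_fin ltW.
near=> n; rewrite sumEFin lee_fin; apply: le_trans LB.
have p0 : 0 <= rho * 2^-1 ^+ n by rewrite mulr_ge0// ?ltW// exprn_gt0.
have m : (minn n L)%:R * rho <= L%:R * rho by rewrite ler_pM2r// ler_nat geq_minr.
by have := S n; rewrite mulrDl mul1r; lra.
Unshelve. all: by end_near.
Qed.

Lemma hausdorff1_ge0 (E : set (R * R)) : (0 <= hausdorff1 E)%E.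
Proof.
apply: (@le_trans _ _ (ereal_inf [set s : \bar R | exists (x : nat -> R * R) (r : nat -> R),
  [/\ forall j, 0 < r j <= 1, E `<=` \bigcup_j cdisc (x j) (r j) &
      s = (\sum_(0 <= j <oo) (r j)%:E)%E]])).
  apply: le_ereal_inf_tmp => _ [x [t [t0 _ ->]]].
  by apply: nneseries_ge0 => j _ _; rewrite lee_fin ltW//; have /andP[] := t0 j.
by apply: ereal_sup_ubound; exists 1 => //=; exact: ltr01.
Qed.

End HausdorffContent.

Section CantorGrowth.
Variable R : realType.
Local Notation C := R[i].
Variables (N : nat -> nat) (p : nat -> nat -> C).
Hypothesis configNp : forall n, point_config (cantor_eps R n) (N n) (p n).
Local Notation P := (cantor_count N).
Local Notation r := (cantor_radius R N).
Local Notation cen := (cantor_center N p).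
Local Notation D := (cantor_cell N p).
Variable mu : probability (R * R)%type R.
Hypothesis muD : forall n k, (k < P n)%N -> mu (D n k) = (r n)%:E.

Lemma cantor_mass_le n M (c : nat -> nat) (Q : pred nat) A : measurable A ->
  (forall e, (e < M)%N -> (c e < P n)%N) ->
  (forall k z, (k < P n)%N -> A z -> D n k z ->
    exists2 e, (e < M)%N && Q e & D n (c e) z) ->
  fine (mu A) <= \sum_(0 <= e < M | Q e) r n.
Proof.
move=> mA cP sub.
rewrite -lee_fin fineK_prob//.
pose U := \big[setU/set0]_(0 <= e < M | Q e) D n (c e).
have mU : measurable U.
  by apply: bigsetU_measurable => e _; exact: measurable_cantor_cell.
apply: (@le_trans _ _ (mu U)).
  have mE := measurable_cantor_level N p n.
  rewrite -(cantor_full_mass mE mA (cantor_level_full configNp muD n)).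
  apply: le_measure; rewrite ?inE//; first exact: measurableI.
  move=> z [/cantor_levelP[k kP Dk] Az].
  have [e /andP[eM Qe] De] := sub k z kP Az Dk.
  rewrite /U (big_rem e) ?mem_index_iota//= Qe; by left.
rewrite /U [X in mu X]big_mkcond [X in X%:E]big_mkcond.
elim: M cP {sub U mU} => [|M IH] cP.
  by rewrite !big_geq// measure0.
rewrite !big_nat_recr//= EFinD.
have mD k : measurable (D n k) by exact: measurable_cantor_cell.
apply: le_trans (measureU2 _ _ _) _.
- by apply: bigsetU_measurable => e _; case: ifP.
- by case: ifP.
apply: leeD; first by apply: IH => e eM; apply: cP; exact: leqW.
case: ifP => _; last by rewrite measure0.
by have /eqP := muD (cP M (ltnSn M)); rewrite eq_le => /andP[].
Qed.

(** For [r n.+1 <= s < r n], all cells of generation [n.+1] meeting the disc are siblings, as cells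
    of generation [n] are 100 radii apart. The energy bound then limits how many siblings lie within
    [6 s] of one of them. *)
Lemma cantor_growth z (s : R) : 0 < s -> (mu (cdisc z s) <= (200 * s)%:E)%E.
Proof.
move=> s0; have mA := measurable_cdisc z s.
have [s1|s1] := leP 1 s.
  by apply: le_trans (probability_le1 mu mA) _; rewrite lee_fin; lra.
have [m rm] := cantor_radius_lt configNp s0.
have ex : exists m, r m <= s by exists m; exact: ltW.
case: (ex_minnP ex) => -[|n] rn rmin.
  by exfalso; move: rn; rewrite cantor_radius0; lra.
have rsn : s < r n by rewrite ltNge; apply/negP => /rmin; rewrite ltnn.
rewrite -fineK_prob// lee_fin.
have near2 k w : D n.+1 k w -> cdisc z s w -> cabs (cplx z - cen n.+1 k) <= 3 * s.
  rewrite cantor_cellE /cdisc /= cdistE => wk wz.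
  have := cabsB_trans (cplx w) (cplx z) (cen n.+1 k); rewrite (cabsBC (cplx z) (cplx w)).
  by move: (r n.+1) rn wk => a *; lra.
have [[l0 [w0 [l0P A0 D0]]]|none] := pselect (exists l w, [/\ (l < P n.+1)%N, cdisc z s w & D n.+1 l w]);
  last first.
  have : fine (mu (cdisc z s)) <= \sum_(0 <= e < 0 | true) r n.+1.
    apply: (@cantor_mass_le n.+1 0 id) => // k w kP Aw Dw.
    by exfalso; apply: none; exists k, w.
  by rewrite big_geq// => h; apply: le_trans h _; lra.
pose k0 := (l0 %/ N n)%N; pose d0 := (l0 %% N n)%N.
have d0N : (d0 < N n)%N by exact: (cantor_digit configNp).
have k0P : (k0 < P n)%N by exact: (cantor_parent configNp l0P).
(* Written as a Markov inequality: the indicator of a sibling within [6 s] is at most [6 s] over its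
   distance. The outcome is [r n.+1 + 120 s]. *)
pose Q e := 1 <= 6 * s * (r n)^-1 * (cabs (p n d0 - p n e))^-1.
have rn0 := cantor_radius_gt0 configNp n.
have H : fine (mu (cdisc z s)) <= \sum_(0 <= e < N n | (e == d0) || Q e) r n.+1.
  apply: (@cantor_mass_le n.+1 (N n) (fun e => k0 * N n + e)%N) => //.
    by move=> e eN; exact: cantor_child.
  move=> l w lP Aw Dw.
  have zl := near2 _ _ Dw Aw; have zl0 := near2 _ _ D0 A0.
  have ll0 : cabs (cen n.+1 l0 - cen n.+1 l) <= 6 * s.
    have := cabsB_trans (cplx z) (cen n.+1 l0) (cen n.+1 l).
    by rewrite (cabsBC (cen n.+1 l0) (cplx z)); lra.
  have par : (l %/ N n)%N = k0.
    apply/eqP; have [//|ne] := eqVneq (l %/ N n)%N k0.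
    have := cantor_separated configNp (cantor_parent configNp lP) k0P ne.
    have := cantor_center_parent configNp n l; have := cantor_center_parent configNp n l0.
    have := cabsB_trans (cen n.+1 l) (cen n (l %/ N n)) (cen n k0).
    have := cabsB_trans (cen n.+1 l0) (cen n.+1 l) (cen n k0).
    rewrite (cabsBC (cen n.+1 l)  (cen n.+1 l0)) (cabsBC (cen n (l %/ N n)) (cen n.+1 l)) -/k0.
    by move: (r n) rsn ll0 => a *; lra.
  exists (l %% N n)%N; last by rewrite -par -divn_eq.
  rewrite (cantor_digit configNp) /=.
  have [//|ne /=] := eqVneq.
  have dpos : 0 < cabs (p n d0 - p n (l %% N n)).
    have := config_separated (configNp n) d0N (cantor_digit configNp n l).
    rewrite eq_sym => /(_ ne) sep; rewrite lt0r cabs_ge0 andbT; apply/eqP => z0.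
    by move: sep; rewrite z0 !mulr0; lra.
  have cE k : cen n.+1 k = cen n (k %/ N n) + (r n)%:C * p n (k %% N n) by [].
  move: ll0; rewrite !cE par -/k0 -/d0.
  rewrite opprD addrACA subrr add0r -mulrBr cabsM cabsR (ger0_norm (ltW rn0)) => ll0.
  by rewrite /Q -[6 * s / r n / _]mulrA -invfM ler_pdivlMr ?mulr_gt0// mul1r.
apply: le_trans H _.
rewrite big_mkcond (bigD1_seq d0) ?mem_index_iota ?iota_uniq ?eqxx//=.
have X : \sum_(0 <= e < N n | e != d0) (if (e == d0) || Q e then r n.+1 else 0) <=
    \sum_(0 <= e < N n | e != d0) r n.+1 * (6 * s * (r n)^-1 * (cabs (p n d0 - p n e))^-1).
  apply: ler_sum => e /negPf ->; have rn1 := cantor_radius_ge0 configNp n.+1.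
  case: ifP => [Qe|_]; first by rewrite ler_peMr.
  by rewrite !mulr_ge0 ?invr_ge0 ?cabs_ge0 ?(ltW s0) ?(ltW rn0).
move: X; rewrite -mulr_sumr -mulr_sumr.
set T := \sum_(_ <= _ < _ | _) _^-1; set S0 := \sum_(_ <= _ < _ | _) _ => X.
have T20 : T <= 20 * (N n)%:R by exact: (config_energy (configNp n) d0N).
have : r n.+1 * (6 * s * (r n)^-1 * T) <= 6 * s * 20.
  have -> : 6 * s * 20 = r n.+1 * (6 * s * (r n)^-1 * (20 * (N n)%:R)).
    rewrite (cantor_radiusS configNp n); field.
    by rewrite gt_eqF ?(cantor_radius_gt0 configNp)//= gt_eqF// ltr0n (cantor_N_gt0 configNp).
  rewrite ler_wpM2l ?(cantor_radius_ge0 configNp)// ler_wpM2l//.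
  by rewrite !mulr_ge0 ?invr_ge0 ?(ltW s0) ?(ltW rn0).
by move: X rn; move: (r n.+1 * _) => a; move: (r n.+1) => b; lra.
Qed.

Lemma cantor_one_dimensional : one_dimensional mu.
Proof.
split; last by exists 200 => [|z s]; [rewrite ltr0n|exact: cantor_growth].
apply: (@le_lt_trans _ _ (3%:R)%:E); last exact: ltry.
apply: hausdorff1_le => delta delta0.
have d0 : 0 < delta / 2 by lra.
have [n rn] := cantor_radius_lt configNp d0.
have rn0 := cantor_radius_gt0 configNp n.
exists (P n), (fun k => plane_of (cen n k)), (101 / 100 * r n); split.
- by move: (r n) rn rn0 => a *; apply/andP; split; lra.
- have := cantor_radius_count configNp n.
  have := cantor_radius_homo configNp (leq0n n); rewrite cantor_radius0.
  rewrite mulrDl mul1r mulrCA => h ->.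
  by move: (r n) h => a *; lra.
- move=> z /(cantor_support_sub configNp muD n)/cantor_levelP[k kP Dk].
  by exists k.
Qed.

End CantorGrowth.

(** * Boundedness of the potential *)

Section CantorPotential.
Variable R : realType.
Local Notation C := R[i].
Variables (N : nat -> nat) (p : nat -> nat -> C).
Hypothesis configNp : forall n, point_config (cantor_eps R n) (N n) (p n).
Local Notation P := (cantor_count N).
Local Notation r := (cantor_radius R N).
Local Notation cen := (cantor_center N p).
Local Notation D := (cantor_cell N p).
Local Notation E := (cantor_level N p).
Variable mu : probability (R * R)%type R.
Hypothesis muD : forall n k, (k < P n)%N -> mu (D n k) = (r n)%:E.

Lemma cantor_child_parent n k d : (d < N n)%N -> ((k * N n + d) %/ N n)%N = k.
Proof. by move=> dN; rewrite divnMDl ?(cantor_N_gt0 configNp)// divn_small// addn0. Qed.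

Lemma cantor_child_digit n k d : (d < N n)%N -> ((k * N n + d) %% N n)%N = d.
Proof. by move=> dN; rewrite modnMDl modn_small. Qed.

Lemma cantor_siblings n k l : (k %/ N n = l %/ N n)%N ->
  cen n.+1 k - cen n.+1 l = (r n)%:C * (p n (k %% N n) - p n (l %% N n)).
Proof. by move=> kl; rewrite /= kl opprD addrACA subrr add0r mulrBr. Qed.

Lemma cantor_sibling_energy n k : (k < P n.+1)%N ->
  r n.+1 * \sum_(0 <= d < N n | d != (k %% N n)%N)
    (cabs (cen n.+1 k - cen n.+1 (k %/ N n * N n + d)))^-1 <= 20.
Proof.
move=> kP; have rn0 := cantor_radius_gt0 configNp n.
have dig := cantor_digit configNp n k.
rewrite (_ : \sum_(_ <= _ < _ | _) _ = (r n)^-1 * \sum_(0 <= d < N n | d != (k %% N n)%N)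
    (cabs (p n (k %% N n) - p n d))^-1); last first.
  rewrite mulr_sumr big_nat_cond [RHS]big_nat_cond; apply: eq_bigr => d /andP[/andP[_ dN] _].
  rewrite cantor_siblings; last by rewrite cantor_child_parent.
  by rewrite cantor_child_digit// cabsM cabsR (ger0_norm (ltW rn0)) invfM.
rewrite mulrA.
have -> : 20 = r n.+1 / r n * (20 * (N n)%:R).
  rewrite (cantor_radiusS configNp n); field.
  by rewrite gt_eqF ?(cantor_radius_gt0 configNp)//= gt_eqF// ltr0n (cantor_N_gt0 configNp).
rewrite ler_wpM2l ?(config_energy (configNp n))//.
by rewrite divr_ge0 ?(cantor_radius_ge0 configNp).
Qed.

Lemma cantor_sibling_potential n k : (k < P n.+1)%N ->
  cabs ((r n.+1)%:C * \sum_(0 <= d < N n | d != (k %% N n)%N)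
    huovinenK (cen n.+1 k - cen n.+1 (k %/ N n * N n + d))) <= cantor_eps R n.
Proof.
move=> kP; have rn0 := cantor_radius_gt0 configNp n.
have dig := cantor_digit configNp n k.
rewrite (_ : \sum_(_ <= _ < _ | _) _ = (r n)^-1%:C * \sum_(0 <= d < N n | d != (k %% N n)%N)
    huovinenK (p n (k %% N n) - p n d)); last first.
  rewrite mulr_sumr big_nat_cond [RHS]big_nat_cond; apply: eq_bigr => d /andP[/andP[_ dN] _].
  rewrite cantor_siblings; last by rewrite cantor_child_parent.
  by rewrite cantor_child_digit// huovinenKM huovinenKR.
rewrite mulrA cabsM -rmorphM cabsR ger0_norm ?divr_ge0 ?(cantor_radius_ge0 configNp)//.
have -> : cantor_eps R n = r n.+1 / r n * (cantor_eps R n * (N n)%:R).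
  rewrite (cantor_radiusS configNp n); field.
  by rewrite gt_eqF ?(cantor_radius_gt0 configNp)//= gt_eqF// ltr0n (cantor_N_gt0 configNp).
rewrite ler_wpM2l ?(config_potential (configNp n))//.
by rewrite divr_ge0 ?(cantor_radius_ge0 configNp).
Qed.

Variables (z : R * R) (S : set (R * R)) (B : R).
Local Notation h := (fun xi => huovinenK (cplx z - cplx xi)).
Hypotheses (mS : measurable S) (nullS : mu (~` S) = 0%E)
  (hB : forall x, S x -> cabs (h x) <= B).
Local Notation J n k := (cintegral mu (S `&` D n k) h).

Let mh : cmeasurable h := cmeasurable_huovinenK z.
Let mSD n k : measurable (S `&` D n k).
Proof. by apply: measurableI => //; exact: measurable_cantor_cell. Qed.

Let mass n k : (k < P n)%N -> fine (mu (S `&` D n k)) = r n.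
Proof.
by move=> kP; rewrite cantor_full_mass//; [rewrite muD|exact: measurable_cantor_cell].
Qed.

Lemma cantor_integral_siblings n k : (k < P n.+1)%N ->
  J n (k %/ N n)%N = J n.+1 k + \sum_(0 <= d < N n | d != (k %% N n)%N)
    J n.+1 (k %/ N n * N n + d)%N.
Proof.
move=> kP; rewrite (cantor_integral_split configNp muD mS mh hB (cantor_parent configNp kP)).
rewrite -(big_mkord xpredT (fun d => J n.+1 (k %/ N n * N n + d)%N)).
have D1 (F : nat -> C) : \sum_(0 <= d < N n) F d =
    F (k %% N n)%N + \sum_(0 <= d < N n | d != (k %% N n)%N) F d.
  by rewrite (bigD1_seq (k %% N n)%N) ?mem_index_iota ?iota_uniq ?(cantor_digit configNp).
apply: etrans (D1 _) _.
exact: (congr1 (fun l => J n.+1 l + _) (esym (divn_eq k (N n)))).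
Qed.

(** The difference is the integral over the siblings. Freezing the kernel at the centres leaves the
    potential of the configuration, at most [eps]; the error made is at most [80 eps] times the
    energy 20. *)
Lemma cantor_chain_step n k : (k < P n.+1)%N -> cabs (cplx z - cen n.+1 k) <= 2 * r n.+1 ->
  cabs (J n (k %/ N n)%N - J n.+1 k) <= 1601 * cantor_eps R n.
Proof.
move=> kP zk; rewrite cantor_integral_siblings// addrC addKr.
have kP0 := cantor_parent configNp kP.
have r0 := cantor_radius_gt0 configNp n.+1.
pose c d := cen n.+1 k - cen n.+1 (k %/ N n * N n + d).
(* The Lipschitz estimate gives [80 (r / |c|)^2]; one factor [r / |c|] is at most [eps] by
   separation, the other is kept for the energy sum. *)
have err d : (d < N n)%N -> d != (k %% N n)%N ->
    cabs (J n.+1 (k %/ N n * N n + d)%N - (r n.+1)%:C * huovinenK (c d)) <=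
    80 * cantor_eps R n * (r n.+1 * (cabs (c d))^-1).
  move=> dN dk; have lP := cantor_child kP0 dN.
  have kl : k != (k %/ N n * N n + d)%N.
    by apply: contra dk => /eqP kE; apply/eqP; rewrite kE !cantor_child_digit// kE.
  have sep := cantor_separated_eps configNp kP lP kl; rewrite -/(c d) in sep.
  have sep0 := cantor_separated configNp kP lP kl; rewrite -/(c d) in sep0.
  have c0 : 0 < cabs (c d) by apply: lt_le_trans sep0; rewrite mulr_gt0.
  rewrite mulrC -[in X in huovinenK _ * X](mass lP).
  have b x : (S `&` D n.+1 (k %/ N n * N n + d)) x ->
      cabs (h x - huovinenK (c d)) <= 40 * r n.+1 / cabs (c d) ^+ 2.
    move=> [_]; rewrite cantor_cellE => xd; apply: huovinenK_lipschitz => //.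
      by move: sep0 r0; move: (r _) (cabs (c d)) => a b *; lra.
    rewrite /c.
    have -> : cplx z - cplx x - (cen n.+1 k - cen n.+1 (k %/ N n * N n + d)) =
      (cplx z - cen n.+1 k) - (cplx x - cen n.+1 (k %/ N n * N n + d)) by ring.
    apply: le_trans (cabsD _ _) _; rewrite cabsN.
    move: zk xd r0; move: (r _) (cabs _) (cabs _) => a b e *; lra.
  apply: le_trans (cintegral_approx mu (mSD _ _) mh b) _.
  rewrite mass//.
  have -> : 2 * (40 * r n.+1 / cabs (c d) ^+ 2) * r n.+1 =
      80 * (r n.+1 / cabs (c d)) * (r n.+1 * (cabs (c d))^-1).
    by field; rewrite gt_eqF.
  rewrite ler_wpM2r// ?divr_ge0 ?(ltW r0) ?(ltW c0)//.
  by rewrite ler_pM2l// ler_pdivrMr.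
pose T := \sum_(0 <= d < N n | d != (k %% N n)%N) (r n.+1)%:C * huovinenK (c d).
have T1 : cabs T <= cantor_eps R n.
  by rewrite /T -mulr_sumr; exact: cantor_sibling_potential.
rewrite -[X in cabs X](subrK T); apply: le_trans (cabsD _ _) _.
suff : cabs (\sum_(0 <= d < N n | d != (k %% N n)%N) J n.+1 (k %/ N n * N n + d)%N - T) <=
    80 * cantor_eps R n * 20.
  by move: (cantor_eps R n) (cabs T) T1 (cabs _) => e t te y; lra.
rewrite /T -sumrB; apply: le_trans (cabs_sum _ _ _) _.
apply: (@le_trans _ _ (\sum_(0 <= d < N n | d != (k %% N n)%N)
    80 * cantor_eps R n * (r n.+1 * (cabs (c d))^-1))).
  rewrite big_nat_cond [leRHS]big_nat_cond; apply: ler_sum => d /andP[/andP[_ dN] dk].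
  exact: err.
rewrite -mulr_sumr -mulr_sumr ler_wpM2l//; last exact: cantor_sibling_energy.
by rewrite mulr_ge0// ltW ?cantor_eps_gt0.
Qed.

Lemma cantor_chain n k : (k < P n)%N -> cabs (cplx z - cen n k) <= 2 * r n ->
  cabs (J 0%N 0%N - J n k) <= 33.
Proof.
(* The increments [16.01 * 2^-n] are absorbed in those of [33 (1 - 2^-n)], which makes the induction
   close. *)
suff H : (k < P n)%N -> cabs (cplx z - cen n k) <= 2 * r n ->
    cabs (J 0%N 0%N - J n k) <= 33 * (1 - 2^-1 ^+ n).
  move=> kP zk; apply: le_trans (H kP zk) _.
  have : (0 : R) <= 2^-1 ^+ n by rewrite exprn_ge0.
  by move: (_ ^+ n) => x; lra.
elim: n k => [|n IH] k.
  rewrite cantor_count0 ltnS leqn0 => /eqP-> _.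
  by rewrite subrr cabs0 expr0 subrr mulr0.
move=> kP zk.
have zk' : cabs (cplx z - cen n (k %/ N n)) <= 2 * r n.
  have := cantor_center_parent configNp n k.
  have := cabsB_trans (cen n.+1 k) (cplx z) (cen n (k %/ N n)).
  have := cantor_radius_small configNp n; have := cantor_radius_gt0 configNp n.+1.
  by move: (r n) (r n.+1) zk => a b *; lra.
have t1 := IH _ (cantor_parent configNp kP) zk'.
have t2 := cantor_chain_step kP zk.
have t3 := cabsB_trans (J n (k %/ N n)%N) (J 0%N 0%N) (J n.+1 k).
move: t1 t2 t3; rewrite /cantor_eps exprS.
have : (0 : R) <= 2^-1 ^+ n by rewrite exprn_ge0.
move: (cabs _) (cabs _) (cabs _) (2^-1 ^+ n : R) => a b c x *; lra.
Qed.

(** The child nearest to [z] contributes at most 3. Any other child is at least half as far from [z]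
    as from the nearest one, so its kernel is at most four times that between the centres, and the
    energy bound gives [8 * 20]. *)
Lemma cantor_last_generation n k : (k < P n)%N ->
  (forall d, (d < N n)%N -> 2 * r n.+1 < cabs (cplx z - cen n.+1 (k * N n + d))) ->
  cabs (J n k) <= 163.
Proof.
move=> kP far; have N0 := cantor_N_gt0 configNp n.
have r0 := cantor_radius_gt0 configNp n.+1.
pose w d := cabs (cplx z - cen n.+1 (k * N n + d)).
have [d0 d0N d0min] : exists2 d0, (d0 < N n)%N & forall d, (d < N n)%N -> w d0 <= w d.
  case: (@Order.TotalTheory.arg_minP _ R _ (Ordinal N0) xpredT (fun d => w d)) => // i _ imin.
  by exists i => // d dN; exact: (imin (Ordinal dN)).
have lP := cantor_child kP d0N; have := cantor_integral_siblings lP.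
rewrite cantor_child_parent// cantor_child_digit// => ->.
apply: le_trans (cabsD _ _) _.
have bound d : (d < N n)%N -> forall b, (forall x, D n.+1 (k * N n + d) x -> cabs (h x) <= b) ->
    cabs (J n.+1 (k * N n + d)%N) <= 2 * b * r n.+1.
  move=> dN b hb; rewrite -[in leRHS](mass (cantor_child kP dN)).
  by apply: (@cintegral_bound _ mu _ h b (mSD _ _) mh) => x [_]; exact: hb.
have J0 : cabs (J n.+1 (k * N n + d0)%N) <= 3.
  apply: le_trans (bound _ d0N (2 / 3 * r n.+1)^-1 _) _.
    move=> x; rewrite cantor_cellE => xd; rewrite cabs_huovinenK.
    have t := cabsB_trans (cplx x) (cplx z) (cen n.+1 (k * N n + d0)).
    have f := far _ d0N.
    rewrite lef_pV2 ?posrE; last by rewrite mulr_gt0.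
      by move: t f xd r0; move: (r _) (cabs _) (cabs _) (cabs _) => *; lra.
    by move: t f xd r0; move: (r _) (cabs _) (cabs _) (cabs _) => *; lra.
  by rewrite invfM -!mulrA mulVf ?gt_eqF//; lra.
suff : cabs (\sum_(0 <= d < N n | d != d0) J n.+1 (k * N n + d)%N) <= 160.
  by move: J0; move: (cabs _) (cabs _) => *; lra.
have := cantor_sibling_energy lP; rewrite cantor_child_parent// cantor_child_digit//.
pose c d := cabs (cen n.+1 (k * N n + d0) - cen n.+1 (k * N n + d)).
move=> energy; apply: (@le_trans _ _ (8 * 20)); last by lra.
apply: le_trans (cabs_sum _ _ _) _.
apply: le_trans (_ : _ <= 8 * (r n.+1 * \sum_(0 <= d < N n | d != d0) (c d)^-1)) _; last first.
  by rewrite ler_pM2l.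
rewrite !mulr_sumr big_nat_cond [leRHS]big_nat_cond; apply: ler_sum => d /andP[/andP[_ dN] dd].
have dl : (k * N n + d0 != k * N n + d)%N by rewrite eqn_add2l eq_sym.
have sep := cantor_separated configNp lP (cantor_child kP dN) dl; rewrite -/(c d) in sep.
have c0 : 0 < c d by apply: lt_le_trans sep; rewrite mulr_gt0.
apply: le_trans (bound _ dN (c d / 4)^-1 _) _.
  move=> x; rewrite cantor_cellE => xd; rewrite cabs_huovinenK.
  have t := cabsB_trans (cplx x) (cplx z) (cen n.+1 (k * N n + d)).
  have t0 := cabsB_trans (cplx z) (cen n.+1 (k * N n + d0)) (cen n.+1 (k * N n + d)).
  have m := d0min _ dN.
  rewrite (cabsBC (cen n.+1 (k * N n + d0)) (cplx z)) -/(w d0) -/(w d) -/(c d) in t0.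
  rewrite -/(w d) in t.
  have lb : c d / 4 <= cabs (cplx z - cplx x).
    by move: t t0 m sep xd r0; move: (r _) (cabs _) (cabs _) (w _) (w _) (c d) => *; lra.
  by rewrite lef_pV2 ?posrE// ?divr_gt0// (lt_le_trans _ lb)// divr_gt0.
by rewrite invfM invrK le_eqVlt; apply/orP; left; apply/eqP; ring.
Qed.

End CantorPotential.

Section CantorBound.
Variable R : realType.
Local Notation C := R[i].
Variables (N : nat -> nat) (p : nat -> nat -> C).
Hypothesis configNp : forall n, point_config (cantor_eps R n) (N n) (p n).
Local Notation P := (cantor_count N).
Local Notation r := (cantor_radius R N).
Local Notation cen := (cantor_center N p).
Local Notation D := (cantor_cell N p).
Local Notation E := (cantor_level N p).
Variable mu : probability (R * R)%type R.
Hypothesis muD : forall n k, (k < P n)%N -> mu (D n k) = (r n)%:E.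

(** Take the first generation all of whose cells are far from [z]. The preceding one has a cell near
    [z]: outside it the chain costs 33, inside it the last generation costs 163. Restricting to the
    far generation keeps the kernel bounded throughout. *)
Lemma cantor_huovinenT_le z : ~ msupport mu z -> cabs (huovinenT mu z) <= 200.
Proof.
move=> zS; pose far n := `[< forall k, (k < P n)%N -> 2 * r n < cabs (cplx z - cen n k) >].
have ex : exists n, far n.
  by have [n nP] := cantor_not_support configNp muD zS; exists n; apply/asboolP.
have {ex} [n /asboolP farn nmin] := ex_minnP ex.
pose h xi := huovinenK (cplx z - cplx xi).
have mh : cmeasurable h := cmeasurable_huovinenK z.
have mE := measurable_cantor_level N p n.
have nullE := cantor_level_full configNp muD n.
have r0 := cantor_radius_gt0 configNp n.
have hB xi : E n xi -> cabs (h xi) <= (r n / 2)^-1.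
  move=> /cantor_levelP[k kP]; rewrite cantor_cellE /h cabs_huovinenK => xk.
  have t := cabsB_trans (cplx xi) (cplx z) (cen n k); have f := farn k kP.
  have lb : r n / 2 <= cabs (cplx z - cplx xi).
    by move: t f xk r0; move: (r _) (cabs _) (cabs _) (cabs _) => *; lra.
  by rewrite lef_pV2 ?posrE// ?divr_gt0// (lt_le_trans _ lb)// divr_gt0.
rewrite /huovinenT -/h (cintegral_full mE nullE mh).
case: n farn nmin mE nullE r0 hB => [|n] farn nmin mE nullE r0 hB.
  apply: le_trans (cintegral_bound mu mE mh hB) _.
  have -> : fine (mu (E 0)) = 1.
    by rewrite -(setTI (E 0)) setIC cantor_full_mass// probability_setT.
  by rewrite cantor_radius0; lra.
have [k [kP zk]] : exists k, (k < P n)%N /\ cabs (cplx z - cen n k) <= 2 * r n.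
  apply: contrapT => none; suff /nmin : far n by rewrite ltnn.
  apply/asboolP => k kP; rewrite ltNge; apply/negP => zk.
  by apply: none; exists k.
have chain := cantor_chain configNp muD mE nullE hB kP zk.
have last : cabs (cintegral mu (E n.+1 `&` D n k) h) <= 163.
  apply: (cantor_last_generation configNp muD mE nullE hB kP) => d dN.
  exact: farn (cantor_child kP dN).
have -> : cintegral mu (E n.+1) h = cintegral mu (E n.+1 `&` D 0 0) h.
  rewrite (cantor_integral_level configNp muD mE mh hB 0).
  by rewrite cantor_count0 big_ord1.
have := cabsB_ge (cintegral mu (E n.+1 `&` D 0 0) h) (cintegral mu (E n.+1 `&` D n k) h).
by move: chain last; rewrite -/h; move: (cabs _) (cabs _) (cabs _) => *; lra.
Qed.

Lemma cantor_Linfty_norm : (Linfty_norm (~` msupport mu) (huovinenT mu) < +oo)%E.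
Proof.
apply: (@le_lt_trans _ _ (200%:E)); last exact: ltry.
rewrite /Linfty_norm unlock; case: ifP => _; last by rewrite lee_fin ler0n.
apply/ess_sup_inf.ess_supP; apply: nearW => z; rewrite /comp patchE.
case: ifPn => [|_]; last by rewrite abse0 lee_fin ler0n.
rewrite inE => zS; rewrite abse_EFin lee_fin.
by rewrite ger0_norm; [exact: cantor_huovinenT_le zS|exact: (cabs_ge0 (huovinenT mu z))].
Qed.

End CantorBound.

(** * Failure of the principal values *)

Section Cone.
Variable R : realType.
Local Notation C := R[i].

(** With [U = |u|^2], [W = |w|^2] and [A] the scalar product, the expression is
    [|u|^3 cos (3 t) / |w|] for the angle [t]. Positivity rests on [49 / 16 - 303 / 100 > 1 / 32], a
    quantitative form of [7 / 4 > sqrt 3]. *)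
Lemma huovinenK_cone_real (A U W s : R) : 0 < s -> 0 <= U -> U <= 101 / 100 * s ->
  U + W - 2 * A <= 101 / 100 * s -> 49 / 16 * s < W ->
  s / 128 <= A * (4 * A ^+ 2 - 3 * W * U) / W ^+ 2.
Proof.
move=> s0 U0 Us WA Ws.
have W0 : 0 < W by lra.
have A4 : W / 4 <= A by lra.
pose t := 101 / 100 * s.
have A2 : (U + W - t) ^+ 2 <= 4 * A ^+ 2.
  have -> : 4 * A ^+ 2 = (2 * A) ^+ 2 by ring.
  by rewrite ler_sqr ?nnegrE /t; lra.
have X : W * (s / 32) <= 4 * A ^+ 2 - 3 * W * U.
  have : W * (s / 32) <= W * (W - U - 2 * t) by rewrite ler_pM2l// /t; lra.
  have : 0 <= (U - t) ^+ 2 by rewrite sqr_ge0.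
  have -> : W * (W - U - 2 * t) = (U + W - t) ^+ 2 - (U - t) ^+ 2 - 3 * W * U by ring.
  by move: A2; move: (_ ^+ 2) (_ ^+ 2) (_ ^+ 2) (W * (s / 32)) (3 * W * U) => *; lra.
rewrite ler_pdivlMr ?exprn_gt0//.
have -> : s / 128 * W ^+ 2 = (W / 4) * (W * (s / 32)) by field.
by apply: ler_pM => //; rewrite ?mulr_ge0 ?divr_ge0 ?(ltW W0) ?(ltW s0).
Qed.

(* Geometrically, the angle between [u] and [w] is less than [pi / 6]; as [K] turns
   three times as fast as the argument, [u ^+ 3 * K w] stays in the right half-plane. *)
Lemma huovinenK_cone (u w : C) (s : R) : 0 < s ->
  cabs u ^+ 2 <= 101 / 100 * s ^+ 2 -> cabs (w - u) ^+ 2 <= 101 / 100 * s ^+ 2 ->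
  7 / 4 * s < cabs w -> s ^+ 2 / 128 <= complex.Re (u ^+ 3 * huovinenK w).
Proof.
move=> s0 us wus ws.
have w2 : 49 / 16 * s ^+ 2 < cabs w ^+ 2.
  have -> : 49 / 16 * s ^+ 2 = (7 / 4 * s) ^+ 2 by field.
  by rewrite ltr_sqr ?nnegrE ?cabs_ge0// mulr_ge0// ltW.
have w0 : cabs w ^+ 2 != 0 by rewrite gt_eqF// (lt_trans _ w2)// mulr_gt0// exprn_gt0.
have ReE a b c d : c ^+ 2 + d ^+ 2 != 0 -> complex.Re ((a +i* b) ^+ 3 * huovinenK (c +i* d)) =
   (a * c + b * d) * (4 * (a * c + b * d) ^+ 2 - 3 * (c ^+ 2 + d ^+ 2) * (a ^+ 2 + b ^+ 2)) /
   (c ^+ 2 + d ^+ 2) ^+ 2 :> R.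
  by move=> cd; rewrite huovinenKE !exprS expr0 mulr1 /=; field; rewrite -!expr2.
move: us wus w2 w0; rewrite !sqr_cabs; case: u w {ws} => a b [c d] us wus w2 w0.
rewrite ReE//; move: us wus w2; rewrite /= => us wus w2.
apply: huovinenK_cone_real => //; first by rewrite exprn_gt0.
  by rewrite addr_ge0// sqr_ge0.
apply: le_trans wus; rewrite le_eqVlt; apply/orP; left; apply/eqP; ring.
Qed.

End Cone.

Section ComplexLinear.
Variable R : realType.
Variable mu : probability (R * R)%type R.
Local Notation C := R[i].

Lemma cintegral_Re_ge S (h : R * R -> C) (c : C) (B b : R) : measurable S -> cmeasurable h ->
  (forall x, S x -> cabs (h x) <= B) -> (forall x, S x -> b <= complex.Re (c * h x)) ->
  b * fine (mu S) <= complex.Re (c * cintegral mu S h).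
Proof.
move=> mS [mRe mIm] hB hb.
have iRe : mu.-integrable S (EFin \o (fun x => complex.Re (h x))).
  apply: (@prob_bounded_integrable _ _ _ mu _ _ B) => // x Sx.
  by apply: le_trans (hB x Sx); exact: Re_le_cabs.
have iIm : mu.-integrable S (EFin \o (fun x => complex.Im (h x))).
  apply: (@prob_bounded_integrable _ _ _ mu _ _ B) => // x Sx.
  by apply: le_trans (hB x Sx); exact: Im_le_cabs.
have -> : complex.Re (c * cintegral mu S h) =
    \int[mu]_(x in S) (complex.Re c * complex.Re (h x) - complex.Im c * complex.Im (h x)).
  rewrite RintegralB//.
  - by rewrite !RintegralZl//; case: c {hb}.
  - exact: (integrableZl mS (complex.Re c) iRe).
  - exact: (integrableZl mS (complex.Im c) iIm).
rewrite -(Rintegral_cst mu mS b); apply: le_Rintegral => //.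
- exact: finite_measure_integrable_cst.
- apply: (integrableB mS (integrableZl mS (complex.Re c) iRe) (integrableZl mS (complex.Im c) iIm)).
move=> x Sx; apply: le_trans (hb x Sx) _.
by case: c {hb} => c1 c2; case: (h x).
Qed.

End ComplexLinear.

Section RealBounds.
Variable R : realType.
Implicit Types a b x : R.

Lemma sq_near a b x : 0 < a -> 0 <= b -> 1000 * b <= a ->
  0 <= x -> x <= a + 2 * b -> x ^+ 2 <= 101 / 100 * a ^+ 2.
Proof.
move=> a0 b0 ba x0 xa; apply: (@le_trans _ _ ((a + 2 * b) ^+ 2)).
  by rewrite ler_sqr ?nnegrE//; lra.
have ba1 : b <= a by lra.
have : b ^+ 2 <= a * b by rewrite expr2 ler_wpM2r.
have : a * (1000 * b) <= a * a by rewrite ler_pM2l.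
by rewrite expr2 sqrrD; move: (b ^+ 2) => y; nra.
Qed.

Lemma cube_near a b x : 0 < a -> 0 <= b -> 1000 * b <= a ->
  0 <= x -> x <= a + 2 * b -> x ^+ 3 <= 2 * a ^+ 3.
Proof.
move=> a0 b0 ba x0 xa; rewrite exprSr [a ^+ 3]exprSr.
have := sq_near a0 b0 ba x0 xa; have : 0 <= a ^+ 2 by exact: sqr_ge0.
move: (a ^+ 2) (x ^+ 2) => A X A0 XA.
apply: (@le_trans _ _ (101 / 100 * A * x)); first by rewrite ler_wpM2r.
have -> : 101 / 100 * A * x = A * (101 / 100 * x) by ring.
by rewrite [leRHS]mulrCA ler_wpM2l//; lra.
Qed.

Lemma gap_constant a x : 0 < a ->
  a ^+ 2 / 128 * (a / 200) <= 2 * a ^+ 3 * x -> (256 * 200)^-1 <= x.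
Proof.
move=> a0 H; have a3 : 0 < 2 * a ^+ 3 by rewrite mulr_gt0// exprn_gt0.
rewrite -(ler_pM2l a3); apply: le_trans H; rewrite le_eqVlt; apply/orP; left; apply/eqP.
by field.
Qed.

End RealBounds.

Section PrincipalValue.
Variable R : realType.
Local Notation C := R[i].
Variables (N : nat -> nat) (p : nat -> nat -> C).
Hypothesis configNp : forall n, point_config (cantor_eps R n) (N n) (p n).
Local Notation P := (cantor_count N).
Local Notation r := (cantor_radius R N).
Local Notation cen := (cantor_center N p).
Local Notation D := (cantor_cell N p).
Local Notation E := (cantor_level N p).
Variable mu : probability (R * R)%type R.
Hypothesis muD : forall n k, (k < P n)%N -> mu (D n k) = (r n)%:E.

Lemma cantor_mass_ge n M (c : nat -> nat) (Q : pred nat) A : measurable A ->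
  (forall e f, (e < M)%N -> (f < M)%N -> c e = c f -> e = f) ->
  (forall e, (e < M)%N -> (c e < P n)%N) ->
  (forall e z, (e < M)%N -> Q e -> D n (c e) z -> A z) ->
  \sum_(0 <= e < M | Q e) r n <= fine (mu A).
Proof.
move=> mA cinj cP sub; rewrite -lee_fin fineK_prob//.
pose F e := if (e < M)%N && Q e then D n (c e) else set0.
have mF e : measurable (F e).
  by rewrite /F; case: ifP => // _; exact: measurable_cantor_cell.
apply: (@le_trans _ _ (mu (\big[setU/set0]_(e < M) F e))); last first.
  apply: le_measure; rewrite ?inE//; first exact: bigsetU_measurable.
  rewrite -bigcup_mkord => z [e /= eM]; rewrite /F eM /=; case: ifP => // Qe.
  exact: sub.
rewrite measure_bigsetU//; last first.
  apply/trivIsetP => e f _ _ /eqP ef; apply/seteqP; split => // z [].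
  rewrite /F; case: ifP => // /andP[eM _] De; case: ifP => // /andP[fM _] Df.
  exact/ef/cinj/(cantor_cell_uniq configNp (cP e eM) (cP f fM) De Df).
rewrite -sumEFin big_mkcond big_mkord le_eqVlt; apply/orP; left; apply/eqP.
apply: eq_bigr => e _; rewrite /F ltn_ord /=.
by case: ifP => _; [have := muD (cP e (ltn_ord e)) => ->|rewrite measure0].
Qed.

Section Gap.
Variables (n k d : nat) (z : R * R).
Hypotheses (kP : (k < P n)%N) (dN : (d < N n)%N) (zD : D n.+1 (k * N n + d) z).
Local Notation h := (fun xi => huovinenK (cplx z - cplx xi)).

(** Intersecting with generation [n.+1] improves the cell radius to [r n + 2 * r n.+1]; the square
    of [101 / 100 * r n] would exceed what the cone estimate admits. *)
Let ann : set (R * R) := (D n k `&` E n.+1) `\` cdisc z (7 / 4 * r n).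

Let mann : measurable ann.
Proof.
apply: measurableD; last exact: measurable_cdisc.
by apply: measurableI; [exact: measurable_cantor_cell|exact: measurable_cantor_level].
Qed.

Let r0 : 0 < r n. Proof. exact: cantor_radius_gt0. Qed.

Let b0 : 0 <= r n.+1. Proof. exact: cantor_radius_ge0. Qed.
Let ba : 1000 * r n.+1 <= r n. Proof. exact: cantor_radius_small. Qed.

Let child_near l x : (l < P n.+1)%N -> D n.+1 l x ->
  cabs (cplx x - cen n (l %/ N n)) <= r n + 2 * r n.+1.
Proof.
rewrite cantor_cellE => lP xl.
have := cabsB_trans (cen n.+1 l) (cplx x) (cen n (l %/ N n)).
have := cantor_center_parent configNp n l; have := cantor_radius_small configNp n.
have := cantor_radius_gt0 configNp n.+1.
by move: (r n) (r n.+1) (cabs _) (cabs _) (cabs _) xl => *; lra.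
Qed.

Let z_near : cabs (cplx z - cen n k) <= r n + 2 * r n.+1.
Proof.
by have := child_near (cantor_child kP dN) zD; rewrite (cantor_child_parent configNp).
Qed.

Let ann_near x : ann x -> cabs (cplx x - cen n k) <= r n + 2 * r n.+1.
Proof.
move=> [[Dx /cantor_levelP[l lP Dl]] _]; have := child_near lP Dl.
by rewrite (cantor_cell_uniq configNp kP (cantor_parent configNp lP) Dx
  (cantor_cell_nested configNp Dl)).
Qed.

(** The cell lies within [4 * r n] of [z], and the other cells of its generation lie beyond. Between
    the two radii there is thus, up to a null set, only a part of the cell. *)
Lemma cantor_truncation_gap :
  truncatedT mu (7 / 4 * r n) z = cintegral mu ann h + truncatedT mu (4 * r n) z.
Proof.
have mh := cmeasurable_huovinenK z.
have mc s : measurable (~` cdisc z s) by apply: measurableC; exact: measurable_cdisc.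
pose F i := if i is 0%N then ann else ~` cdisc z (4 * r n).
have mF i : measurable (F i) by case: i => [|i]; [exact: mann|exact: mc].
have sum2 (G : nat -> C) : \sum_(i < 2) G i = G 0%N + G 1%N by rewrite !big_ord_recr big_ord0 /= add0r.
apply: etrans (@cintegral_partition _ mu (~` cdisc z (7 / 4 * r n)) F 2 h (7 / 4 * r n)^-1
  _ _ _ _ _ _) _ => //.
- have dis x : ann x -> cdisc z (4 * r n) x.
    move=> /ann_near xk; rewrite /cdisc /= cdistE.
    have := cabsB_trans (cen n k) (cplx x) (cplx z); rewrite (cabsBC (cen n k) (cplx z)).
    move: z_near xk r0 b0 ba; move: (r n) (r n.+1) (cabs _) (cabs _) (cabs _) => *; lra.
  move=> [|[|]]// [|[|]]// x _ _ /=; first by move=> /dis.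
  by move=> nx /dis.
- apply/eqP; rewrite eq_le measure_ge0 andbT -(cantor_level_full configNp muD n.+1).
  apply: le_measure; rewrite ?inE.
  + apply: measurableD => //; apply: bigsetU_measurable => i _; exact: mF.
  + by apply: measurableC; exact: measurable_cantor_level.
  move=> x [xz nF] Ex; apply: nF; rewrite -(bigcup_mkord 2 F).
  case/cantor_levelP: (Ex) => l lP Dl; have [lk|lk] := eqVneq (l %/ N n)%N k.
    exists 0%N => //=; split=> //; split=> //.
    by rewrite -lk; exact: (cantor_cell_nested configNp).
  exists 1%N => //=; rewrite /cdisc /= cdistE => xz4.
  have sep := cantor_separated configNp (cantor_parent configNp lP) kP lk.
  have xl := child_near lP Dl.
  have t1 := cabsB_trans (cplx x) (cen n (l %/ N n)) (cen n k).
  have t2 := cabsB_trans (cplx z) (cplx x) (cen n k).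
  rewrite (cabsBC (cen n (l %/ N n)) (cplx x)) in t1.
  by move: sep xl t1 t2 z_near xz4 r0 b0 ba; move: (r n) (r n.+1) (cabs _) (cabs _) (cabs _) (cabs _) (cabs _) => *; lra.
- move=> x /negP; rewrite cdistE -ltNge => xz.
  rewrite cabs_huovinenK (cabsBC (cplx z)) lef_pV2 ?posrE ?mulr_gt0// ?(ltW xz)//.
  by apply: le_lt_trans xz; rewrite mulr_ge0// ltW.
apply: etrans (sum2 (fun i => cintegral mu (~` cdisc z (7 / 4 * r n) `&` F i) h)) _.
congr (cintegral mu _ h + cintegral mu _ h); rewrite /F.
  by apply/setIidPr => x [].
apply/setIidPr => x /=; apply: contra_not; rewrite /cdisc /= => /le_trans; apply.
by move: (r n) r0 => a *; lra.
Qed.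

Hypothesis far : (N n <= 200 * \sum_(0 <= e < N n | (9 / 5 <= cabs (p n d - p n e))%R) 1)%N.

(** A child whose centre is [9 / 5 * r n] away stays beyond [7 / 4 * r n] despite the sizes of both
    children. *)
Let ann_mass : r n / 200 <= fine (mu ann).
Proof.
pose Q e := 9 / 5 <= cabs (p n d - p n e).
apply: (@le_trans _ _ (\sum_(0 <= e < N n | Q e) r n.+1)).
  have : (N n)%:R * r n.+1 <= (200 * \sum_(0 <= e < N n | Q e) 1)%:R * r n.+1.
    by rewrite ler_wpM2r ?(cantor_radius_ge0 configNp)// ler_nat.
  rewrite -(cantor_radiusS configNp) natrM natr_sum -mulrA mulr_suml.
  under eq_bigr do rewrite mul1r.
  by move: (r n) (\sum_(_ <= _ < _ | _) _) => *; lra.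
apply: (@cantor_mass_ge n.+1 (N n) (fun e => (k * N n + e)%N)) => //.
- by move=> e f eN fN /addnI.
- by move=> e eN; exact: cantor_child.
move=> e x eN Qe De.
have lP := cantor_child kP eN.
split.
  split; last by apply/cantor_levelP; exists (k * N n + e)%N.
  by have := cantor_cell_nested configNp De; rewrite (cantor_child_parent configNp).
rewrite /cdisc /= cdistE => xz.
have cc : 9 / 5 * r n <= cabs (cen n.+1 (k * N n + d) - cen n.+1 (k * N n + e)).
  rewrite cantor_siblings; last by rewrite !(cantor_child_parent configNp).
  rewrite !cantor_child_digit// cabsM cabsR (ger0_norm (ltW r0)) mulrC.
  by rewrite ler_pM2l.
move: zD De; rewrite !cantor_cellE => zd xe.
have t1 := cabsB_trans (cplx z) (cen n.+1 (k * N n + d)) (cen n.+1 (k * N n + e)).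
have t2 := cabsB_trans (cplx x) (cplx z) (cen n.+1 (k * N n + e)).
rewrite (cabsBC (cen n.+1 (k * N n + d)) (cplx z)) in t1.
rewrite (cabsBC (cplx z) (cplx x)) in t2.
have := cantor_radius_small configNp n; have := cantor_radius_gt0 configNp n.+1.
by move: t1 t2 zd xe xz cc r0; move: (r n) (r n.+1) (cabs _) (cabs _) (cabs _) (cabs _) (cabs _) => *; lra.
Qed.

(** Multiplying by [u ^+ 3] turns all kernel values into the right half-plane, so nothing cancels;
    dividing by [|u|^3 <= 2 r n ^ 3] makes the bound independent of [n]. *)
Lemma cantor_truncation_gap_ge :
  (256 * 200)^-1 <= cabs (truncatedT mu (7 / 4 * r n) z - truncatedT mu (4 * r n) z).
Proof.
rewrite cantor_truncation_gap addrK.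
pose u := cplx z - cen n k.
have mh := cmeasurable_huovinenK z.
have I1 : r n ^+ 2 / 128 * fine (mu ann) <= complex.Re (u ^+ 3 * cintegral mu ann h).
  apply: (@cintegral_Re_ge _ mu ann h (u ^+ 3) (7 / 4 * r n)^-1 (r n ^+ 2 / 128) mann mh).
    move=> x [_ /negP]; rewrite cdistE -ltNge => xz.
    rewrite cabs_huovinenK (cabsBC (cplx z)) lef_pV2 ?posrE ?mulr_gt0// ?(ltW xz)//.
    by apply: le_lt_trans xz; rewrite mulr_ge0// ltW.
  move=> x ax; have [_ /negP] := ax; rewrite cdistE -ltNge => xz.
  apply: huovinenK_cone => //; [exact: (sq_near r0 b0 ba (cabs_ge0 _) z_near)|..|by rewrite cabsBC].
  apply: (sq_near r0 b0 ba (cabs_ge0 _)); rewrite /u opprB addrC addrA subrK cabsBC.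
  exact: ann_near.
have I2 : complex.Re (u ^+ 3 * cintegral mu ann h) <= cabs u ^+ 3 * cabs (cintegral mu ann h).
  by apply: le_trans (ler_norm _) _; apply: le_trans (Re_le_cabs _) _; rewrite cabsM cabsX.
have u3 : cabs u ^+ 3 <= 2 * r n ^+ 3 by exact: (cube_near r0 b0 ba (cabs_ge0 _) z_near).
have I3 : r n ^+ 2 / 128 * (r n / 200) <= 2 * r n ^+ 3 * cabs (cintegral mu ann h).
  apply: le_trans (le_trans _ I1) (le_trans I2 _).
    by rewrite ler_wpM2l ?divr_ge0 ?ler0n ?exprn_ge0 ?ann_mass ?(ltW r0).
  by rewrite ler_wpM2r// cabs_ge0.
exact: (gap_constant r0 I3).
Qed.

End Gap.

Lemma cvg_near_cabs (f : R -> C) (l : C) (e : R) : 0 < e ->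
  (f delta : C^o) @[delta --> 0^'+] --> (l : C^o) ->
  exists2 t : R, 0 < t & forall delta : R, 0 < delta < t -> cabs (f delta - l) < e.
Proof.
move=> e0 /cvgrPdist_lt /(_ e%:C); rewrite ltcR => /(_ e0) near0.
have : \forall delta \near 0^'+, cabs (f delta - l) < e.
  apply: filterS near0 => delta; rewrite -[X in X < _ -> _]/((cabs (l - f delta))%:C) ltcR.
  by rewrite cabsBC.
rewrite near_withinE => /nbhs_ballP[t /= t0 tP]; exists t => // delta /andP[d0 dt].
by apply: tP => //; rewrite /ball /= sub0r normrN ger0_norm ?ltW.
Qed.

Lemma cantor_not_pv z :
  (forall t : R, 0 < t -> exists n k d, [/\ r n < t, (k < P n)%N, (d < N n)%N,
     D n.+1 (k * N n + d) z &
     (N n <= 200 * \sum_(0 <= e < N n | (9 / 5 <= cabs (p n d - p n e))%R) 1)%N]) ->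
  ~ pv_exists mu z.
Proof.
move=> good [l /cvg_near_cabs lim].
have : 0 < (256 * 200)^-1 :> R by rewrite invr_gt0 mulr_gt0 ?ltr0n.
have := cantor_truncation_gap_ge; move: ((256 * 200)^-1 : R) => c gap_ge c0'.
have c0 : 0 < c / 2 by lra.
have [t t0 tP] := lim _ c0.
have t4 : 0 < t / 4 by rewrite divr_gt0.
have [n [k [d [rn kP dN zD far]]]] := good _ t4.
have gap := gap_ge _ _ _ _ kP dN zD far.
have r0 := cantor_radius_gt0 configNp n.
have h1 : cabs (truncatedT mu (7 / 4 * r n) z - l) < c / 2.
  by apply: tP; move: (r n) rn r0 => a *; apply/andP; split; lra.
have h2 : cabs (truncatedT mu (4 * r n) z - l) < c / 2.
  by apply: tP; move: (r n) rn r0 => a *; apply/andP; split; lra.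
have := cabsB_trans l (truncatedT mu (7 / 4 * r n) z) (truncatedT mu (4 * r n) z).
rewrite (cabsBC l); move: gap h1 h2; move: (cabs _) (cabs _) (cabs _) => *; lra.
Qed.

Variable G : nat -> pred nat.
Hypothesis Gcount : forall n, (N n <= 200 * \sum_(0 <= d < N n | G n d) 1)%N.
Hypothesis Gfar : forall n d, (d < N n)%N -> G n d ->
  (N n <= 200 * \sum_(0 <= e < N n | (9 / 5 <= cabs (p n d - p n e))%R) 1)%N.

Fixpoint cantor_bad n j k :=
  if j is i.+1 then cantor_bad n i (k %/ N (n + i))%N && ~~ G (n + i) (k %% N (n + i))%N
  else true.

(** At each generation at least 1/200 of the children of every cell are good, so avoiding them
    multiplies the mass by at most 199/200. This counting replaces an independence argument. *)
Lemma cantor_bad_mass n j :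
  \sum_(0 <= k < P (n + j) | cantor_bad n j k) r (n + j) <= (199 / 200) ^+ j.
Proof.
elim: j => [|j IH].
  rewrite addn0 expr0 /= big_const_nat subn0 iter_addr_0 -[r n *+ _]mulr_natl.
  by rewrite (cantor_radius_count configNp).
rewrite addnS cantor_countS big_mkcond sum_nat_mul exprSr.
set m := (n + j)%N in IH *.
have row i : \sum_(0 <= k < N m) (if cantor_bad n j.+1 (i * N m + k) then r m.+1 else 0) <=
    (if cantor_bad n j i then r m else 0) * (199 / 200).
  rewrite (@eq_big_nat _ _ _ _ _ _ (fun k => if cantor_bad n j i && ~~ G m k then r m.+1 else 0)); last first.
    by move=> k /andP[_ kN] /=; rewrite -/m (cantor_child_parent configNp)// cantor_child_digit.
  case: (cantor_bad n j i) => /=; last by rewrite mul0r big1.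
  have cnt : (\sum_(0 <= k < N m) (if ~~ G m k then 1 else 0) : R) +
      \sum_(0 <= k < N m) (if G m k then 1 else 0) = (N m)%:R.
    rewrite -big_split /= (eq_bigr (fun=> 1)); last by move=> k _; case: (G m k); rewrite /= ?addr0 ?add0r.
    by rewrite big_const_nat subn0 iter_addr_0.
  have g : (N m)%:R <= 200 * \sum_(0 <= k < N m) (if G m k then 1 else 0) :> R.
    by rewrite -big_mkcond -(natr_sum _ _ _ (fun=> 1%N)) -natrM ler_nat.
  rewrite (eq_bigr (fun k => (if ~~ G m k then 1 else 0) * r m.+1)); last first.
    by move=> k _; case: ifP; rewrite ?mul1r ?mul0r.
  rewrite -mulr_suml (cantor_radiusS configNp m) mulrAC ler_wpM2r ?(cantor_radius_ge0 configNp)//.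
  by move: cnt g; move: (\sum_(_ <= _ < _) _) (\sum_(_ <= _ < _) _) ((N m)%:R) => *; lra.
apply: le_trans (_ : \sum_(0 <= i < P m) (if cantor_bad n j i then r m else 0) * (199 / 200) <= _).
  by apply: ler_sum => i _; exact: row.
by rewrite -mulr_suml -big_mkcond ler_wpM2r ?IH ?divr_ge0 ?ler0n.
Qed.

(** Points that lie in no good cell from generation [n] on; being null for all [n], almost every
    point lies in good cells infinitely often. *)
Let avoid n : set (R * R) :=
  \bigcap_m \bigcap_(k in [set k | [/\ (n <= m)%N, (k < P m.+1)%N & G m (k %% N m)%N]]) ~` D m.+1 k.

Let avoid_null n : mu (avoid n) = 0%E.
Proof.
have mA : measurable (avoid n).
  apply: bigcapT_measurable => m; apply: bigcap_measurableType => k _.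
  by apply: measurableC; exact: measurable_cantor_cell.
have le j : fine (mu (avoid n)) <= (199 / 200) ^+ j.
  apply: le_trans (cantor_bad_mass n j).
  apply: (@cantor_mass_le _ _ _ configNp mu muD (n + j) (P (n + j)) id) => // k z kP az Dk.
  exists k => //; rewrite kP /=.
  elim: j k kP Dk => // j IH k; rewrite addnS => kP Dk /=.
  rewrite IH ?(cantor_parent configNp)//; last exact: (cantor_cell_nested configNp).
  by apply/negP => Gk; apply: (az (n + j)%N I k) => //; split => //; exact: leq_addr.
apply/eqP; rewrite -fineK_prob// eqe eq_le mass_ge0 andbT.
apply/ler_addgt0Pr => e e0; rewrite add0r.
have : (199 / 200 : R) ^+ j @[j --> \oo] --> 0.
  by apply: cvg_expr; rewrite ger0_norm; lra.
move=> /cvgrPdist_lt /(_ e e0)[j _ /(_ j (leqnn j))] /=.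
rewrite sub0r normrN => je; apply: le_trans (le j) (le_trans (ler_norm _) (ltW je)).
Qed.

Lemma cantor_ae_not_pv : {ae mu, forall z : R * R, ~ pv_exists mu z}.
Proof.
have : mu.-negligible (\bigcup_n avoid n).
  apply: negligible_bigcup => n; exists (avoid n); split; [|exact: avoid_null|by []].
  apply: bigcapT_measurable => m; apply: bigcap_measurableType => k _.
  by apply: measurableC; exact: measurable_cantor_cell.
apply: negligibleS => z /= pv; apply: contrapT => az; apply: pv.
apply: cantor_not_pv => t t0; have [n rn] := cantor_radius_lt configNp t0.
apply: contrapT => none; apply: az; exists n => // m _ k [nm kP Gk] Dk; apply: none.
exists m, (k %/ N m)%N, (k %% N m)%N; split.
- by apply: le_lt_trans rn; exact: (cantor_radius_homo configNp).
- exact: (cantor_parent configNp).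
- exact: (cantor_digit configNp).
- by rewrite -divn_eq.
by apply: Gfar => //; exact: (cantor_digit configNp).
Qed.

End PrincipalValue.

(** * Pure unrectifiability *)

Section Curves.
Variable R : realType.
Implicit Types (a b : R) (g : R -> R * R) (s : seq R).

Lemma polygonal_length_ge a b g s (e : R) : 0 <= e -> uniq s ->
  {in s &, forall t t', t != t' -> e <= cdist (g t) (g t')} ->
  ((size s)%:R - 1) * e <= polygonal_length a b g (rcons s b).
Proof.
have dist0 z w : 0 <= cdist z w :> R by rewrite cdistE cabs_ge0.
move=> e0 us sep; rewrite /polygonal_length.
case: s us sep => [|x s] us sep.
  have : 0 <= \sum_(0 <= n < size (rcons [::] b))
      cdist ((g \o nth b (a :: rcons [::] b)) n.+1) ((g \o nth b (a :: rcons [::] b)) n).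
    by apply: sumr_ge0 => n _; exact: dist0.
  apply: le_trans; rewrite sub0r mulN1r oppr_le0//.
rewrite size_rcons /= big_nat_recl// big_nat_recr//=.
rewrite -[leLHS]add0r; apply: lerD; first exact: dist0.
rewrite -[leLHS]addr0; apply: lerD; last exact: dist0.
rewrite -natr1 addrK mulrC -[leLHS](_ : \sum_(0 <= n < size s) e = _); last first.
  by rewrite big_const_nat subn0 iter_addr_0 mulr_natr.
apply: ler_sum_nat => n /andP[_ ns].
have n1 : (n < size (x :: s))%N by exact: ltnW.
have nx : nth b (x :: rcons s b) n = nth b (x :: s) n.
  by rewrite -rcons_cons nth_rcons n1.
have nx1 : nth b (rcons s b) n = nth b (x :: s) n.+1 by rewrite nth_rcons ns.
rewrite nx nx1; apply: sep; rewrite ?mem_nth//.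
by rewrite nth_uniq// gtn_eqF.
Qed.

Lemma rectifiable_count a b g (L e : R) s : a < b -> 0 <= e ->
  ubound [set polygonal_length a b g s | s in itv_partition a b] L ->
  uniq s -> {in s, forall t, a <= t <= b} ->
  {in s &, forall t t', t != t' -> e <= cdist (g t) (g t')} ->
  ((size s)%:R - 3) * e <= L.
Proof.
move=> ab e0 Lub us sab sep.
(* A partition increases strictly from [a] and ends at [b]. Removing these two times from the list
   and appending [b] costs 2 points, and one more since [k] points bound [k - 1] chords. *)
pose inner := [pred t | a < t < b].
pose s' := sort <=%R [seq t <- s | inner t].
have mem' t : (t \in s') = inner t && (t \in s) by rewrite mem_sort mem_filter.
have us' : uniq s' by rewrite sort_uniq filter_uniq.
have part : itv_partition a b (rcons s' b).
  split; last by rewrite last_rcons.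
  rewrite rcons_path path_min_sorted; last by apply/allP => t; rewrite mem' => /andP[/andP[]].
  rewrite lt_sorted_uniq_le us' sort_le_sorted /=.
  have := mem_last a s'; rewrite inE => /predU1P[->//|].
  by rewrite mem' => /andP[/andP[]].
have len : ((size s')%:R - 1) * e <= L.
  apply: le_trans (Lub _ _); last by exists (rcons s' b); [exact: part|reflexivity].
  apply: polygonal_length_ge => // t t'; rewrite !mem' => /andP[_ ts] /andP[_ ts'].
  exact: sep.
have : (size s <= size s' + 2)%N.
  rewrite size_sort size_filter -(count_predC inner) leq_add2l -size_filter.
  rewrite -[2%N]/(size [:: a; b]); apply: uniq_leq_size; first exact: filter_uniq.
  move=> t; rewrite mem_filter /= !inE => /andP[out ts]; have := sab t ts.
  by rewrite !le_eqVlt eq_sym; move: out; case: (t == a) => //=; case: (t == b); rewrite ?andbT ?orbT//= => /negP.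
rewrite -(ler_nat R) natrD => sz; apply: le_trans len; rewrite ler_wpM2r//.
by move: sz; move: ((size s)%:R) ((size s')%:R) => *; lra.
Qed.

End Curves.

Section CantorUnrectifiable.
Variable R : realType.
Local Notation C := R[i].
Variables (N : nat -> nat) (p : nat -> nat -> C).
Hypothesis configNp : forall n, point_config (cantor_eps R n) (N n) (p n).
Local Notation P := (cantor_count N).
Local Notation r := (cantor_radius R N).
Local Notation cen := (cantor_center N p).
Local Notation D := (cantor_cell N p).
Local Notation E := (cantor_level N p).
Variable mu : probability (R * R)%type R.
Hypothesis muD : forall n k, (k < P n)%N -> mu (D n k) = (r n)%:E.

(** Points of the curve in distinct cells are [r n.+1 / (2 eps n)] apart, so it meets at most
    [3 + 2 eps n L / r n.+1] cells. Their total radius is of order [r n.+1 + eps n L], which tends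
    to 0. *)
Lemma cantor_purely_unrectifiable : purely_unrectifiable mu.
Proof.
move=> Gamma [a [b [g [ab _ [L Lub] ->]]]].
apply/eqP; rewrite eq_le hausdorff1_ge0 andbT.
have L1 : 0 < 1 + `|L| by rewrite ltr_pwDl.
apply/lee_addgt0Pr => /= e e0; rewrite add0e.
apply: hausdorff1_le => delta delta0.
(* The first bound makes the discs smaller than [delta], the second their total radius smaller than
   [e]; [1 + |L|] avoids dividing by 0. *)
pose c := Num.min (delta / 2) (e / (8 * (1 + `|L|))).
have c0 : 0 < c by rewrite lt_min !divr_gt0// mulr_gt0.
have : (2^-1 : R) ^+ n @[n --> \oo] --> 0.
  by apply: cvg_expr; rewrite ger0_norm//; lra.
move=> /cvgrPdist_lt /(_ c c0)[n _ /(_ n (leqnn n))] /=.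
rewrite sub0r normrN ger0_norm ?exprn_ge0// lt_min => /andP[nd ne].
have rn := cantor_radius_le_exp configNp n.
have r0 := cantor_radius_gt0 configNp n.+1.
have rS := cantor_radius_small configNp n.
pose met k := `[< exists t, [/\ a <= t, t <= b & D n.+1 k (g t)] >].
have [tau tauP] : exists tau : nat -> R, forall k, met k ->
    [/\ a <= tau k, tau k <= b & D n.+1 k (g (tau k))].
  suff /choice[tau tauP] : forall k, exists t, met k -> [/\ a <= t, t <= b & D n.+1 k (g t)].
    by exists tau.
  move=> k; have [/asboolP[t tP]|nm] := boolP (met k); first by exists t.
  by exists a.
pose K := [seq k <- iota 0 (P n.+1) | met k].
have memK k : (k \in K) = met k && (k < P n.+1)%N.
  by rewrite mem_filter mem_iota /= add0n.
have eps0 := cantor_eps_gt0 R n.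
have sep k l : k \in K -> l \in K -> k != l ->
    r n.+1 / (2 * cantor_eps R n) <= cdist (g (tau k)) (g (tau l)).
  rewrite !memK => /andP[/tauP[_ _ Dk] kP] /andP[/tauP[_ _ Dl] lP] kl.
  have := cantor_separated_eps configNp kP lP kl.
  have := cantor_separated configNp kP lP kl.
  move: Dk Dl; rewrite !cantor_cellE cdistE => Dk Dl sep100.
  have t1 := cabsB_trans (cplx (g (tau k))) (cen n.+1 k) (cen n.+1 l).
  have t2 := cabsB_trans (cplx (g (tau l))) (cplx (g (tau k))) (cen n.+1 l).
  rewrite (cabsBC (cen n.+1 k) (cplx (g (tau k)))) in t1.
  have half : cabs (cen n.+1 k - cen n.+1 l) <= 2 * cabs (cplx (g (tau k)) - cplx (g (tau l))).
    by move: Dk Dl sep100 t1 t2 r0; move: (r _) (cabs _) (cabs _) (cabs _) (cabs _) (cabs _) => *; lra.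
  move=> h; rewrite ler_pdivrMr ?mulr_gt0//; apply: le_trans h _.
  by rewrite [leRHS]mulrCA [leRHS]mulrA [leRHS]mulrC ler_wpM2l// ltW.
have tau_inj : {in K &, injective tau}.
  move=> k l kK lK kl; apply: contrapT => /eqP ne'; have := sep k l kK lK ne'.
  rewrite kl cdistE subrr cabs0 leNgt divr_gt0// mulr_gt0//.
have count : ((size K)%:R - 3) * (r n.+1 / (2 * cantor_eps R n)) <= L.
  rewrite -(size_map tau); apply: (rectifiable_count ab _ Lub).
  - by rewrite divr_ge0 ?mulr_ge0 ?ltW.
  - by rewrite map_inj_in_uniq// filter_uniq// iota_uniq.
  - by move=> t /mapP[k kK ->]; move: kK; rewrite memK => /andP[/tauP[-> ->]].
  move=> t t' /mapP[k kK ->] /mapP[l lK ->] kl; apply: sep => //.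
  by apply: contra_neq kl => ->.
exists (size K), (fun j => plane_of (cen n.+1 (nth 0%N K j))), (101 / 100 * r n.+1); split.
- by move: rn nd rS r0; move: (r n) (r n.+1) (_ ^+ n) => *; apply/andP; split; lra.
- have count' : ((size K)%:R - 3) * r n.+1 <= `|L| * (2 * cantor_eps R n).
    apply: le_trans (_ : L * (2 * cantor_eps R n) <= _).
      by rewrite -ler_pdivrMr ?mulr_gt0// -mulrA.
    by rewrite ler_wpM2r ?ler_norm// mulr_ge0// ltW.
  have eps1 : cantor_eps R n <= 2^-1 ^+ n.
    by rewrite /cantor_eps ler_piMl ?exprn_ge0// invf_le1//; lra.
  have Leps : `|L| * (2 * cantor_eps R n) <= `|L| * (2 * 2^-1 ^+ n).
    by rewrite ler_wpM2l// ler_pM2l.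
  move: ne; rewrite ltr_pdivlMr ?mulr_gt0//.
  have -> : 2^-1 ^+ n * (8 * (1 + `|L|)) = 8 * 2^-1 ^+ n + 4 * (`|L| * (2 * 2^-1 ^+ n)) by ring.
  have LL : 0 <= `|L| * (2 * 2^-1 ^+ n) by rewrite !mulr_ge0// exprn_ge0.
  have -> : ((size K)%:R + 1) * (101 / 100 * r n.+1) =
    101 / 100 * (((size K)%:R - 3) * r n.+1 + 4 * r n.+1) by ring.
  move: count' Leps LL rn rS r0.
  move: (((size K)%:R - 3) * r n.+1) (`|L| * (2 * cantor_eps R n)) (`|L| * (2 * 2^-1 ^+ n)) (2^-1 ^+ n) (r n) (r n.+1) => *; lra.
move=> z [[t tab gt] /(cantor_support_sub configNp muD n.+1)/cantor_levelP[k kP Dk]].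
have kK : k \in K.
  rewrite memK kP andbT; apply/asboolP; exists t; rewrite gt.
  by move: tab; rewrite /= in_itv /= => /andP[].
by exists (index k K); rewrite ?index_mem// nth_index.
Qed.

End CantorUnrectifiable.

Theorem mainTheorem2 (R : realType) :
  exists mu : probability (R * R)%type R,
    [/\ one_dimensional mu,
        purely_unrectifiable mu,
        (Linfty_norm (~` msupport mu) (huovinenT mu) < +oo)%E &
        {ae mu, forall z : R * R, ~ pv_exists mu z}].
Proof.
have ex n : exists Np : nat * (nat -> R[i]), point_config (cantor_eps R n) Np.1 Np.2.
  by have [N [p Np]] := exists_point_config (cantor_eps_gt0 R n); exists (N, p).
have [Np NpP] := choice ex.
pose N n := (Np n).1; pose p n := (Np n).2.
have configNp n : point_config (cantor_eps R n) (N n) (p n) := NpP n.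
have [mu muD] := exists_cantor_measure configNp.
have exG n := config_spread (configNp n).
have [G GP] := choice exG.
exists mu; split.
- exact: (cantor_one_dimensional configNp muD).
- exact: (cantor_purely_unrectifiable configNp muD).
- exact: (cantor_Linfty_norm configNp muD).
apply: (cantor_ae_not_pv configNp muD (G := G)) => [n|n d dN Gd]; first by have [] := GP n.
by have [_ /(_ d dN Gd)] := GP n.
Qed.
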